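(* Let $V$ be a MOSVA whose vertex operator map $Y_V$ satisfies the pole-order condition (with $W=V$, $Y_W^L=Y_V$). Let $W=\coprod_{m\in\mathbb C}W_{[m]}$ be a $\mathbb C$-graded vector space with a linear map $Y_W^L:V\otimes W\to W[[x,x^{-1}]]$ and linear operators $\mathbf d_W$ (weight $0$) and $D_W$ (weight $1$) satisfying: the axioms for the grading (items (i) of the definition of left module), the $D$-derivative property and $D$-commutator formula (item (iii)), the rationality of products of two vertex operators and of iterates of two vertex operators (item (iv) with $n\le 2$), associativity (item (v)), and the pole-order condition. Then for every $n\ge 1$, $u_1,\dots,u_n\in V$, $w\in W$, $w'\in W'$, the series $\langle w',Y_W^L(u_1,z_1)\cdots Y_W^L(u_n,z_n)w\rangle$ converges absolutely when $|z_1|>\cdots>|z_n|>0$ to a rational function with the only possible poles at $z_i=0$ ($i=1,\dots,n$) and $z_i=z_j$ ($i\neq j$). Moreover, for each $i$ the order of the pole $z_i=0$ is bounded above by an integer depending only on $u_i$ and $w$, and for each $1\le i<j\le n$ the order of the pole $z_i=z_j$ is bounded above by an integer depending only on $u_i$ and $u_j$.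
   Context: Conventions: $x$ denotes a formal variable, $z$'s complex variables. For a formal series $Y(u,x)=\sum_{k\in\mathbb Z}Y_k(u)x^{-k-1}$, a series such as $\langle w',Y(u_1,z_1)\cdots Y(u_n,z_n)w\rangle$ means the multiple complex series $\sum_{k_1,\dots,k_n}\langle w',Y_{k_1}(u_1)\cdots Y_{k_n}(u_n)w\rangle z_1^{-k_1-1}\cdots z_n^{-k_n-1}$; an iterate such as $\langle w',Y(Y(u_1,z_1-z_2)u_2,z_2)w\rangle$ means the double series in the variables $z_1-z_2$ and $z_2$ obtained from the coefficients. A meromorphic open-string vertex algebra (MOSVA) is a $\mathbb Z$-graded vector space $V=\coprod_{n\in\mathbb Z}V_{(n)}$ with a linear map $Y_V:V\otimes V\to V[[x,x^{-1}]]$, $u\otimes v\mapsto Y_V(u,x)v$, and a vacuum $\mathbf 1\in V$ such that: (i) $V_{(n)}=0$ for $n$ sufficiently negative; with $\mathbf d_Vv=nv$ for $v\in V_{(n)}$, $[\mathbf d_V,Y_V(v,x)]=x\frac{d}{dx}Y_V(v,x)+Y_V(\mathbf d_Vv,x)$; (ii) $Y_V(\mathbf 1,x)=1_V$, and $Y_V(u,x)\mathbf 1\in V[[x]]$ with $\lim_{x\to0}Y_V(u,x)\mathbf 1=u$; (iii) with $D_Vv=\lim_{x\to0}\frac{d}{dx}Y_V(v,x)\mathbf 1$, one has $\frac{d}{dx}Y_V(v,x)=Y_V(D_Vv,x)=[D_V,Y_V(v,x)]$; (iv) rationality: with $V'=\coprod_nV_{(n)}^*$, for all $u_1,\dots,u_n,v\in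 V$, $v'\in V'$, $\langle v',Y_V(u_1,z_1)\cdots Y_V(u_n,z_n)v\rangle$ converges absolutely for $|z_1|>\cdots>|z_n|>0$ to a rational function with only possible poles at $z_i=0$, $z_i=z_j$ ($i\ne j$), and $\langle v',Y_V(Y_V(u_1,z_1-z_2)u_2,z_2)v\rangle$ converges absolutely for $|z_2|>|z_1-z_2|>0$ to a rational function with only possible poles at $z_1=0,z_2=0,z_1=z_2$; (v) associativity: $\langle v',Y_V(u_1,z_1)Y_V(u_2,z_2)v\rangle=\langle v',Y_V(Y_V(u_1,z_1-z_2)u_2,z_2)v\rangle$ for $|z_1|>|z_2|>|z_1-z_2|>0$. A left $V$-module is a $\mathbb C$-graded vector space $W=\coprod_{m\in\mathbb C}W_{[m]}$ with a linear map $Y_W^L:V\otimes W\to W[[x,x^{-1}]]$, an operator $\mathbf d_W$ of weight $0$ and an operator $D_W$ of weight $1$ such that: (i) $W_{[m]}=0$ when $\mathrm{Re}(m)$ is sufficiently negative; $\mathbf d_Ww=mw$ for $w\in W_{[m]}$; $[\mathbf d_W,Y_W^L(u,x)]=Y_W^L(\mathbf d_Vu,x)+x\frac{d}{dx}Y_W^L(u,x)$; (ii) $Y_W^L(\mathbf 1,x)=1_W$; (iii) $\frac{d}{dx}Y_W^L(u,x)=Y_W^L(D_Vu,x)=[D_W,Y_W^L(u,x)]$; (iv) rationality: with $W'=\coprod_mW_{[m]}^*$, for $u_1,\dots,u_n\in V$, $w\in W$, $w'\in W'$, $\langle w',Y_W^L(u_1,z_1)\cdots Y_W^L(u_n,z_n)w\rangle$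 converges absolutely for $|z_1|>\cdots>|z_n|>0$ to a rational function with only possible poles at $z_i=0$ and $z_i=z_j$ ($i\neq j$), and $\langle w',Y_W^L(Y_V(u_1,z_1-z_2)u_2,z_2)w\rangle$ converges absolutely for $|z_2|>|z_1-z_2|>0$ to a rational function with only possible poles at $z_1=0,z_2=0,z_1=z_2$; (v) associativity: $\langle w',Y_W^L(u_1,z_1)Y_W^L(u_2,z_2)w\rangle=\langle w',Y_W^L(Y_V(u_1,z_1-z_2)u_2,z_2)w\rangle$ for $|z_1|>|z_2|>|z_1-z_2|>0$. Pole-order condition: for every $w'\in W'$, $u_1,u_2\in V$, $w\in W$, the order of the pole $z_1=0$ of the rational function to which $\langle w',Y_W^L(u_1,z_1)Y_W^L(u_2,z_2)w\rangle$ converges is bounded above by an integer depending only on $u_1$ and $w$ (not on $u_2$ or $w'$). *)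

(* Defs.v *)
From Stdlib Require Import Reals List ZArith.
Import ListNotations.
Open Scope R_scope.

Record C : Type := mkC { Re : R; Im : R }.
Definition C0 : C := mkC 0 0.
Definition C1 : C := mkC 1 0.
Definition Cadd (a b : C) : C := mkC (Re a + Re b) (Im a + Im b).
Definition Copp (a : C) : C := mkC (- Re a) (- Im a).
Definition Csub (a b : C) : C := Cadd a (Copp b).
Definition Cmul (a b : C) : C :=
  mkC (Re a * Re b - Im a * Im b) (Re a * Im b + Im a * Re b).
Definition Cnorm (a : C) : R := sqrt (Re a * Re a + Im a * Im a).
Definition Cinv (a : C) : C :=
  mkC (Re a / (Re a * Re a + Im a * Im a)) (- Im a / (Re a * Re a + Im a * Im a)).
Definition Cdiv (a b : C) : C := Cmul a (Cinv b).
Fixpoint Cpow (a : C) (n : nat) : C :=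
  match n with O => C1 | S m => Cmul a (Cpow a m) end.
Definition Czpow (a : C) (k : Z) : C :=
  match k with
  | Z0 => C1
  | Zpos p => Cpow a (Pos.to_nat p)
  | Zneg p => Cinv (Cpow a (Pos.to_nat p))
  end.
Definition CofZ (k : Z) : C := mkC (IZR k) 0.
Definition Csum (l : list C) : C := fold_right Cadd C0 l.
Definition Rsum (l : list R) : R := fold_right Rplus 0 l.

Record VSpace : Type := {
  vcar :> Type;
  vzero : vcar;
  vadd : vcar -> vcar -> vcar;
  vscale : C -> vcar -> vcar;
  vadd_assoc : forall x y z, vadd x (vadd y z) = vadd (vadd x y) z;
  vadd_comm : forall x y, vadd x y = vadd y x;
  vadd_0 : forall x, vadd vzero x = x;
  vadd_inv : forall x, exists y, vadd x y = vzero;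
  vscale_1 : forall x, vscale C1 x = x;
  vscale_assoc : forall a b x, vscale a (vscale b x) = vscale (Cmul a b) x;
  vscale_addv : forall a x y, vscale a (vadd x y) = vadd (vscale a x) (vscale a y);
  vscale_addC : forall a b x, vscale (Cadd a b) x = vadd (vscale a x) (vscale b x)
}.
Arguments vzero {v}.
Arguments vadd {v}.
Arguments vscale {v}.

Definition vsum {X : VSpace} (l : list X) : X := fold_right vadd vzero l.

Definition linear_map {X Y : VSpace} (f : X -> Y) : Prop :=
  forall (a : C) (x y : X), f (vadd x y) = vadd (f x) (f y) /\ f (vscale a x) = vscale a (f x).

Definition linear_functional {X : VSpace} (f : X -> C) : Prop :=
  forall (a : C) (x y : X), f (vadd x y) = Cadd (f x) (f y) /\ f (vscale a x) = Cmul a (f x).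

(** * Graded vector spaces  X = coprod_{i : I} X_i,  given by the projections
    proj i : X -> X_i  (so  x \in X_i  iff  proj i x = x). *)
Definition is_grading {I : Type} {X : VSpace} (proj : I -> X -> X) : Prop :=
  (forall i, linear_map (proj i)) /\
  (forall i j x, (i = j -> proj i (proj j x) = proj j x) /\
                 (i <> j -> proj i (proj j x) = vzero)) /\
  (forall x, exists S : list I, NoDup S /\ x = vsum (map (fun i => proj i x) S)).

(** graded dual  X' = coprod_i X_i^* : linear functionals vanishing on all but
    finitely many homogeneous components; the pairing <x', x> is  x' x. *)
Definition in_graded_dual {I : Type} {X : VSpace} (proj : I -> X -> X) (f : X -> C) : Prop :=
  linear_functional f /\
  exists S : list I, forall i x, ~ In i S -> f (proj i x) = C0.

Definition idx_ok (n : nat) (L : list (list Z)) : Prop :=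
  NoDup L /\ Forall (fun k => length k = n) L.

Definition abs_conv_to (n : nat) (a : list Z -> C) (s : C) : Prop :=
  (exists B : R, forall L, idx_ok n L -> Rsum (map (fun k => Cnorm (a k)) L) <= B) /\
  (forall eps : R, eps > 0 -> exists L0, idx_ok n L0 /\
     forall L, idx_ok n L -> incl L0 L -> Cnorm (Csub (Csum (map a L)) s) < eps).

(** * Rational functions of z_0,...,z_{n-1} whose only possible poles are at
    z_i = 0 and z_i = z_j:  p(z) / (prod_i z_i^{a i} prod_{i<j} (z_i - z_j)^{b i j}),
    p a polynomial (list of monomials  c * prod_i z_i^{e i}). *)
Definition poly := list (C * (nat -> nat)).

Fixpoint prod_upto (n : nat) (f : nat -> C) : C :=
  match n with O => C1 | S m => Cmul (prod_upto m f) (f m) end.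

Definition peval (n : nat) (p : poly) (z : nat -> C) : C :=
  Csum (map (fun ce => Cmul (fst ce) (prod_upto n (fun i => Cpow (z i) (snd ce i)))) p).

Definition denom (n : nat) (a : nat -> nat) (b : nat -> nat -> nat) (z : nat -> C) : C :=
  Cmul (prod_upto n (fun i => Cpow (z i) (a i)))
       (prod_upto n (fun j => prod_upto j (fun i => Cpow (Csub (z i) (z j)) (b i j)))).

Definition ratval (n : nat) (p : poly) (a : nat -> nat) (b : nat -> nat -> nat)
  (z : nat -> C) : C := Cdiv (peval n p z) (denom n a b z).

(** * Products and iterates of vertex operators.
    A vertex operator map  Y : U (x) X -> X[[x,x^{-1}]]  is encoded by its
    coefficients:  Y u w k = Y_k(u) w,  where  Y(u,x) w = sum_k Y_k(u) w x^{-k-1}. *)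
Fixpoint prodY {U X : VSpace} (Y : U -> X -> Z -> X) (us : list U) (ks : list Z) (w : X) : X :=
  match us, ks with
  | u :: us', k :: ks' => Y u (prodY Y us' ks' w) k
  | _, _ => w
  end.

Fixpoint zmono (z : nat -> C) (i : nat) (ks : list Z) : C :=
  match ks with
  | [] => C1
  | k :: ks' => Cmul (Czpow (z i) (- k - 1)%Z) (zmono z (S i) ks')
  end.

Definition prod_term {U X : VSpace} (Y : U -> X -> Z -> X) (w' : X -> C) (us : list U)
  (w : X) (z : nat -> C) (ks : list Z) : C :=
  Cmul (w' (prodY Y us ks w)) (zmono z 0 ks).

Definition iter_term {U X : VSpace} (YU : U -> U -> Z -> U) (Y : U -> X -> Z -> X)
  (w' : X -> C) (u1 u2 : U) (w : X) (z : nat -> C) (ks : list Z) : C :=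
  match ks with
  | [k; l] => Cmul (w' (Y (YU u1 u2 k) w l))
                   (Cmul (Czpow (Csub (z 0%nat) (z 1%nat)) (- k - 1)%Z) (Czpow (z 1%nat) (- l - 1)%Z))
  | _ => C0
  end.

Definition prod_dom (n : nat) (z : nat -> C) : Prop :=
  (forall i, (i < n)%nat -> 0 < Cnorm (z i)) /\
  (forall i, (S i < n)%nat -> Cnorm (z (S i)) < Cnorm (z i)).

Definition iter_dom (z : nat -> C) : Prop :=
  0 < Cnorm (Csub (z 0%nat) (z 1%nat)) /\ Cnorm (Csub (z 0%nat) (z 1%nat)) < Cnorm (z 1%nat).

Definition assoc_dom (z : nat -> C) : Prop :=
  Cnorm (z 1%nat) < Cnorm (z 0%nat) /\ iter_dom z.

Definition rational_products {U X : VSpace} {I : Type} (projX : I -> X -> X)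
  (Y : U -> X -> Z -> X) (n : nat) : Prop :=
  forall (us : list U) (w : X) (w' : X -> C), length us = n -> in_graded_dual projX w' ->
  exists (p : poly) (a : nat -> nat) (b : nat -> nat -> nat),
    forall z, prod_dom n z -> abs_conv_to n (prod_term Y w' us w z) (ratval n p a b z).

Definition rational_iterates {U X : VSpace} {I : Type} (projX : I -> X -> X)
  (YU : U -> U -> Z -> U) (Y : U -> X -> Z -> X) : Prop :=
  forall (u1 u2 : U) (w : X) (w' : X -> C), in_graded_dual projX w' ->
  exists (p : poly) (a : nat -> nat) (b : nat -> nat -> nat),
    forall z, iter_dom z -> abs_conv_to 2 (iter_term YU Y w' u1 u2 w z) (ratval 2 p a b z).

Definition associativity {U X : VSpace} {I : Type} (projX : I -> X -> X)
  (YU : U -> U -> Z -> U) (Y : U -> X -> Z -> X) : Prop :=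
  forall (u1 u2 : U) (w : X) (w' : X -> C) (z : nat -> C) (s1 s2 : C),
    in_graded_dual projX w' -> assoc_dom z ->
    abs_conv_to 2 (prod_term Y w' [u1; u2] w z) s1 ->
    abs_conv_to 2 (iter_term YU Y w' u1 u2 w z) s2 -> s1 = s2.

(** pole-order condition: the order of the pole z_1 = 0 of the rational function
    to which <w', Y(u_1,z_1) Y(u_2,z_2) w> converges is at most N u_1 w. *)
Definition pole_order_condition {U X : VSpace} {I : Type} (projX : I -> X -> X)
  (Y : U -> X -> Z -> X) : Prop :=
  exists N : U -> X -> nat,
  forall (u1 u2 : U) (w : X) (w' : X -> C), in_graded_dual projX w' ->
  exists (p : poly) (a : nat -> nat) (b : nat -> nat -> nat),
    (a 0%nat <= N u1 w)%nat /\
    forall z, prod_dom 2 z -> abs_conv_to 2 (prod_term Y w' [u1; u2] w z) (ratval 2 p a b z).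

(** * Meromorphic open-string vertex algebras
    projV n = projection onto V_(n); dV = the grading operator d_V;
    YV u v k = (Y_V)_k(u) v; one = vacuum; D_V v = (Y_V)_{-2}(v) 1. *)
Definition DVof {V : VSpace} (YV : V -> V -> Z -> V) (one : V) (v : V) : V := YV v one (-2)%Z.

Record is_MOSVA (V : VSpace) (projV : Z -> V -> V) (dV : V -> V)
    (YV : V -> V -> Z -> V) (one : V) : Prop := {
  mosva_grading : is_grading projV;
  mosva_lower : exists N : Z, forall n v, (n < N)%Z -> projV n v = vzero;
  mosva_d_lin : linear_map dV;
  mosva_d_eigen : forall n v, dV (projV n v) = vscale (CofZ n) (projV n v);
  mosva_Y_lin_l : forall v k, linear_map (fun u => YV u v k);
  mosva_Y_lin_r : forall u k, linear_map (fun v => YV u v k);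
  mosva_d_comm : forall u v k,
    dV (YV u v k) = vadd (YV u (dV v) k)
                         (vadd (vscale (CofZ (- k - 1)) (YV u v k)) (YV (dV u) v k));
  mosva_vac_id : forall v k, YV one v k = if Z.eqb k (-1) then v else vzero;
  mosva_creation : forall u k, (0 <= k)%Z -> YV u one k = vzero;
  mosva_creation_lim : forall u, YV u one (-1)%Z = u;
  mosva_D_deriv : forall v u k,
    YV (DVof YV one v) u k = vscale (CofZ (- k)) (YV v u (k - 1)%Z);
  mosva_D_comm : forall v u k,
    DVof YV one (YV v u k) =
      vadd (YV v (DVof YV one u) k) (vscale (CofZ (- k)) (YV v u (k - 1)%Z));
  mosva_rat_prod : forall n, rational_products projV YV n;
  mosva_rat_iter : rational_iterates projV YV YV;
  mosva_assoc : associativity projV YV YV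
}.

(** * The hypotheses on W in the theorem: items (i), (iii), (iv) for n <= 2,
    (v) of the definition of left module, and the pole-order condition.
    projW m = projection onto W_[m] (m complex). *)
Record weak_left_module (V : VSpace) (projV : Z -> V -> V) (dV : V -> V)
    (YV : V -> V -> Z -> V) (one : V)
    (W : VSpace) (projW : C -> W -> W) (YW : V -> W -> Z -> W) (dW DW : W -> W) : Prop := {
  wlm_grading : is_grading projW;
  wlm_lower : exists r : R, forall m w, Re m < r -> projW m w = vzero;
  wlm_d_lin : linear_map dW;
  wlm_d_eigen : forall m w, dW (projW m w) = vscale m (projW m w);
  wlm_D_lin : linear_map DW;
  wlm_D_weight : forall m w, projW (Cadd m C1) (DW (projW m w)) = DW (projW m w);
  wlm_Y_lin_l : forall w k, linear_map (fun u => YW u w k);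
  wlm_Y_lin_r : forall u k, linear_map (fun w => YW u w k);
  wlm_d_comm : forall u w k,
    dW (YW u w k) = vadd (YW u (dW w) k)
                         (vadd (vscale (CofZ (- k - 1)) (YW u w k)) (YW (dV u) w k));
  wlm_D_deriv : forall u w k,
    YW (DVof YV one u) w k = vscale (CofZ (- k)) (YW u w (k - 1)%Z);
  wlm_D_comm : forall u w k,
    DW (YW u w k) = vadd (YW u (DW w) k) (vscale (CofZ (- k)) (YW u w (k - 1)%Z));
  wlm_rat_prod : forall n, (1 <= n <= 2)%nat -> rational_products projW YW n;
  wlm_rat_iter : rational_iterates projW YV YW;
  wlm_assoc : associativity projW YV YW;
  wlm_pole : pole_order_condition projW YW
}.

(* Main.v *)
(** Pairing with a functional f turns Y(u_1,z_1)...Y(u_n,z_n)w into a family F of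
    complex numbers indexed by Z^n, on which polynomials in z act by shifts. With
    q the product of the z_i^N(u_i,w) and the (z_i - z_j)^M(u_i,u_j), it suffices that
    qF is supported on the exponents of a polynomial: F is then recovered by expanding
    1/q geometrically. By the grading the total degree of qF is bounded, so only
    negative powers of each z_i have to be excluded, and by induction only those of z_1.

    Rationality, associativity and the pole-order condition give weak associativity
    z_1^N Y(u_1,z_1)Y(u_2,z_2)w = z_1^N Y(Y(u_1,z_1-z_2)u_2,z_2)w with N depending only
    on u_1 and w. Since N does not depend on u_2, it applies successively to all the
    u_i, i < n, and replaces the product of n operators by
    Y(Y(u_1,y_1)...Y(u_{n-1},y_{n-1})u_n, z_n)w, y_i = z_i - z_n. The inner product has
    n - 1 factors and lives in V, so the induction hypothesis for the module V bounds
    its pole y_1 = 0, that is z_1 = z_n, by M(u_1,u_n) and its poles z_1 = z_j by M(u_1,u_j). *)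

From Stdlib Require Import Reals List ZArith Lra Lia Permutation Classical ClassicalEpsilon FunctionalExtensionality.
Require Import Defs.
Import ListNotations.
Open Scope R_scope.

Declare Scope C_scope.
Delimit Scope C_scope with C.
Bind Scope C_scope with C.
Infix "+" := Cadd : C_scope.
Infix "-" := Csub : C_scope.
Infix "*" := Cmul : C_scope.
Infix "/" := Cdiv : C_scope.
Notation "- x" := (Copp x) : C_scope.

(** Doubly infinite series do not form a ring: z_i - z_j kills the formal delta function, so a
    denominator cannot simply be cancelled. Every cancellation below is therefore licensed by a
    truncation property of the series at hand, and polynomials are handled as operators on
    coefficient families. Analysis enters in two places: two-variable identities are read off from
    values at real points, and the final division by q is a convergent geometric expansion. What
    lies between is formal. The passage from iterates back to products is a triangular change of
    variables, and triangularity is what carries the vanishing of negative powers back. Each such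
    step costs a power of z_i: for i = 1 this is the pole bound N(u_1,w), while for i > 1 it can be
    shifted away, since only the index of z_1 is constrained. Statements are kept uniform in the
    functional, because removing the leftmost operator replaces w' by its composite with a mode. *)

Definition RtoC (r : R) : C := mkC r 0.

(** * Complex numbers: field structure, norm, integer powers *)

Lemma C_ext (a b : C) : Re a = Re b -> Im a = Im b -> a = b.
Proof. destruct a, b; simpl; intros; subst; reflexivity. Qed.

Lemma C_ring_theory : ring_theory C0 C1 Cadd Cmul Csub Copp eq.
Proof. split; intros; apply C_ext; simpl; ring. Qed.

Lemma Csqn_pos (a : C) : a <> C0 -> 0 < Re a * Re a + Im a * Im a.
Proof.
  intros H. destruct a as [x y]; simpl.
  destruct (Req_dec x 0) as [->|Hx].
  - destruct (Req_dec y 0) as [->|Hy]; [now elim H|nra].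
  - nra.
Qed.

Lemma C_field_theory : field_theory C0 C1 Cadd Cmul Csub Copp Cdiv Cinv eq.
Proof.
  split.
  - exact C_ring_theory.
  - intros H. apply (f_equal Re) in H. simpl in H. lra.
  - reflexivity.
  - intros a H. apply Csqn_pos in H. apply C_ext; simpl; field; lra.
Qed.

Add Field C_field : C_field_theory.

Lemma Cnorm_ge0 (a : C) : 0 <= Cnorm a.
Proof. apply sqrt_pos. Qed.

Lemma Cnorm_0 : Cnorm C0 = 0.
Proof. unfold Cnorm; simpl. replace (0 * 0 + 0 * 0) with 0 by ring. apply sqrt_0. Qed.

Lemma Cnorm_pos (a : C) : a <> C0 -> 0 < Cnorm a.
Proof. intros H. apply sqrt_lt_R0. now apply Csqn_pos. Qed.

Lemma Cnorm_pos_neq0 (a : C) : 0 < Cnorm a -> a <> C0.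
Proof. intros H ->. rewrite Cnorm_0 in H. lra. Qed.

Lemma Cnorm_mul (a b : C) : Cnorm (a * b) = Cnorm a * Cnorm b.
Proof.
  unfold Cnorm. rewrite <- sqrt_mult by nra. f_equal. simpl. ring.
Qed.

Lemma Cnorm_RtoC (r : R) : 0 <= r -> Cnorm (RtoC r) = r.
Proof.
  intros H. unfold Cnorm; simpl. replace (r * r + 0 * 0) with (r * r) by ring.
  now apply sqrt_square.
Qed.

Lemma Cnorm_1 : Cnorm C1 = 1.
Proof. change C1 with (RtoC 1). apply Cnorm_RtoC. lra. Qed.

Lemma Cnorm_triangle (a b : C) : Cnorm (a + b) <= Cnorm a + Cnorm b.
Proof.
  unfold Cnorm.
  set (p := Re a * Re a + Im a * Im a). set (q := Re b * Re b + Im b * Im b).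
  assert (Hp : 0 <= p) by (unfold p; nra). assert (Hq : 0 <= q) by (unfold q; nra).
  pose proof (sqrt_pos p) as H1. pose proof (sqrt_pos q) as H2.
  pose proof (sqrt_sqrt p Hp) as H3. pose proof (sqrt_sqrt q Hq) as H4.
  rewrite <- (sqrt_square (sqrt p + sqrt q)) by lra.
  apply sqrt_le_1_alt. simpl.
  assert (H : Re a * Re b + Im a * Im b <= sqrt p * sqrt q).
  { rewrite <- sqrt_mult by assumption.
    apply Rle_trans with (Rabs (Re a * Re b + Im a * Im b)); [apply Rle_abs|].
    rewrite <- sqrt_Rsqr_abs. apply sqrt_le_1_alt. unfold Rsqr, p, q.
    pose proof (Rle_0_sqr (Re a * Im b - Im a * Re b)). unfold Rsqr in *. lra. }
  replace ((sqrt p + sqrt q) * (sqrt p + sqrt q))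
    with (sqrt p * sqrt p + sqrt q * sqrt q + 2 * (sqrt p * sqrt q)) by ring.
  rewrite H3, H4. unfold p at 1, q at 1. lra.
Qed.

Lemma Cnorm_opp (a : C) : Cnorm (- a) = Cnorm a.
Proof. unfold Cnorm; simpl. f_equal. ring. Qed.

Lemma Cnorm_sub_triangle (a b : C) : Cnorm (a - b) <= Cnorm a + Cnorm b.
Proof.
  unfold Csub. eapply Rle_trans; [apply Cnorm_triangle|]. rewrite Cnorm_opp. lra.
Qed.

Lemma Cnorm_ge_Re (a : C) : Rabs (Re a) <= Cnorm a.
Proof. rewrite <- sqrt_Rsqr_abs. apply sqrt_le_1_alt. unfold Rsqr.
  pose proof (Rle_0_sqr (Re a)). pose proof (Rle_0_sqr (Im a)). unfold Rsqr in *. lra. Qed.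

Lemma Cnorm_ge_Im (a : C) : Rabs (Im a) <= Cnorm a.
Proof. rewrite <- sqrt_Rsqr_abs. apply sqrt_le_1_alt. unfold Rsqr.
  pose proof (Rle_0_sqr (Re a)). pose proof (Rle_0_sqr (Im a)). unfold Rsqr in *. lra. Qed.

Lemma Cnorm_le_ReIm (a : C) : Cnorm a <= Rabs (Re a) + Rabs (Im a).
Proof.
  pose proof (Rabs_pos (Re a)). pose proof (Rabs_pos (Im a)).
  unfold Cnorm. rewrite <- (sqrt_square (Rabs (Re a) + Rabs (Im a))) by lra.
  apply sqrt_le_1_alt.
  replace (Re a * Re a) with (Rabs (Re a) * Rabs (Re a)) by (rewrite <- Rabs_mult; apply Rabs_pos_eq; nra).
  replace (Im a * Im a) with (Rabs (Im a) * Rabs (Im a)) by (rewrite <- Rabs_mult; apply Rabs_pos_eq; nra).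
  nra.
Qed.

Lemma Cnorm_eq0 (a : C) : Cnorm a <= 0 -> a = C0.
Proof.
  intros H. destruct (classic (a = C0)) as [E|E]; [exact E|].
  apply Cnorm_pos in E. lra.
Qed.

Lemma C1_neq0 : C1 <> C0.
Proof. intros H. apply (f_equal Re) in H. simpl in H. lra. Qed.

Lemma Cmul_eq0 (a b : C) : (a * b)%C = C0 -> a <> C0 -> b = C0.
Proof.
  intros H Ha. replace b with (Cinv a * (a * b))%C by (field; assumption).
  rewrite H. ring.
Qed.

Lemma Cmul_neq0 (a b : C) : a <> C0 -> b <> C0 -> (a * b)%C <> C0.
Proof. intros Ha Hb H. apply Hb. eapply Cmul_eq0; eassumption. Qed.

Lemma Cinv_neq0 (a : C) : a <> C0 -> Cinv a <> C0.
Proof.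
  intros Ha H. apply C1_neq0. replace C1 with (Cinv a * a)%C by (field; assumption).
  rewrite H. ring.
Qed.

Lemma Cpow_neq0 (a : C) (n : nat) : a <> C0 -> Cpow a n <> C0.
Proof. intros Ha. induction n; simpl; [apply C1_neq0|now apply Cmul_neq0]. Qed.

Lemma Czpow_neq0 (a : C) (k : Z) : a <> C0 -> Czpow a k <> C0.
Proof.
  intros Ha. destruct k; simpl; [apply C1_neq0| |apply Cinv_neq0]; now apply Cpow_neq0.
Qed.

Lemma Czpow_nat (a : C) (n : nat) : Czpow a (Z.of_nat n) = Cpow a n.
Proof. destruct n; [reflexivity|]. simpl. now rewrite SuccNat2Pos.id_succ. Qed.

Lemma Czpow_opp_nat (a : C) (n : nat) : Czpow a (- Z.of_nat n) = Cinv (Cpow a n).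
Proof.
  destruct n; simpl.
  - apply C_ext; simpl; field.
  - now rewrite SuccNat2Pos.id_succ.
Qed.

Lemma Czpow_succ (a : C) (k : Z) : a <> C0 -> Czpow a (k + 1) = (a * Czpow a k)%C.
Proof.
  intros Ha. destruct (Z_le_gt_dec 0 k) as [Hk|Hk].
  - rewrite <- (Z2Nat.id k) by lia. replace (Z.of_nat (Z.to_nat k) + 1)%Z with (Z.of_nat (S (Z.to_nat k))) by lia.
    now rewrite !Czpow_nat.
  - replace k with (- Z.of_nat (S (Z.to_nat (- k - 1))))%Z by lia.
    set (n := Z.to_nat (- k - 1)).
    replace (- Z.of_nat (S n) + 1)%Z with (- Z.of_nat n)%Z by lia.
    rewrite !Czpow_opp_nat. simpl. field. split; [now apply Cpow_neq0|assumption].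
Qed.

(** Integer powers are defined by cases on the sign; characterising them by a one-step recurrence
    yields the exponent laws below without a case analysis for each. *)
Lemma Czpow_unique (a : C) (h : Z -> C) :
  a <> C0 -> (forall k, h (k + 1)%Z = (a * h k)%C) ->
  forall k, h k = (Czpow a k * h 0%Z)%C.
Proof.
  intros Ha Hh. apply Z.peano_ind.
  - simpl. ring.
  - intros k IH. change (Z.succ k) with (k + 1)%Z. rewrite Hh, Czpow_succ, IH by assumption. ring.
  - intros k IH. assert (E : (a * h (Z.pred k))%C = (a * (Czpow a (Z.pred k) * h 0%Z))%C).
    { rewrite <- Hh. replace (Z.pred k + 1)%Z with k by lia. rewrite IH.
      replace (Czpow a k) with (a * Czpow a (Z.pred k))%C; [ring|].
      rewrite <- Czpow_succ by assumption. f_equal. lia. }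
    replace (h (Z.pred k)) with (Cinv a * (a * h (Z.pred k)))%C by (field; assumption).
    rewrite E. field. assumption.
Qed.

Lemma Czpow_add (a : C) (k l : Z) : a <> C0 -> Czpow a (k + l) = (Czpow a k * Czpow a l)%C.
Proof.
  intros Ha. rewrite (Czpow_unique a (fun k => Czpow a (k + l)) Ha); [reflexivity|].
  intros j. rewrite <- Czpow_succ by assumption. f_equal. lia.
Qed.

Lemma Czpow_Czpow (a : C) (k l : Z) : a <> C0 -> Czpow (Czpow a k) l = Czpow a (k * l).
Proof.
  intros Ha. rewrite (Czpow_unique (Czpow a k) (fun l => Czpow a (k * l))).
  - rewrite Z.mul_0_r. simpl. ring.
  - now apply Czpow_neq0.
  - intros j. rewrite <- Czpow_add by assumption. f_equal. lia.
Qed.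

Lemma Czpow_mul_base (a b : C) (k : Z) :
  a <> C0 -> b <> C0 -> Czpow (a * b) k = (Czpow a k * Czpow b k)%C.
Proof.
  intros Ha Hb. rewrite (Czpow_unique (a * b) (fun k => Czpow a k * Czpow b k)%C).
  - simpl. ring.
  - now apply Cmul_neq0.
  - intros j. rewrite !Czpow_succ by assumption. ring.
Qed.

Lemma Cnorm_Czpow_pos (a : C) (k : Z) : a <> C0 -> 0 < Cnorm (Czpow a k).
Proof. intros Ha. apply Cnorm_pos. now apply Czpow_neq0. Qed.

Lemma Cnorm_Czpow_mono (r : R) (k l : Z) :
  1 <= r -> (k <= l)%Z -> Cnorm (Czpow (RtoC r) k) <= Cnorm (Czpow (RtoC r) l).
Proof.
  intros Hr Hkl. assert (Hr0 : RtoC r <> C0) by (apply Cnorm_pos_neq0; rewrite Cnorm_RtoC; lra).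
  replace l with (Z.of_nat (Z.to_nat (l - k)) + k)%Z by lia.
  induction (Z.to_nat (l - k)) as [|n IH].
  - apply Rle_refl.
  - eapply Rle_trans; [exact IH|].
    replace (Z.of_nat (S n) + k)%Z with (Z.of_nat n + k + 1)%Z by lia.
    rewrite Czpow_succ, Cnorm_mul, Cnorm_RtoC by (assumption || lra).
    pose proof (Cnorm_ge0 (Czpow (RtoC r) (Z.of_nat n + k))). nra.
Qed.

Lemma Czpow_RtoC (r : R) (k : Z) : 0 < r -> exists x, 0 < x /\ Czpow (RtoC r) k = RtoC x.
Proof.
  intros Hr. assert (Hp : forall n, exists x, 0 < x /\ Cpow (RtoC r) n = RtoC x).
  { induction n as [|n [x [Hx E]]]; simpl.
    - exists 1. split; [lra|reflexivity].
    - exists (r * x). split; [nra|]. rewrite E. apply C_ext; simpl; ring. }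
  destruct k as [|p|p]; simpl.
  - exists 1. split; [lra|reflexivity].
  - apply Hp.
  - destruct (Hp (Pos.to_nat p)) as [x [Hx E]]. rewrite E. exists (/ x).
    split; [now apply Rinv_0_lt_compat|]. apply C_ext; simpl; field; nra.
Qed.

(** * Finite sums *)

Lemma Csum_app (l1 l2 : list C) : Csum (l1 ++ l2) = (Csum l1 + Csum l2)%C.
Proof. induction l1; simpl; [ring|]. rewrite IHl1. ring. Qed.

Lemma Rsum_app (l1 l2 : list R) : Rsum (l1 ++ l2) = Rsum l1 + Rsum l2.
Proof. induction l1; simpl; [ring|]. rewrite IHl1. ring. Qed.

Lemma Csum_perm (l1 l2 : list C) : Permutation l1 l2 -> Csum l1 = Csum l2.
Proof. induction 1; simpl; congruence || ring. Qed.

Lemma Rsum_perm (l1 l2 : list R) : Permutation l1 l2 -> Rsum l1 = Rsum l2.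
Proof. induction 1; simpl; congruence || ring. Qed.

Section Sums.
Context {A : Type}.
Implicit Types (l : list A).

Lemma Csum_map_add (f g : A -> C) l :
  Csum (map (fun x => f x + g x)%C l) = (Csum (map f l) + Csum (map g l))%C.
Proof. induction l; simpl; [ring|]. rewrite IHl. ring. Qed.

Lemma Csum_map_scale (c : C) (f : A -> C) l :
  Csum (map (fun x => c * f x)%C l) = (c * Csum (map f l))%C.
Proof. induction l; simpl; [ring|]. rewrite IHl. ring. Qed.

Lemma Rsum_map_add (f g : A -> R) l :
  Rsum (map (fun x => f x + g x) l) = Rsum (map f l) + Rsum (map g l).
Proof. induction l; simpl; [ring|]. rewrite IHl. ring. Qed.

Lemma Rsum_map_scale (c : R) (f : A -> R) l :
  Rsum (map (fun x => c * f x) l) = c * Rsum (map f l).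
Proof. induction l; simpl; [ring|]. rewrite IHl. ring. Qed.

Lemma Rsum_map_le (f g : A -> R) l :
  (forall x, In x l -> f x <= g x) -> Rsum (map f l) <= Rsum (map g l).
Proof.
  induction l; simpl; intros H; [lra|].
  apply Rplus_le_compat; [apply H; auto|apply IHl; auto].
Qed.

Lemma Rsum_map_ge0 (f : A -> R) l : (forall x, In x l -> 0 <= f x) -> 0 <= Rsum (map f l).
Proof.
  induction l; simpl; intros H; [lra|].
  apply Rplus_le_le_0_compat; [apply H; auto|apply IHl; auto].
Qed.

Lemma Csum_map_zero (f : A -> C) l : (forall x, In x l -> f x = C0) -> Csum (map f l) = C0.
Proof.
  induction l; simpl; intros H; [reflexivity|].
  rewrite H, IHl by auto. ring.
Qed.

Lemma Cnorm_Csum_map (f : A -> C) l :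
  Cnorm (Csum (map f l)) <= Rsum (map (fun x => Cnorm (f x)) l).
Proof.
  induction l; simpl; [rewrite Cnorm_0; lra|].
  eapply Rle_trans; [apply Cnorm_triangle|lra].
Qed.

Lemma incl_NoDup_split (L0 L : list A) :
  NoDup L0 -> incl L0 L -> exists L1, Permutation L (L0 ++ L1).
Proof.
  revert L. induction L0 as [|x L0 IH]; intros L Hnd Hi.
  - now exists L.
  - inversion Hnd as [|? ? Hx Hnd']; subst.
    destruct (in_split x L) as (l1 & l2 & ->); [apply Hi; now left|].
    destruct (IH (l1 ++ l2)) as [L1 HL1]; [assumption| |].
    + intros y Hy. assert (Hy' : In y (l1 ++ x :: l2)) by (apply Hi; now right).
      apply in_app_or in Hy'. apply in_or_app. destruct Hy' as [|[->|]]; auto. contradiction.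
    + exists L1. simpl. rewrite <- HL1. symmetry. apply Permutation_middle.
Qed.

Lemma Rsum_incl (f : A -> R) (L0 L : list A) :
  (forall x, 0 <= f x) -> NoDup L0 -> incl L0 L -> Rsum (map f L0) <= Rsum (map f L).
Proof.
  intros Hf Hnd Hi. destruct (incl_NoDup_split L0 L Hnd Hi) as [L1 HL1].
  rewrite (Rsum_perm _ _ (Permutation_map f HL1)), map_app, Rsum_app.
  pose proof (Rsum_map_ge0 f L1 (fun x _ => Hf x)). lra.
Qed.

End Sums.

(** * Absolutely convergent multiple series *)

Lemma idx_ok_union (n : nat) (L1 L2 : list (list Z)) :
  idx_ok n L1 -> idx_ok n L2 -> exists L, idx_ok n L /\ incl L1 L /\ incl L2 L.
Proof.
  intros [H1 F1] [H2 F2].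
  exists (nodup (list_eq_dec Z.eq_dec) (L1 ++ L2)). split; [split|split].
  - apply NoDup_nodup.
  - apply Forall_forall. intros x Hx. apply nodup_In, in_app_or in Hx.
    rewrite Forall_forall in F1, F2. destruct Hx; auto.
  - intros x Hx. apply nodup_In, in_or_app. now left.
  - intros x Hx. apply nodup_In, in_or_app. now right.
Qed.

Lemma abs_conv_unique (n : nat) (a : list Z -> C) (s t : C) :
  abs_conv_to n a s -> abs_conv_to n a t -> s = t.
Proof.
  intros [_ Hs] [_ Ht].
  assert (H : Cnorm (s - t) <= 0).
  { apply Rnot_lt_le. intros Hlt.
    destruct (Hs (Cnorm (s - t) / 2)) as (L1 & O1 & H1); [lra|].
    destruct (Ht (Cnorm (s - t) / 2)) as (L2 & O2 & H2); [lra|].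
    destruct (idx_ok_union n L1 L2 O1 O2) as (L & O & I1 & I2).
    specialize (H1 L O I1). specialize (H2 L O I2).
    pose proof (Cnorm_sub_triangle (Csum (map a L) - t) (Csum (map a L) - s)) as H.
    replace (Csum (map a L) - t - (Csum (map a L) - s))%C with (s - t)%C in H by ring.
    lra. }
  apply Cnorm_eq0 in H. replace s with (s - t + t)%C by ring. rewrite H. ring.
Qed.

Lemma abs_conv_ext (n : nat) (a b : list Z -> C) (s : C) :
  (forall k, length k = n -> a k = b k) -> abs_conv_to n a s -> abs_conv_to n b s.
Proof.
  intros E [[B HB] Hs].
  assert (E' : forall L, idx_ok n L -> map a L = map b L).
  { intros L [_ HL]. apply map_ext_in. intros x Hx. apply E.
    rewrite Forall_forall in HL. auto. }
  split.
  - exists B. intros L HL. specialize (HB L HL).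
    rewrite <- (map_map b Cnorm), <- E' by assumption. now rewrite map_map.
  - intros eps He. destruct (Hs eps He) as (L0 & O0 & H0).
    exists L0. split; [assumption|]. intros L HL Hi. rewrite <- E' by assumption. now apply H0.
Qed.

Lemma abs_conv_add (n : nat) (a b : list Z -> C) (s t : C) :
  abs_conv_to n a s -> abs_conv_to n b t -> abs_conv_to n (fun k => a k + b k)%C (s + t).
Proof.
  intros [[B1 HB1] Hs] [[B2 HB2] Ht]. split.
  - exists (B1 + B2). intros L HL. specialize (HB1 L HL). specialize (HB2 L HL).
    eapply Rle_trans; [apply (Rsum_map_le _ (fun k => Cnorm (a k) + Cnorm (b k)))|].
    + intros; apply Cnorm_triangle.
    + rewrite Rsum_map_add. lra.
  - intros eps He.
    destruct (Hs (eps / 2)) as (L1 & O1 & H1); [lra|].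
    destruct (Ht (eps / 2)) as (L2 & O2 & H2); [lra|].
    destruct (idx_ok_union n L1 L2 O1 O2) as (L0 & O & I1 & I2).
    exists L0. split; [assumption|]. intros L HL Hi.
    specialize (H1 L HL (incl_tran I1 Hi)). specialize (H2 L HL (incl_tran I2 Hi)).
    rewrite Csum_map_add.
    replace (Csum (map a L) + Csum (map b L) - (s + t))%C
      with ((Csum (map a L) - s) + (Csum (map b L) - t))%C by ring.
    eapply Rle_lt_trans; [apply Cnorm_triangle|lra].
Qed.

Lemma abs_conv_scale (n : nat) (a : list Z -> C) (c s : C) :
  abs_conv_to n a s -> abs_conv_to n (fun k => c * a k)%C (c * s).
Proof.
  intros [[B HB] Hs]. pose proof (Cnorm_ge0 c) as Hc. split.
  - exists (Cnorm c * B). intros L HL.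
    rewrite (map_ext _ (fun k => Cnorm c * Cnorm (a k))) by (intros; apply Cnorm_mul).
    rewrite Rsum_map_scale. apply Rmult_le_compat_l; auto.
  - intros eps He.
    destruct (Hs (eps / (Cnorm c + 1))) as (L0 & O0 & H0).
    { apply Rdiv_lt_0_compat; lra. }
    exists L0. split; [assumption|]. intros L HL Hi. specialize (H0 L HL Hi).
    rewrite Csum_map_scale.
    replace (c * Csum (map a L) - c * s)%C with (c * (Csum (map a L) - s))%C by ring.
    rewrite Cnorm_mul.
    apply Rle_lt_trans with (Cnorm c * (eps / (Cnorm c + 1))).
    + apply Rmult_le_compat_l; lra.
    + apply Rlt_le_trans with ((Cnorm c + 1) * (eps / (Cnorm c + 1))).
      * apply Rmult_lt_compat_r; [apply Rdiv_lt_0_compat|]; lra.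
      * right. field. lra.
Qed.

Lemma idx_ok_map (n : nat) (phi psi : list Z -> list Z) (L : list (list Z)) :
  (forall k, length k = n -> length (phi k) = n) ->
  (forall k, length k = n -> psi (phi k) = k) ->
  idx_ok n L -> idx_ok n (map phi L).
Proof.
  intros Hl Hp [Hnd HL]. rewrite Forall_forall in HL. split.
  - induction L as [|x L IH]; simpl; constructor.
    + intros Hin. apply in_map_iff in Hin. destruct Hin as (y & Ey & Hy).
      inversion Hnd as [|? ? Hx ?]; subst. apply Hx.
      rewrite <- (Hp x), <- Ey, Hp by (apply HL; simpl; auto). assumption.
    + inversion Hnd; subst. apply IH; auto. intros; apply HL; now right.
  - apply Forall_forall. intros x Hx. apply in_map_iff in Hx. destruct Hx as (y & <- & Hy). auto.
Qed.

Lemma abs_conv_reindex (n : nat) (phi psi : list Z -> list Z) (a : list Z -> C) (s : C) :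
  (forall k, length k = n -> length (phi k) = n) ->
  (forall k, length k = n -> length (psi k) = n) ->
  (forall k, length k = n -> psi (phi k) = k) ->
  (forall k, length k = n -> phi (psi k) = k) ->
  abs_conv_to n a s -> abs_conv_to n (fun k => a (phi k)) s.
Proof.
  intros H1 H2 H3 H4 [[B HB] Hs]. split.
  - exists B. intros L HL. rewrite <- (map_map phi (fun k => Cnorm (a k))).
    apply HB. now apply idx_ok_map with psi.
  - intros eps He. destruct (Hs eps He) as (L0 & O0 & H0).
    exists (map psi L0). split; [now apply idx_ok_map with phi|].
    intros L HL Hi. rewrite <- (map_map phi a). apply H0.
    + now apply idx_ok_map with psi.
    + intros x Hx. apply in_map_iff. exists (psi x). split.
      * apply H4. destruct O0 as [_ O0]. rewrite Forall_forall in O0. auto.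
      * apply Hi, in_map_iff. now exists x.
Qed.

Lemma nonneg_bounded_conv (n : nat) (r : list Z -> R) (B : R) :
  (forall k, 0 <= r k) -> (forall L, idx_ok n L -> Rsum (map r L) <= B) ->
  exists s, forall eps, eps > 0 -> exists L0, idx_ok n L0 /\
    forall L, idx_ok n L -> incl L0 L -> Rabs (Rsum (map r L) - s) < eps.
Proof.
  intros Hr HB.
  destruct (completeness (fun x => exists L, idx_ok n L /\ x = Rsum (map r L))) as [s [Hub Hlub]].
  - exists B. intros x (L & HL & ->). auto.
  - exists 0. exists nil. split; [split; constructor|reflexivity].
  - exists s. intros eps He.
    assert (Hex : exists L0, idx_ok n L0 /\ s - eps < Rsum (map r L0)).
    { apply NNPP. intros Hn. assert (s <= s - eps); [|lra].
      apply Hlub. intros x (L & HL & ->). apply Rnot_lt_le. intros Hlt. apply Hn. now exists L. }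
    destruct Hex as (L0 & O0 & H0). exists L0. split; [assumption|].
    intros L HL Hi. assert (H1 := Rsum_incl r L0 L Hr (proj1 O0) Hi).
    assert (Rsum (map r L) <= s) by (apply Hub; now exists L).
    apply Rabs_def1; lra.
Qed.

Lemma Re_Csum {A : Type} (a : A -> C) (L : list A) : Re (Csum (map a L)) = Rsum (map (fun k => Re (a k)) L).
Proof. induction L; simpl; [reflexivity|]. now rewrite IHL. Qed.

Lemma Im_Csum {A : Type} (a : A -> C) (L : list A) : Im (Csum (map a L)) = Rsum (map (fun k => Im (a k)) L).
Proof. induction L; simpl; [reflexivity|]. now rewrite IHL. Qed.

Lemma abs_bounded_conv (n : nat) (a : list Z -> C) (B : R) :
  (forall L, idx_ok n L -> Rsum (map (fun k => Cnorm (a k)) L) <= B) ->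
  exists s, abs_conv_to n a s.
Proof.
  intros HB.
  (* For h = Re or Im, write h = (|a| + h) - |a|, a difference of two nonnegative families with
     bounded partial sums. *)
  assert (Hpart : forall h : C -> R, (forall c, Rabs (h c) <= Cnorm c) ->
    exists s, forall eps, eps > 0 -> exists L0, idx_ok n L0 /\
    forall L, idx_ok n L -> incl L0 L -> Rabs (Rsum (map (fun k => h (a k)) L) - s) < eps).
  { intros h Hh.
    destruct (nonneg_bounded_conv n (fun k => Cnorm (a k)) B) as [s0 H0]; [intros; apply Cnorm_ge0|exact HB|].
    destruct (nonneg_bounded_conv n (fun k => Cnorm (a k) + h (a k)) (2 * B)) as [s1 H1].
    - intros k. specialize (Hh (a k)). pose proof (Rle_abs (- h (a k))); rewrite Rabs_Ropp in *; pose proof (Rle_abs (h (a k))). lra.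
    - intros L HL. eapply Rle_trans; [apply (Rsum_map_le _ (fun k => 2 * Cnorm (a k)))|].
      + intros k _. specialize (Hh (a k)). pose proof (Rle_abs (- h (a k))); rewrite Rabs_Ropp in *; pose proof (Rle_abs (h (a k))). lra.
      + rewrite Rsum_map_scale. specialize (HB L HL). lra.
    - exists (s1 - s0). intros eps He.
      destruct (H0 (eps / 2)) as (L1 & O1 & K1); [lra|].
      destruct (H1 (eps / 2)) as (L2 & O2 & K2); [lra|].
      destruct (idx_ok_union n L1 L2 O1 O2) as (L0 & O & I1 & I2).
      exists L0. split; [assumption|]. intros L HL Hi.
      specialize (K1 L HL (incl_tran I1 Hi)). specialize (K2 L HL (incl_tran I2 Hi)).
      rewrite Rsum_map_add in K2. apply Rabs_def2 in K1, K2. apply Rabs_def1; lra. }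
  destruct (Hpart Re Cnorm_ge_Re) as [sr Hr]. destruct (Hpart Im Cnorm_ge_Im) as [si Hi].
  exists (mkC sr si). split; [now exists B|].
  intros eps He.
  destruct (Hr (eps / 2)) as (L1 & O1 & K1); [lra|].
  destruct (Hi (eps / 2)) as (L2 & O2 & K2); [lra|].
  destruct (idx_ok_union n L1 L2 O1 O2) as (L0 & O & I1 & I2).
  exists L0. split; [assumption|]. intros L HL HiL.
  specialize (K1 L HL (incl_tran I1 HiL)). specialize (K2 L HL (incl_tran I2 HiL)).
  eapply Rle_lt_trans; [apply Cnorm_le_ReIm|]. simpl.
  rewrite Re_Csum, Im_Csum. unfold Rminus in *. lra.
Qed.

Lemma abs_conv_finite (n : nat) (a : list Z -> C) (L0 : list (list Z)) :
  idx_ok n L0 -> (forall k, length k = n -> ~ In k L0 -> a k = C0) ->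
  abs_conv_to n a (Csum (map a L0)).
Proof.
  intros O0 Ha.
  assert (Hsplit : forall L, idx_ok n L -> incl L0 L ->
    exists L1, Permutation L (L0 ++ L1) /\ forall k, In k L1 -> a k = C0).
  { intros L [Hnd HL] Hi. destruct (incl_NoDup_split L0 L (proj1 O0) Hi) as [L1 HL1].
    exists L1. split; [assumption|]. intros k Hk.
    assert (Hnd' := Permutation_NoDup HL1 Hnd).
    apply Ha.
    - rewrite Forall_forall in HL. apply HL. apply (Permutation_in _ (Permutation_sym HL1)).
      apply in_or_app. now right.
    - intros Hk0. clear - Hnd' Hk Hk0. induction L0 as [|x L0 IH]; [contradiction|].
      simpl in Hnd'. inversion Hnd' as [|? ? Hx Hn]; subst. destruct Hk0 as [->|Hk0].
      + apply Hx, in_or_app. now right.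
      + auto. }
  split.
  - exists (Rsum (map (fun k => Cnorm (a k)) L0)). intros L HL.
    destruct (idx_ok_union n L0 L O0 HL) as (L' & O' & I1 & I2).
    eapply Rle_trans.
    + apply (Rsum_incl _ L L'); [intros; apply Cnorm_ge0|apply HL|exact I2].
    + destruct (Hsplit L' O' I1) as (L1 & P1 & Z1).
      rewrite (Rsum_perm _ _ (Permutation_map _ P1)), map_app, Rsum_app.
      rewrite <- (Rplus_0_r (Rsum (map (fun k => Cnorm (a k)) L0))) at 2.
      apply Rplus_le_compat_l.
      eapply Rle_trans; [apply (Rsum_map_le _ (fun _ => 0 * 0))|].
      * intros k Hk. rewrite (Z1 k Hk), Cnorm_0. lra.
      * rewrite Rsum_map_scale. lra.
  - intros eps He. exists L0. split; [assumption|]. intros L HL Hi.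
    destruct (Hsplit L HL Hi) as (L1 & P1 & Z1).
    rewrite (Csum_perm _ _ (Permutation_map a P1)), map_app, Csum_app, (Csum_map_zero a L1 Z1).
    replace (Csum (map a L0) + C0 - Csum (map a L0))%C with C0 by ring.
    rewrite Cnorm_0. assumption.
Qed.

(* Evaluating at powers of a large real T turns the series into a Laurent series
   in 1/T, whose leading coefficient is isolated by letting T tend to infinity. *)
Lemma abs_conv_zero_coeffs (n : nat) (a : list Z -> C) (wt : list Z -> Z) (W0 : Z) :
  (forall k, length k = n -> a k <> C0 -> (wt k <= W0)%Z) ->
  (forall k l, length k = n -> length l = n -> a k <> C0 -> a l <> C0 -> wt k = wt l -> k = l) ->
  (forall T : R, 2 <= T -> abs_conv_to n (fun k => a k * Czpow (RtoC T) (wt k))%C C0) ->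
  forall k, length k = n -> a k = C0.
Proof.
  intros Hb Hinj Hconv.
  assert (Hmax : (exists k, length k = n /\ a k <> C0) -> exists k, length k = n /\ a k <> C0 /\
    forall l, length l = n -> a l <> C0 -> (wt l <= wt k)%Z).
  (* Weights are bounded by [W0], so the weight can strictly increase only finitely often; d bounds
     the room left. *)
  { assert (Hind : forall (d : nat) k, length k = n -> a k <> C0 -> (W0 - wt k <= Z.of_nat d)%Z ->
      exists k, length k = n /\ a k <> C0 /\ forall l, length l = n -> a l <> C0 -> (wt l <= wt k)%Z).
    { induction d as [|d IH]; intros k Hk Hak Hd.
      - exists k. repeat split; auto. intros l Hl Hal. specialize (Hb l Hl Hal). lia.
      - destruct (classic (exists l, length l = n /\ a l <> C0 /\ (wt k < wt l)%Z)) as [(l & Hl & Hal & Hlt)|Hn].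
        + apply (IH l); auto. lia.
        + exists k. repeat split; auto. intros l Hl Hal.
          destruct (Z_le_gt_dec (wt l) (wt k)); [assumption|].
          elim Hn. exists l. repeat split; auto. lia. }
    intros (k & Hk & Hak). apply (Hind (Z.to_nat (W0 - wt k)) k); auto. lia. }
  intros k0 Hk0. apply NNPP. intros Hne.
  destruct Hmax as (k & Hk & Hak & Hm); [now exists k0|].
  destruct (Hconv 2 (Rle_refl 2)) as [[B HB] _].
  assert (H20 : RtoC 2 <> C0) by (apply Cnorm_pos_neq0; rewrite Cnorm_RtoC; lra).
  set (c := Cnorm (a k * Czpow (RtoC 2) (wt k))).
  assert (Hc : 0 < c) by (apply Cnorm_pos, Cmul_neq0; [assumption|now apply Czpow_neq0]).
  (* At T = 2s the leading term has norm s^(wt k) c, while all other weights are at most wt k - 1,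
     so that the other terms add up to at most s^(wt k - 1) B by the bound at T = 2. Since the total
     is 0, s c <= B follows. *)
  assert (Hs : forall s, 1 <= s -> s * c <= B).
  { intros s Hs1.
    assert (Hs0 : RtoC s <> C0) by (apply Cnorm_pos_neq0; rewrite Cnorm_RtoC; lra).
    assert (HT : forall e, Czpow (RtoC (2 * s)) e = (Czpow (RtoC 2) e * Czpow (RtoC s) e)%C).
    { intros e. rewrite <- Czpow_mul_base by assumption. f_equal. apply C_ext; simpl; ring. }
    destruct (Hconv (2 * s)) as [_ Hlim]; [lra|].
    set (p := Cnorm (Czpow (RtoC s) (wt k - 1))).
    assert (Hp : 0 < p) by now apply Cnorm_Czpow_pos.
    assert (Hle : forall eps, eps > 0 -> p * (s * c) <= p * B + eps).
    { intros eps He. destruct (Hlim eps He) as (L0 & O0 & H0).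
      destruct (idx_ok_union n L0 [k] O0) as (L & O & I1 & I2).
      { split; [repeat constructor; auto|]. constructor; auto. }
      specialize (H0 L O I1).
      destruct (in_split k L) as (l1 & l2 & E); [apply I2; now left|].
      assert (P : Permutation L (k :: (l1 ++ l2))).
      { subst L. symmetry. apply Permutation_middle. }
      set (L' := l1 ++ l2) in *.
      assert (O' : idx_ok n (k :: L')).
      { destruct O as [O1 O2]. split; [now apply (Permutation_NoDup P)|now apply (Permutation_Forall P)]. }
      rewrite (Csum_perm _ _ (Permutation_map _ P)) in H0. simpl in H0.
      set (f := fun k => (a k * Czpow (RtoC (2 * s)) (wt k))%C) in *.
      assert (Hrest : Cnorm (Csum (map f L')) <= p * B).
      { eapply Rle_trans; [apply Cnorm_Csum_map|].
        eapply Rle_trans; [apply (Rsum_map_le _ (fun k => p * Cnorm (a k * Czpow (RtoC 2) (wt k))))|].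
        - intros l Hl. unfold f. destruct (classic (a l = C0)) as [El|El].
          + rewrite El. replace (C0 * Czpow (RtoC (2 * s)) (wt l))%C with C0 by ring.
            rewrite Cnorm_0. apply Rmult_le_pos; [lra|apply Cnorm_ge0].
          + destruct O' as [O1 O2]. apply NoDup_cons_iff in O1. destruct O1 as [N1 _].
            apply Forall_inv_tail in O2. rewrite Forall_forall in O2.
            assert (Hl' : length l = n) by auto.
            assert (wt l <> wt k).
            { intros Ew. apply N1. rewrite <- (Hinj l k); auto. }
            specialize (Hm l Hl' El).
            rewrite HT, !Cnorm_mul.
            assert (Hmono : Cnorm (Czpow (RtoC s) (wt l)) <= p) by (apply Cnorm_Czpow_mono; [assumption|lia]).
            pose proof (Cnorm_ge0 (a l)). pose proof (Cnorm_ge0 (Czpow (RtoC 2) (wt l))).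
            pose proof (Rmult_le_pos _ _ H1 H2). nra.
        - rewrite Rsum_map_scale. apply Rmult_le_compat_l; [lra|]. apply HB.
          destruct O' as [O1 O2]. split; [now apply NoDup_cons_iff in O1|now apply Forall_inv_tail in O2]. }
      assert (Hmain : Cnorm (f k) = p * (s * c)).
      { unfold f, p, c. rewrite HT, !Cnorm_mul.
        replace (wt k) with (wt k - 1 + 1)%Z at 2 by lia.
        rewrite (Czpow_succ (RtoC s)), Cnorm_mul, (Cnorm_RtoC s) by (assumption || lra). ring. }
      rewrite <- Hmain.
      replace (f k) with ((f k + Csum (map f L') - C0) - Csum (map f L'))%C by ring.
      eapply Rle_trans; [apply Cnorm_sub_triangle|].
      change (a k * Czpow (RtoC (2 * s)) (wt k))%C with (f k) in H0. lra. }
    assert (Hlim' : p * (s * c) <= p * B).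
    { apply Rnot_lt_le. intros Hlt. specialize (Hle ((p * (s * c) - p * B) / 2)). lra. }
    now apply Rmult_le_reg_l in Hlim'. }
  (* The choice s = max(1, B/c + 1) makes s c exceed B. *)
  pose proof (Rmax_l 1 (B / c + 1)) as M1. pose proof (Rmax_r 1 (B / c + 1)) as M2.
  specialize (Hs _ M1).
  assert ((B / c + 1) * c <= Rmax 1 (B / c + 1) * c) by (apply Rmult_le_compat_r; lra).
  replace ((B / c + 1) * c) with (B + c) in H by (field; lra). lra.
Qed.

(** * Shift operators on formal series *)

Fixpoint incr (i : nat) (x : Z) (ks : list Z) : list Z :=
  match ks, i with
  | [], _ => []
  | k :: ks', O => (k + x)%Z :: ks'
  | k :: ks', S i' => k :: incr i' x ks'
  end.

Arguments incr !i x !ks.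

Lemma incr_length (i : nat) (x : Z) (ks : list Z) : length (incr i x ks) = length ks.
Proof. revert i. induction ks; intros [|i]; simpl; auto. Qed.

Lemma incr_comm (i j : nat) (x y : Z) (ks : list Z) :
  incr i x (incr j y ks) = incr j y (incr i x ks).
Proof.
  revert i j. induction ks; intros [|i] [|j]; simpl; auto.
  - f_equal. lia.
  - f_equal. auto.
Qed.

Lemma incr_incr (i : nat) (x y : Z) (ks : list Z) : incr i x (incr i y ks) = incr i (x + y) ks.
Proof.
  revert i. induction ks; intros [|i]; simpl; auto.
  - f_equal. lia.
  - f_equal. auto.
Qed.

Lemma incr_0 (i : nat) (ks : list Z) : incr i 0 ks = ks.
Proof. revert i. induction ks; intros [|i]; simpl; f_equal; auto. lia. Qed.

Lemma nth_incr (i : nat) (x : Z) (ks : list Z) :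
  (i < length ks)%nat -> nth i (incr i x ks) 0%Z = (nth i ks 0 + x)%Z.
Proof. revert i. induction ks; intros [|i]; simpl; intros; try lia. apply IHks. lia. Qed.

Lemma nth_incr_neq (i j : nat) (x : Z) (ks : list Z) :
  i <> j -> nth i (incr j x ks) 0%Z = nth i ks 0%Z.
Proof. revert i j. induction ks; intros [|i] [|j]; simpl; intros; auto; try lia. Qed.

Definition zsum (ks : list Z) : Z := fold_right Z.add 0%Z ks.

Lemma zsum_incr (i : nat) (x : Z) (ks : list Z) :
  (i < length ks)%nat -> zsum (incr i x ks) = (zsum ks + x)%Z.
Proof. revert i. induction ks; intros [|i]; simpl; intros; try lia. rewrite IHks; lia. Qed.

(* A series sum_k F(k) z^(-k-1) is encoded by F, so multiplication by the
   variable z_i is the shift k_i := k_i + 1. *)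
Inductive op : Type :=
| OC (c : C)
| OX (i : nat)
| OAdd (a b : op)
| OSub (a b : op)
| OMul (a b : op).

Fixpoint ev (o : op) (F : list Z -> C) : list Z -> C :=
  match o with
  | OC c => fun l => (c * F l)%C
  | OX i => fun l => F (incr i 1 l)
  | OAdd a b => fun l => (ev a F l + ev b F l)%C
  | OSub a b => fun l => (ev a F l - ev b F l)%C
  | OMul a b => ev a (ev b F)
  end.

Fixpoint val (z : nat -> C) (o : op) : C :=
  match o with
  | OC c => c
  | OX i => z i
  | OAdd a b => (val z a + val z b)%C
  | OSub a b => (val z a - val z b)%C
  | OMul a b => (val z a * val z b)%C
  end.

Fixpoint osub (s : nat -> op) (o : op) : op :=
  match o with
  | OC c => OC c
  | OX i => s i
  | OAdd a b => OAdd (osub s a) (osub s b)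
  | OSub a b => OSub (osub s a) (osub s b)
  | OMul a b => OMul (osub s a) (osub s b)
  end.

Fixpoint ovars (P : nat -> Prop) (o : op) : Prop :=
  match o with
  | OC _ => True
  | OX i => P i
  | OAdd a b | OSub a b | OMul a b => ovars P a /\ ovars P b
  end.

Fixpoint opow (o : op) (n : nat) : op :=
  match n with O => OC C1 | S m => OMul o (opow o m) end.

Lemma ev_shift (o : op) (F : list Z -> C) (i : nat) (x : Z) :
  ev o (fun l => F (incr i x l)) = fun l => ev o F (incr i x l).
Proof.
  revert F. induction o; intros F; simpl; try reflexivity; extensionality l.
  - now rewrite incr_comm.
  - now rewrite IHo1, IHo2.
  - now rewrite IHo1, IHo2.
  - now rewrite IHo2, IHo1.
Qed.

Lemma ev_add (o : op) (F G : list Z -> C) :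
  ev o (fun l => F l + G l)%C = fun l => (ev o F l + ev o G l)%C.
Proof.
  revert F G. induction o; intros F G; simpl; try reflexivity; extensionality l.
  - ring.
  - rewrite IHo1, IHo2. ring.
  - rewrite IHo1, IHo2. ring.
  - now rewrite IHo2, IHo1.
Qed.

Lemma ev_sub (o : op) (F G : list Z -> C) :
  ev o (fun l => F l - G l)%C = fun l => (ev o F l - ev o G l)%C.
Proof.
  revert F G. induction o; intros F G; simpl; try reflexivity; extensionality l.
  - ring.
  - rewrite IHo1, IHo2. ring.
  - rewrite IHo1, IHo2. ring.
  - now rewrite IHo2, IHo1.
Qed.

Lemma ev_scale (o : op) (c : C) (F : list Z -> C) :
  ev o (fun l => c * F l)%C = fun l => (c * ev o F l)%C.
Proof.
  revert F. induction o; intros F; simpl; try reflexivity; extensionality l.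
  - ring.
  - rewrite IHo1, IHo2. ring.
  - rewrite IHo1, IHo2. ring.
  - now rewrite IHo2, IHo1.
Qed.

(** Operators are syntax, not polynomials, so commutativity must be proved; it holds because the
    generators are scalars and commuting shifts. It lets denominators be cleared and cancelled in
    any order. *)
Lemma ev_comm (a b : op) (F : list Z -> C) : ev a (ev b F) = ev b (ev a F).
Proof.
  revert F. induction a; intros F; simpl.
  - now rewrite ev_scale.
  - now rewrite ev_shift.
  - rewrite ev_add. now rewrite IHa1, IHa2.
  - rewrite ev_sub. now rewrite IHa1, IHa2.
  - now rewrite IHa2, IHa1.
Qed.

(** An operator reads its argument only at points reached by upward shifts in its own variables.
    Hence Q may be a half-space such as 0 <= k_j, or a slice on which an index not occurring in [o]
    is frozen. *)
Lemma ev_ext_on (P : nat -> Prop) (Q : list Z -> Prop) (o : op) (F G : list Z -> C) :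
  (forall i l, P i -> Q l -> Q (incr i 1 l)) -> ovars P o ->
  (forall l, Q l -> F l = G l) -> forall l, Q l -> ev o F l = ev o G l.
Proof.
  intros HQ. revert F G. induction o; simpl; intros F G Ho HF l Hl.
  - now rewrite HF.
  - apply HF. auto.
  - destruct Ho. now rewrite (IHo1 F G), (IHo2 F G).
  - destruct Ho. now rewrite (IHo1 F G), (IHo2 F G).
  - destruct Ho. apply IHo1; auto.
Qed.

Lemma ovars_top (o : op) : ovars (fun _ => True) o.
Proof. induction o; simpl; auto. Qed.

Lemma ovars_opow (P : nat -> Prop) (o : op) (n : nat) : ovars P o -> ovars P (opow o n).
Proof. intros H. induction n; simpl; auto. Qed.

Lemma ovars_osub (P Q : nat -> Prop) (s : nat -> op) (o : op) :
  (forall i, P i -> ovars Q (s i)) -> ovars P o -> ovars Q (osub s o).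
Proof. intros H. induction o; simpl; intuition. Qed.

Lemma ev_ext_length (n : nat) (o : op) (F G : list Z -> C) :
  (forall l, length l = n -> F l = G l) -> forall l, length l = n -> ev o F l = ev o G l.
Proof.
  intros H. apply (ev_ext_on (fun _ => True)); auto using ovars_top.
  intros i l _ Hl. now rewrite incr_length.
Qed.

Lemma ev_0 (o : op) : ev o (fun _ => C0) = fun _ => C0.
Proof.
  induction o; simpl; try rewrite IHo1, IHo2; try reflexivity;
    try (extensionality l; ring). now rewrite IHo2.
Qed.

Lemma ev_vanish (Q : list Z -> Prop) (o : op) (F : list Z -> C) :
  (forall i l, Q l -> Q (incr i 1 l)) ->
  (forall l, Q l -> F l = C0) -> forall l, Q l -> ev o F l = C0.
Proof.
  intros HQ HF l Hl.
  rewrite (ev_ext_on (fun _ => True) Q o F (fun _ => C0)); auto using ovars_top.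
  now rewrite ev_0.
Qed.

Lemma val_opow (z : nat -> C) (o : op) (n : nat) : val z (opow o n) = Cpow (val z o) n.
Proof. induction n; simpl; congruence. Qed.

Lemma osub_opow (s : nat -> op) (o : op) (n : nat) : osub s (opow o n) = opow (osub s o) n.
Proof. induction n; simpl; congruence. Qed.

Lemma ev_opow_congr (a b : op) (n : nat) :
  (forall F, ev a F = ev b F) -> forall F, ev (opow a n) F = ev (opow b n) F.
Proof. intros H F. induction n; simpl; [reflexivity|]. now rewrite IHn, H. Qed.

Lemma ev_opow_add (o : op) (m n : nat) (F : list Z -> C) :
  ev (opow o (m + n)) F = ev (opow o m) (ev (opow o n) F).
Proof.
  induction m; simpl.
  - extensionality l. ring.
  - now rewrite IHm.
Qed.

Lemma ev_OX_pow (i : nat) (n : nat) (F : list Z -> C) (l : list Z) :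
  ev (opow (OX i) n) F l = F (incr i (Z.of_nat n) l).
Proof.
  revert l. induction n; intros l.
  - simpl. rewrite incr_0. ring.
  - change (ev (opow (OX i) n) F (incr i 1 l) = F (incr i (Z.of_nat (S n)) l)).
    rewrite IHn, incr_incr. do 2 f_equal. lia.
Qed.

Lemma osub_osub (s t : nat -> op) (o : op) : osub s (osub t o) = osub (fun i => osub s (t i)) o.
Proof. induction o; simpl; congruence. Qed.

Lemma osub_OX (o : op) : osub OX o = o.
Proof. induction o; simpl; congruence. Qed.

Definition olift (o : op) : op := osub (fun i => OX (S i)) o.

(** An operator free of the first variable acts separately on each slice with fixed first index;
    inductions that peel off the leftmost vertex operator rest on this. *)
Lemma ev_olift (o : op) (F : list Z -> C) (k : Z) :
  (fun ks => ev (olift o) F (k :: ks)) = ev o (fun ks => F (k :: ks)).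
Proof.
  revert F. induction o; intros F; simpl; try reflexivity.
  - rewrite <- IHo1, <- IHo2. reflexivity.
  - rewrite <- IHo1, <- IHo2. reflexivity.
  - unfold olift in *. simpl. now rewrite IHo1, IHo2.
Qed.

(** * Evaluation of formal series *)

Definition tm (z : nat -> C) (F : list Z -> C) (ks : list Z) : C := (F ks * zmono z 0 ks)%C.

Lemma zmono_incr (z : nat -> C) (o i : nat) (x : Z) (ks : list Z) :
  (i < length ks)%nat -> z (o + i)%nat <> C0 ->
  zmono z o (incr i x ks) = (Czpow (z (o + i)%nat) (- x) * zmono z o ks)%C.
Proof.
  revert o i. induction ks as [|k ks IH]; intros o [|i]; simpl; intros Hi Hz; try lia.
  - rewrite Nat.add_0_r in *. replace (- (k + x) - 1)%Z with (- x + (- k - 1))%Z by lia.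
    rewrite Czpow_add by assumption. ring.
  - rewrite IH by (simpl; try lia; now rewrite Nat.add_succ_r in Hz).
    rewrite Nat.add_succ_r. simpl. ring.
Qed.

Lemma tm_shift (z : nat -> C) (F : list Z -> C) (i : nat) (x : Z) (ks : list Z) :
  (i < length ks)%nat -> z i <> C0 ->
  tm z (fun l => F (incr i x l)) ks = (Czpow (z i) x * tm z F (incr i x ks))%C.
Proof.
  intros Hi Hz. unfold tm. rewrite zmono_incr by assumption. simpl.
  replace (Czpow (z i) x * (F (incr i x ks) * (Czpow (z i) (- x) * zmono z 0 ks)))%C
    with (Czpow (z i) x * Czpow (z i) (- x) * (F (incr i x ks) * zmono z 0 ks))%C by ring.
  rewrite <- Czpow_add, Z.add_opp_diag_r by assumption. simpl. ring.
Qed.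

Lemma abs_conv_shift (n : nat) (z : nat -> C) (F : list Z -> C) (i : nat) (x : Z) (s : C) :
  (i < n)%nat -> z i <> C0 -> abs_conv_to n (tm z F) s ->
  abs_conv_to n (tm z (fun l => F (incr i x l))) (Czpow (z i) x * s).
Proof.
  intros Hi Hz H.
  apply abs_conv_ext with (fun ks => Czpow (z i) x * tm z F (incr i x ks))%C.
  - intros k Hk. now rewrite tm_shift by (lia || assumption).
  - apply abs_conv_scale.
    apply (abs_conv_reindex n (incr i x) (incr i (- x))); try assumption;
      intros k Hk; rewrite ?incr_length, ?incr_incr; try assumption.
    + now rewrite Z.add_opp_diag_l, incr_0.
    + now rewrite Z.add_opp_diag_r, incr_0.
Qed.

Lemma abs_conv_tm_add (n : nat) (z : nat -> C) (F G : list Z -> C) (s t : C) :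
  abs_conv_to n (tm z F) s -> abs_conv_to n (tm z G) t ->
  abs_conv_to n (tm z (fun l => F l + G l)%C) (s + t).
Proof.
  intros H1 H2. eapply abs_conv_ext; [|apply (abs_conv_add _ _ _ _ _ H1 H2)].
  intros k _. unfold tm. ring.
Qed.

Lemma abs_conv_tm_scale (n : nat) (z : nat -> C) (F : list Z -> C) (c s : C) :
  abs_conv_to n (tm z F) s -> abs_conv_to n (tm z (fun l => c * F l)%C) (c * s).
Proof.
  intros H1. eapply abs_conv_ext; [|apply (abs_conv_scale _ _ c _ H1)].
  intros k _. unfold tm. ring.
Qed.

Lemma abs_conv_tm_sub (n : nat) (z : nat -> C) (F G : list Z -> C) (s t : C) :
  abs_conv_to n (tm z F) s -> abs_conv_to n (tm z G) t ->
  abs_conv_to n (tm z (fun l => F l - G l)%C) (s - t).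
Proof.
  intros H1 H2.
  replace (s - t)%C with (s + - C1 * t)%C by ring.
  eapply abs_conv_ext; [|apply (abs_conv_tm_add _ _ _ _ _ _ H1 (abs_conv_tm_scale _ _ _ (- C1)%C _ H2))].
  intros k _. unfold tm. ring.
Qed.

(** Bridge between the formal and the analytic side: a generator only reindexes, rescales or
    combines families already known to converge. *)
Lemma abs_conv_ev (n : nat) (z : nat -> C) (o : op) (F : list Z -> C) (s : C) :
  (forall i, (i < n)%nat -> z i <> C0) -> ovars (fun i => (i < n)%nat) o ->
  abs_conv_to n (tm z F) s -> abs_conv_to n (tm z (ev o F)) (val z o * s).
Proof.
  intros Hz. revert F s. induction o; simpl; intros F s Ho H.
  - now apply abs_conv_tm_scale.
  - replace (z i) with (Czpow (z i) 1) by (simpl; ring).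
    apply abs_conv_shift; auto.
  - destruct Ho. replace ((val z o1 + val z o2) * s)%C with (val z o1 * s + val z o2 * s)%C by ring.
    apply abs_conv_tm_add; auto.
  - destruct Ho. replace ((val z o1 - val z o2) * s)%C with (val z o1 * s - val z o2 * s)%C by ring.
    apply abs_conv_tm_sub; auto.
  - destruct Ho. replace (val z o1 * val z o2 * s)%C with (val z o1 * (val z o2 * s))%C by ring.
    auto.
Qed.

(* Truncation along the diagonals k - j e_i + j e_m: this is what expansions in
   nonnegative powers of z_m / z_i need in order to be formally well defined. *)
Definition diag_trunc (n i m : nat) (F : list Z -> C) : Prop :=
  forall l, length l = n -> exists J0, forall j, (J0 <= j)%nat ->
    F (incr i (- Z.of_nat j) (incr m (Z.of_nat j) l)) = C0.

Lemma diag_trunc_ev (n i m : nat) (o : op) (F : list Z -> C) :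
  diag_trunc n i m F -> diag_trunc n i m (ev o F).
Proof.
  revert F. induction o; simpl; intros F H; auto; intros l Hl.
  - destruct (H l Hl) as [J HJ]. exists J. intros j Hj. rewrite HJ by assumption. ring.
  - destruct (H (incr i0 1 l)) as [J HJ]; [now rewrite incr_length|]. exists J. intros j Hj.
    rewrite (incr_comm i0 i), (incr_comm i0 m). auto.
  - destruct (IHo1 F H l Hl) as [J1 H1]. destruct (IHo2 F H l Hl) as [J2 H2].
    exists (Nat.max J1 J2). intros j Hj. rewrite H1, H2 by lia. ring.
  - destruct (IHo1 F H l Hl) as [J1 H1]. destruct (IHo2 F H l Hl) as [J2 H2].
    exists (Nat.max J1 J2). intros j Hj. rewrite H1, H2 by lia. ring.
Qed.

Definition csum (J : nat) (f : nat -> C) : C := Csum (map f (seq 0 J)).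

Lemma csum_S (J : nat) (f : nat -> C) : csum (S J) f = (csum J f + f J)%C.
Proof.
  unfold csum. rewrite seq_S, map_app, Csum_app. simpl. ring.
Qed.

Lemma csum_ext (J : nat) (f g : nat -> C) :
  (forall j, (j < J)%nat -> f j = g j) -> csum J f = csum J g.
Proof.
  intros H. unfold csum. f_equal. apply map_ext_in. intros j Hj. apply in_seq in Hj. apply H. lia.
Qed.

Lemma uniform_threshold {A : Type} (P : A -> nat -> Prop) (L : list A) :
  (forall x, In x L -> exists J0, forall j, (J0 <= j)%nat -> P x j) ->
  exists J0, forall x j, In x L -> (J0 <= j)%nat -> P x j.
Proof.
  induction L as [|x L IH]; intros H.
  - exists 0%nat. intros x j [].
  - destruct IH as [J1 H1]; [intros y Hy; apply H; now right|].
    destruct (H x) as [J2 H2]; [now left|].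
    exists (Nat.max J1 J2). intros y j [<-|Hy] Hj; [apply H2; lia|apply H1; auto; lia].
Qed.

Lemma Rsum_geometric (r : R) (J : nat) :
  0 <= r < 1 -> Rsum (map (fun l => r ^ l) (seq 0 J)) <= / (1 - r).
Proof.
  intros Hr. assert (H : Rsum (map (fun l => r ^ l) (seq 0 J)) = (1 - r ^ J) / (1 - r)).
  { induction J.
    - simpl. field. lra.
    - rewrite seq_S, map_app, Rsum_app, IHJ. simpl. field. lra. }
  rewrite H. unfold Rdiv. rewrite <- (Rmult_1_l (/ (1 - r))) at 2.
  apply Rmult_le_compat_r; [left; apply Rinv_0_lt_compat; lra|].
  assert (0 <= r ^ J) by (apply pow_le; lra). lra.
Qed.

Lemma Rsum_swap {A B : Type} (f : A -> B -> R) (L : list A) (M : list B) :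
  Rsum (map (fun x => Rsum (map (fun y => f x y) M)) L) =
  Rsum (map (fun y => Rsum (map (fun x => f x y) L)) M).
Proof.
  induction L; simpl.
  - induction M; simpl; [reflexivity|]. rewrite <- IHM. ring.
  - rewrite IHL, Rsum_map_add. reflexivity.
Qed.

(* F is recovered from H = (z_i - z_j) F as the product of H with the geometric
   expansion of 1/(z_i - z_j) in nonnegative powers of z_j. *)
Lemma abs_conv_div_diff (n i j : nat) (z : nat -> C) (F : list Z -> C) (s : C) :
  (i < n)%nat -> (j < n)%nat -> (forall i, (i < n)%nat -> z i <> C0) ->
  Cnorm (z j) < Cnorm (z i) -> diag_trunc n i j F ->
  abs_conv_to n (tm z (ev (OSub (OX i) (OX j)) F)) s ->
  abs_conv_to n (tm z F) (s / (z i - z j)).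
Proof.
  intros Hi Hj Hz Hlt HF Hs.
  assert (Hij : (z i - z j)%C <> C0).
  { intros E. assert (z i = z j) by (replace (z i) with ((z i - z j) + z j)%C by ring; rewrite E; ring).
    rewrite H in Hlt. lra. }
  set (H := ev (OSub (OX i) (OX j)) F) in *.
  set (sg := fun (l : nat) ks => incr i (- Z.of_nat (S l)) (incr j (Z.of_nat l) ks)).
  (* Telescoping: the l-th term of the expansion is H multiplied by z_j^l z_i^(-l-1). By
     [diag_trunc] the remainder vanishes for large J, and one J serves a finite list of indices. *)
  assert (Htel : forall J ks, F ks =
    (csum J (fun l => H (sg l ks)) + F (incr i (- Z.of_nat J) (incr j (Z.of_nat J) ks)))%C).
  { induction J; intros ks.
    - simpl. rewrite !incr_0. unfold csum. simpl. ring.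
    - rewrite csum_S.
      assert (E : H (sg J ks) = (F (incr i (- Z.of_nat J) (incr j (Z.of_nat J) ks)) -
        F (incr i (- Z.of_nat (S J)) (incr j (Z.of_nat (S J)) ks)))%C).
      { unfold H, sg. cbn [ev]. rewrite incr_incr, (incr_comm j i), incr_incr.
        f_equal; [|f_equal]; f_equal; (lia || (f_equal; lia)). }
      rewrite E, (IHJ ks). ring. }
  set (ri := Cnorm (z i)) in *. set (rj := Cnorm (z j)) in *.
  assert (Hrj : 0 < rj) by (apply Cnorm_pos; auto).
  set (r := rj / ri).
  assert (Hr : 0 <= r < 1).
  { unfold r. split.
    - left. apply Rdiv_lt_0_compat; lra.
    - apply Rmult_lt_reg_r with ri; [lra|]. field_simplify; lra. }
  destruct Hs as [[B HB] Hs].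
  (* B bounds the partial sums of H, and the other factor bounds the sum of r^l / |z_i| with r =
     |z_j| / |z_i|. *)
  destruct (abs_bounded_conv n (tm z F) (B * (/ ri * / (1 - r)))) as [s' Hs'].
  - intros L HL.
    destruct (uniform_threshold (fun ks J => F (incr i (- Z.of_nat J) (incr j (Z.of_nat J) ks)) = C0) L) as [J HJ].
    { intros ks Hks. apply HF. destruct HL as [_ HL]. rewrite Forall_forall in HL. auto. }
    eapply Rle_trans; [apply (Rsum_map_le _ (fun ks =>
      Rsum (map (fun l => (/ ri * r ^ l) * Cnorm (tm z H (sg l ks))) (seq 0 J))))|].
    + intros ks Hks. unfold tm at 1. rewrite (Htel J ks), HJ by auto.
      replace ((csum J (fun l => H (sg l ks)) + C0) * zmono z 0 ks)%C
        with (zmono z 0 ks * csum J (fun l => H (sg l ks)))%C by ring.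
      unfold csum. rewrite <- Csum_map_scale.
      eapply Rle_trans; [apply Cnorm_Csum_map|]. apply Rsum_map_le. intros l _. right.
      assert (Hlen : length ks = n) by (destruct HL as [_ HL]; rewrite Forall_forall in HL; auto).
      unfold tm, sg. rewrite !zmono_incr by (rewrite ?incr_length; try lia; simpl; auto). simpl (0 + _)%nat.
      rewrite Z.opp_involutive, Czpow_nat, Czpow_opp_nat.
      rewrite !Cnorm_mul.
      assert (Hp : forall a m, Cnorm (Cpow a m) = Cnorm a ^ m).
      { intros a m. induction m; simpl; [apply Cnorm_1|]. rewrite Cnorm_mul. congruence. }
      assert (Hv : forall a, a <> C0 -> Cnorm (Cinv a) = / Cnorm a).
      { intros a Ha. apply Rmult_eq_reg_l with (Cnorm a); [|apply Rgt_not_eq, Cnorm_pos; assumption].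
        rewrite <- Cnorm_mul. replace (a * Cinv a)%C with C1 by (field; assumption).
        rewrite Cnorm_1. field. apply Rgt_not_eq, Cnorm_pos. assumption. }
      rewrite Hv, !Hp by (apply Cpow_neq0; auto). fold ri rj. unfold r.
      unfold Rdiv. rewrite Rpow_mult_distr, pow_inv. simpl. field. split; [|split]; try lra; apply pow_nonzero; lra.
    + rewrite Rsum_swap.
      eapply Rle_trans; [apply (Rsum_map_le _ (fun l => B * (/ ri * r ^ l)))|].
      * intros l _. rewrite Rsum_map_scale, Rmult_comm.
        apply Rmult_le_compat_r.
        { apply Rmult_le_pos; [left; apply Rinv_0_lt_compat; lra|apply pow_le; lra]. }
        rewrite <- (map_map (sg l) (fun ks => Cnorm (tm z H ks))). apply HB.
        apply idx_ok_map with (fun ks => incr j (- Z.of_nat l) (incr i (Z.of_nat (S l)) ks)); [| |exact HL]; intros k Hk; unfold sg.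
        { now rewrite !incr_length. }
        { rewrite incr_incr, Z.add_opp_diag_r, incr_0, incr_incr, Z.add_opp_diag_l, incr_0. reflexivity. }
      * rewrite Rsum_map_scale. apply Rmult_le_compat_l.
        { specialize (HB []). simpl in HB. apply HB. split; constructor. }
        rewrite Rsum_map_scale. apply Rmult_le_compat_l; [left; apply Rinv_0_lt_compat; lra|].
        now apply Rsum_geometric.
  (* The value of the sum needs no rearrangement: multiplying it by z_i - z_j gives the sum of H,
     and sums are unique. *)
  - assert (E : s = ((z i - z j) * s')%C).
    { apply (abs_conv_unique n (tm z H)); [split; [now exists B|assumption]|].
      change (z i - z j)%C with (val z (OSub (OX i) (OX j))).
      apply abs_conv_ev; simpl; auto. }
    rewrite E. replace ((z i - z j) * s' / (z i - z j))%C with s' by (field; assumption).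
    exact Hs'.
Qed.

(** * Division by products of z_i and z_i - z_j *)

Inductive pole_factor (n : nat) : op -> Prop :=
| pf_one : pole_factor n (OC C1)
| pf_var i : (i < n)%nat -> pole_factor n (OX i)
| pf_diff i j : (i < j)%nat -> (j < n)%nat -> pole_factor n (OSub (OX i) (OX j))
| pf_mul a b : pole_factor n a -> pole_factor n b -> pole_factor n (OMul a b).

Lemma pole_factor_opow (n : nat) (o : op) (m : nat) : pole_factor n o -> pole_factor n (opow o m).
Proof. intros H. induction m; simpl; constructor; auto. Qed.

Lemma prod_dom_lt (n : nat) (z : nat -> C) (i j : nat) :
  prod_dom n z -> (i < j)%nat -> (j < n)%nat -> Cnorm (z j) < Cnorm (z i).
Proof.
  intros [_ H] Hij Hj. induction j as [|j IH]; [lia|].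
  destruct (Nat.eq_dec i j) as [->|]; [now apply H|].
  apply Rlt_trans with (Cnorm (z j)); [now apply H|apply IH; lia].
Qed.

Lemma prod_dom_neq0 (n : nat) (z : nat -> C) (i : nat) : prod_dom n z -> (i < n)%nat -> z i <> C0.
Proof. intros [H _] Hi. apply Cnorm_pos_neq0. auto. Qed.

Lemma pole_factor_neq0 (n : nat) (z : nat -> C) (o : op) :
  prod_dom n z -> pole_factor n o -> val z o <> C0.
Proof.
  intros Hz H. induction H; simpl.
  - apply C1_neq0.
  - now apply prod_dom_neq0 with n.
  - intros E. pose proof (prod_dom_lt n z i j Hz H H0) as Hlt.
    assert (z i = z j) by (replace (z i) with ((z i - z j) + z j)%C by ring; rewrite E; ring).
    rewrite H1 in Hlt. lra.
  - now apply Cmul_neq0.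
Qed.

(** Factors are divided out one at a time, the partial products staying truncated by
    [diag_trunc_ev]. Only differences with i < j occur, so on [prod_dom] the geometric expansion
    runs in the convergent direction. *)
Lemma abs_conv_div_pole_factor (n : nat) (z : nat -> C) (o : op) :
  prod_dom n z -> pole_factor n o -> forall (F : list Z -> C) (s : C),
  (forall i j, (i < j)%nat -> (j < n)%nat -> diag_trunc n i j F) ->
  abs_conv_to n (tm z (ev o F)) s -> abs_conv_to n (tm z F) (s / val z o).
Proof.
  intros Hz Ho.
  assert (Hz0 : forall i, (i < n)%nat -> z i <> C0) by (intros; now apply prod_dom_neq0 with n).
  induction Ho; intros F s HF Hs; simpl in *.
  - replace (s / C1)%C with s by (field; apply C1_neq0).
    eapply abs_conv_ext; [|exact Hs]. intros k _. unfold tm. simpl. ring.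
  - replace (s / z i)%C with (Czpow (z i) (-1) * s)%C by (simpl; field; auto).
    eapply abs_conv_ext; [|apply (abs_conv_shift _ _ _ i (-1) _ H (Hz0 _ H) Hs)].
    intros k _. unfold tm. rewrite incr_incr. now rewrite incr_0.
  - apply abs_conv_div_diff; auto; try lia. now apply prod_dom_lt with n.
  - replace (s / (val z a * val z b))%C with (s / val z a / val z b)%C.
    + apply IHHo2; auto. apply IHHo1; auto. intros. apply diag_trunc_ev. auto.
    + field. split; now apply (pole_factor_neq0 n).
Qed.

(** * Support bounds: total degree and truncation in one variable *)

(** Formal trace of the grading. The total degree lies in a band rather than being fixed, since
    neither the vectors nor the functional are homogeneous. *)
Definition sum_bounded (n : nat) (F : list Z -> C) : Prop :=
  exists D : Z, forall l, length l = n -> F l <> C0 -> (Z.abs (zsum l) <= D)%Z.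

Definition top_bounded (n i : nat) (F : list Z -> C) : Prop :=
  exists K : Z, forall l, length l = n -> F l <> C0 -> (nth i l 0 < K)%Z.

Lemma Cadd_neq0 (a b : C) : (a + b)%C <> C0 -> a <> C0 \/ b <> C0.
Proof.
  intros H. apply NNPP. intros Hn. apply not_or_and in Hn. destruct Hn as [Ha Hb].
  apply NNPP in Ha, Hb. apply H. rewrite Ha, Hb. ring.
Qed.

Lemma Csub_neq0 (a b : C) : (a - b)%C <> C0 -> a <> C0 \/ b <> C0.
Proof.
  intros H. apply NNPP. intros Hn. apply not_or_and in Hn. destruct Hn as [Ha Hb].
  apply NNPP in Ha, Hb. apply H. rewrite Ha, Hb. ring.
Qed.

Lemma Cmul_neq0_r (a b : C) : (a * b)%C <> C0 -> b <> C0.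
Proof. intros H E. apply H. rewrite E. ring. Qed.

Lemma sum_bounded_sub (n : nat) (F G : list Z -> C) :
  sum_bounded n F -> sum_bounded n G -> sum_bounded n (fun l => F l - G l)%C.
Proof.
  intros [D1 H1] [D2 H2]. exists (Z.max D1 D2). intros l Hl Hn.
  apply Csub_neq0 in Hn. destruct Hn as [Hn|Hn]; [specialize (H1 l Hl Hn)|specialize (H2 l Hl Hn)]; lia.
Qed.

Lemma top_bounded_sub (n i : nat) (F G : list Z -> C) :
  top_bounded n i F -> top_bounded n i G -> top_bounded n i (fun l => F l - G l)%C.
Proof.
  intros [D1 H1] [D2 H2]. exists (Z.max D1 D2). intros l Hl Hn.
  apply Csub_neq0 in Hn. destruct Hn as [Hn|Hn]; [specialize (H1 l Hl Hn)|specialize (H2 l Hl Hn)]; lia.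
Qed.

Lemma sum_bounded_ev (n : nat) (o : op) (F : list Z -> C) :
  sum_bounded n F -> sum_bounded n (ev o F).
Proof.
  revert F. induction o; simpl; intros F H; auto.
  - destruct H as [D H]. exists D. intros l Hl Hn. eauto using Cmul_neq0_r.
  - destruct H as [D H]. exists (D + 1)%Z. intros l Hl Hn.
    specialize (H (incr i 1 l)). rewrite incr_length in H. specialize (H Hl Hn).
    destruct (lt_dec i (length l)).
    + rewrite zsum_incr in H by assumption. lia.
    (* A shift at a position outside the list does nothing. *)
    + assert (E : incr i 1 l = l).
      { clear - n0. revert i n0. induction l; intros [|i] Hi; simpl in *; auto; try lia.
        f_equal. apply IHl. lia. }
      rewrite E in H. lia.
  - destruct (IHo1 F H) as [D1 H1], (IHo2 F H) as [D2 H2]. exists (Z.max D1 D2). intros l Hl Hn.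
    apply Cadd_neq0 in Hn. destruct Hn as [Hn|Hn]; [specialize (H1 l Hl Hn)|specialize (H2 l Hl Hn)]; lia.
  - apply sum_bounded_sub; auto.
Qed.

Lemma top_bounded_ev (n i : nat) (o : op) (F : list Z -> C) :
  (i < n)%nat -> top_bounded n i F -> top_bounded n i (ev o F).
Proof.
  intros Hi. revert F. induction o; simpl; intros F H; auto.
  - destruct H as [D H]. exists D. intros l Hl Hn. eauto using Cmul_neq0_r.
  - destruct H as [D H]. exists D. intros l Hl Hn.
    specialize (H (incr i0 1 l)). rewrite incr_length in H. specialize (H Hl Hn).
    destruct (Nat.eq_dec i i0) as [<-|Hne].
    + rewrite nth_incr in H by lia. lia.
    + now rewrite nth_incr_neq in H.
  - destruct (IHo1 F H) as [D1 H1], (IHo2 F H) as [D2 H2]. exists (Z.max D1 D2). intros l Hl Hn.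
    apply Cadd_neq0 in Hn. destruct Hn as [Hn|Hn]; [specialize (H1 l Hl Hn)|specialize (H2 l Hl Hn)]; lia.
  - apply top_bounded_sub; auto.
Qed.

(** * Change of variable z_i = y_i + z_m in formal series *)

(* [signed_binom a j] is (-1)^j binom(a, j), the coefficient of z_i^(a-j) z_m^j in
   the expansion of (z_i - z_m)^a in nonnegative powers of z_m. *)
Fixpoint signed_binom (a : Z) (j : nat) : C :=
  match j with
  | O => C1
  | S j' => (signed_binom a j' * RtoC ((INR j' - IZR a) / (INR j' + 1)))%C
  end.

(** Coefficient form of (z_i - z_m)^(a+1) = (z_i - z_m) (z_i - z_m)^a, valid for negative a as
    well. *)
Lemma signed_binom_pascal (a : Z) (j : nat) :
  signed_binom (a + 1) (S j) = (signed_binom a (S j) - signed_binom a j)%C.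
Proof.
  induction j as [|j IH].
  - simpl. apply C_ext; simpl; rewrite plus_IZR; field.
  - change (signed_binom (a + 1) (S (S j))) with
      (signed_binom (a + 1) (S j) * RtoC ((INR (S j) - IZR (a + 1)) / (INR (S j) + 1)))%C.
    rewrite IH.
    change (signed_binom a (S (S j))) with
      (signed_binom a (S j) * RtoC ((INR (S j) - IZR a) / (INR (S j) + 1)))%C.
    change (signed_binom a (S j)) with (signed_binom a j * RtoC ((INR j - IZR a) / (INR j + 1)))%C.
    pose proof (pos_INR j). rewrite S_INR, plus_IZR.
    apply C_ext; simpl; field; lra.
Qed.

Lemma signed_binom_0 (a : Z) (j : nat) :
  (0 <= a)%Z -> (a < Z.of_nat j)%Z -> signed_binom a j = C0.
Proof.
  intros Ha. induction j as [|j IH]; intros Hj; [lia|]. simpl.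
  destruct (Z.eq_dec a (Z.of_nat j)) as [->|Hne].
  - rewrite <- INR_IZR_INZ. replace ((INR j - INR j) / (INR j + 1)) with 0.
    + apply C_ext; simpl; ring.
    + unfold Rdiv. ring.
  - rewrite IH by lia. ring.
Qed.

(* Ft is the coefficient family in y_i = z_i - z_m, for |z_m| > |y_i|, obtained from F
   by taking residues against the expansions of (z_i - z_m)^a in |z_i| > |z_m|. *)
Definition change_var (n i m : nat) (F Ft : list Z -> C) : Prop :=
  diag_trunc n i m F /\
  forall l, length l = n -> exists J0, forall J, (J0 <= J)%nat ->
    Ft l = csum J (fun j => signed_binom (nth i l 0%Z) j *
                            F (incr i (- Z.of_nat j) (incr m (Z.of_nat j) l)))%C.

(** After the change of variable, slot i stands for y_i, so that z_i has to be read as y_i + z_m. *)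
Definition iter_subst (i m : nat) : op -> op :=
  osub (fun j => if Nat.eqb j i then OAdd (OX i) (OX m) else OX j).

Lemma csum_add (J : nat) (f g : nat -> C) : csum J (fun j => f j + g j)%C = (csum J f + csum J g)%C.
Proof. apply Csum_map_add. Qed.

Lemma csum_scale (J : nat) (c : C) (f : nat -> C) : csum J (fun j => c * f j)%C = (c * csum J f)%C.
Proof. apply Csum_map_scale. Qed.

(** Truncated form of (z_i - z_m)^(a+1) + z_m (z_i - z_m)^a = z_i (z_i - z_m)^a. The second sum is
    one term shorter because its terms carry an extra z_m. *)
Lemma csum_pascal (a : Z) (J : nat) (f : nat -> C) :
  (csum (S J) (fun j => signed_binom (a + 1) j * f j) + csum J (fun j => signed_binom a j * f (S j)))%C =
  csum (S J) (fun j => signed_binom a j * f j)%C.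
Proof.
  induction J as [|J IH].
  - unfold csum. simpl. ring.
  - rewrite (csum_S (S J) (fun j => signed_binom a j * f j)%C), <- IH.
    rewrite (csum_S (S J) (fun j => signed_binom (a + 1) j * f j)%C).
    rewrite (csum_S J (fun j => signed_binom a j * f (S j))%C).
    rewrite signed_binom_pascal. ring.
Qed.

(** Only multiplication by z_i has content, and there it is [csum_pascal]; the other variables leave
    the upper argument of the binomial alone and commute with the diagonal shifts. *)
Lemma change_var_ev (n i m : nat) (o : op) (F Ft : list Z -> C) :
  (i < n)%nat -> (m < n)%nat -> i <> m ->
  change_var n i m F Ft -> change_var n i m (ev o F) (ev (iter_subst i m o) Ft).
Proof.
  intros Hi Hm Him. revert F Ft. induction o; intros F Ft HT; [| | | |now apply IHo1, IHo2];
    (split; [apply diag_trunc_ev, HT|]; intros l Hl).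
  - destruct HT as [_ HT]. destruct (HT l Hl) as [J0 H0]. exists J0. intros J HJ.
    simpl. rewrite (H0 J HJ), <- csum_scale. apply csum_ext. intros. ring.
  - unfold iter_subst. simpl. destruct (Nat.eqb_spec i0 i) as [->|Hne].
    + destruct HT as [Htr HT].
      destruct (HT (incr i 1 l)) as [J1 H1]; [now rewrite incr_length|].
      destruct (HT (incr m 1 l)) as [J2 H2]; [now rewrite incr_length|].
      (* The sum coming from z_m has one term fewer, so J must be a successor whose predecessor is
         still past both thresholds. *)
      exists (S (Nat.max J1 J2)). intros J HJ. destruct J as [|J]; [lia|].
      cbn [ev]. rewrite (H1 (S J)), (H2 J) by lia.
      rewrite nth_incr, nth_incr_neq by (lia || assumption).
      pose (f := fun j => F (incr i (1 - Z.of_nat j) (incr m (Z.of_nat j) l))).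
      replace (csum (S J) (fun j => signed_binom (nth i l 0%Z) j *
          F (incr i 1 (incr i (- Z.of_nat j) (incr m (Z.of_nat j) l))))%C)
        with (csum (S J) (fun j => signed_binom (nth i l 0%Z) j * f j)%C).
      * rewrite <- (csum_pascal _ J f). f_equal; apply csum_ext; intros j _; f_equal; unfold f.
        -- rewrite (incr_comm m i), incr_incr. do 2 f_equal. lia.
        -- rewrite incr_incr. f_equal. f_equal; [lia|f_equal; lia].
      * apply csum_ext. intros j _. unfold f. rewrite incr_incr. do 3 f_equal.
    + destruct HT as [Htr HT].
      destruct (HT (incr i0 1 l)) as [J1 H1]; [now rewrite incr_length|].
      exists J1. intros J HJ. simpl. rewrite (H1 J HJ).
      rewrite nth_incr_neq by auto. apply csum_ext. intros j _.
      now rewrite (incr_comm m i0), (incr_comm i i0).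
  - destruct (IHo1 F Ft HT) as [_ T1]. destruct (IHo2 F Ft HT) as [_ T2].
    destruct (T1 l Hl) as [J1 H1]. destruct (T2 l Hl) as [J2 H2].
    exists (Nat.max J1 J2). intros J HJ. unfold iter_subst in *. simpl.
    rewrite (H1 J), (H2 J), <- csum_add by lia. apply csum_ext. intros. ring.
  - destruct (IHo1 F Ft HT) as [_ T1]. destruct (IHo2 F Ft HT) as [_ T2].
    destruct (T1 l Hl) as [J1 H1]. destruct (T2 l Hl) as [J2 H2].
    exists (Nat.max J1 J2). intros J HJ. unfold iter_subst in *. simpl.
    rewrite (H1 J), (H2 J) by lia.
    replace (csum J (fun j => signed_binom (nth i l 0%Z) j * (ev o1 F (incr i (- Z.of_nat j) (incr m (Z.of_nat j) l)) - ev o2 F (incr i (- Z.of_nat j) (incr m (Z.of_nat j) l))))%C)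
     with (csum J (fun j => signed_binom (nth i l 0%Z) j * ev o1 F (incr i (- Z.of_nat j) (incr m (Z.of_nat j) l)) + (- C1) * (signed_binom (nth i l 0%Z) j * ev o2 F (incr i (- Z.of_nat j) (incr m (Z.of_nat j) l))))%C)
     by (apply csum_ext; intros; ring).
    rewrite csum_add, csum_scale. ring.
Qed.

Lemma change_var_unique (n i m : nat) (F Ft Gt : list Z -> C) :
  change_var n i m F Ft -> change_var n i m F Gt -> forall l, length l = n -> Ft l = Gt l.
Proof.
  intros [_ H1] [_ H2] l Hl. destruct (H1 l Hl) as [J1 K1]. destruct (H2 l Hl) as [J2 K2].
  rewrite (K1 (Nat.max J1 J2)), (K2 (Nat.max J1 J2)) by lia. reflexivity.
Qed.

Lemma change_var_ext (n i m : nat) (F G Ft Gt : list Z -> C) :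
  (forall l, length l = n -> F l = G l) -> (forall l, length l = n -> Ft l = Gt l) ->
  change_var n i m F Ft -> change_var n i m G Gt.
Proof.
  intros E Et [H1 H2]. split.
  - intros l Hl. destruct (H1 l Hl) as [J HJ]. exists J. intros j Hj.
    rewrite <- E by (now rewrite !incr_length). auto.
  - intros l Hl. destruct (H2 l Hl) as [J HJ]. exists J. intros j Hj.
    rewrite <- Et, (HJ j Hj) by assumption. apply csum_ext. intros.
    now rewrite E by (now rewrite !incr_length).
Qed.

Lemma csum_stable (J0 : nat) (f : nat -> C) :
  (forall j, (J0 <= j)%nat -> f j = C0) -> forall J, (J0 <= J)%nat -> csum J f = csum J0 f.
Proof.
  intros Hf J HJ. induction J as [|J IH].
  - now replace J0 with 0%nat by lia.
  - destruct (Nat.eq_dec J0 (S J)) as [->|]; [reflexivity|].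
    rewrite csum_S, IH, Hf by lia. ring.
Qed.

Lemma change_var_exists (n i m : nat) (F : list Z -> C) :
  diag_trunc n i m F -> exists Ft, change_var n i m F Ft.
Proof.
  intros HF.
  pose (P := fun l y => length l = n -> exists J0, forall J, (J0 <= J)%nat ->
    y = csum J (fun j => signed_binom (nth i l 0%Z) j *
                         F (incr i (- Z.of_nat j) (incr m (Z.of_nat j) l)))%C).
  assert (HP : forall l, exists y, P l y).
  { intros l. destruct (Nat.eq_dec (length l) n) as [Hl|Hl].
    - destruct (HF l Hl) as [J0 H0].
      exists (csum J0 (fun j => signed_binom (nth i l 0%Z) j *
                         F (incr i (- Z.of_nat j) (incr m (Z.of_nat j) l)))%C).
      intros _. exists J0. intros J HJ. symmetry. apply csum_stable; [|assumption].
      intros j Hj. rewrite H0 by assumption. ring.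
    - exists C0. intros E. contradiction. }
  exists (fun l => proj1_sig (constructive_indefinite_description _ (HP l))).
  split; [assumption|]. intros l.
  exact (proj2_sig (constructive_indefinite_description _ (HP l))).
Qed.

(* Each value of F on a diagonal is the leading term of the corresponding value of
   Ft, so vanishing propagates downwards along the diagonal. *)
Lemma change_var_vanish (n i m : nat) (F Ft : list Z -> C) (P : list Z -> Prop) :
  (forall l j, P l -> length l = n -> signed_binom (nth i l 0%Z) j <> C0 ->
     P (incr i (- Z.of_nat j) (incr m (Z.of_nat j) l))) ->
  change_var n i m F Ft ->
  (forall l, length l = n -> P l -> Ft l = C0) ->
  forall l, length l = n -> P l -> F l = C0.
Proof.
  intros HP [Htr HT] Hz l Hl HPl. destruct (Htr l Hl) as [d Hd].
  (* Induction on d, the number of diagonal steps after which F is known to vanish; a step by j >= 1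
     lowers it. *)
  revert l Hl HPl Hd. induction d as [|d IH]; intros l Hl HPl Hd.
  - specialize (Hd 0%nat (le_n _)). simpl in Hd. now rewrite !incr_0 in Hd.
  - destruct (HT l Hl) as [J HJ]. specialize (HJ (S J) ltac:(lia)).
    rewrite Hz in HJ by assumption.
    (* All terms with j >= 1 vanish, either by the binomial or by induction, so [Ft l] reduces to
       its leading term [F l]. *)
    rewrite (csum_stable 1) in HJ; [| |lia].
    + unfold csum in HJ. simpl in HJ. rewrite !incr_0 in HJ.
      transitivity (C1 * F l + C0)%C; [ring|now symmetry].
    + intros j Hj. destruct (classic (signed_binom (nth i l 0%Z) j = C0)) as [E|E].
      { rewrite E. ring. }
      rewrite IH; [ring|now rewrite !incr_length|now apply HP|].
      intros j' Hj'. rewrite (incr_comm m i), !incr_incr.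
      replace (- Z.of_nat j' + - Z.of_nat j)%Z with (- Z.of_nat (j' + j))%Z by lia.
      replace (Z.of_nat j' + Z.of_nat j)%Z with (Z.of_nat (j' + j)) by lia.
      apply Hd. lia.
Qed.

(** * Weak associativity from rationality, associativity and the pole-order bound *)

Lemma length2 (l : list Z) : length l = 2%nat -> exists k m, l = [k; m].
Proof.
  destruct l as [|k [|m [|? ?]]]; simpl; intros H; try discriminate. now exists k, m.
Qed.

(** Variable i receives the small value T^(-m): i = 1 for products, where |z_1| < |z_0|, and i = 0
    for iterates, where |y| < |z_1|. *)
Definition scale_point (i : nat) (T : R) (m : Z) (j : nat) : C :=
  if Nat.eqb j i then Czpow (RtoC T) (- m) else RtoC T.

(** At these points the two-variable series becomes a series in T alone. The degree band and a large
    m make the exponents distinct, and truncation in variable i bounds them above, so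
    [abs_conv_zero_coeffs] applies. *)
Lemma laurent_unique (i : nat) (E : list Z -> C) :
  (i < 2)%nat -> sum_bounded 2 E -> top_bounded 2 i E ->
  (forall T m, 2 <= T -> (1 <= m)%Z -> abs_conv_to 2 (tm (scale_point i T m) E) C0) ->
  forall l, length l = 2%nat -> E l = C0.
Proof.
  intros Hi [D HD] [K HK] Hconv.
  (* On the strip |k + l| <= D the exponents below are distinct once m > 2D. *)
  pose (m := (2 * Z.abs D + 2)%Z).
  assert (Hinj : forall c d, (Z.abs d <= 2 * Z.abs D -> (m + 1) * c = d -> c = 0)%Z) by (unfold m; nia).
  apply (abs_conv_zero_coeffs 2 E
    (fun l => m * (nth i l 0%Z + 1) - nth (1 - i) l 0%Z - 1)%Z
    ((m + 1) * Z.abs K + m + Z.abs D)%Z).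
  - intros k Hk Hn. specialize (HD k Hk Hn). specialize (HK k Hk Hn).
    destruct (length2 k Hk) as (x & y & ->). simpl in HD.
    assert (Hm : (0 <= m)%Z) by (unfold m; lia). clearbody m.
    assert (H : ((m + 1) * nth i [x; y] 0 <= (m + 1) * Z.abs K)%Z) by (apply Z.mul_le_mono_nonneg_l; lia).
    destruct i as [|[|i]]; [| |lia]; simpl in *; lia.
  - intros k l Hk Hl Hnk Hnl.
    pose proof (HD k Hk Hnk) as D1. pose proof (HD l Hl Hnl) as D2.
    destruct (length2 k Hk) as (x & y & ->). destruct (length2 l Hl) as (x' & y' & ->).
    simpl in D1, D2. intros Hw.
    assert (x = x' /\ y = y'); [|intuition congruence].
    destruct i as [|[|i]]; [| |lia]; simpl in Hw.
    + assert (Hx : ((m + 1) * (x - x') = (x + y) - (x' + y'))%Z) by lia.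
      apply Hinj in Hx; [|lia]. assert (x = x') by lia. subst x'. lia.
    + assert (Hx : ((m + 1) * (y - y') = (x + y) - (x' + y'))%Z) by lia.
      apply Hinj in Hx; [|lia]. assert (y = y') by lia. subst y'. lia.
  - intros T HT. assert (HT0 : RtoC T <> C0) by (apply Cnorm_pos_neq0; rewrite Cnorm_RtoC; lra).
    apply (abs_conv_ext 2 (tm (scale_point i T m) E)); [|apply Hconv; [assumption|unfold m; lia]].
    intros k Hk. destruct (length2 k Hk) as (x & y & ->). unfold tm.
    destruct i as [|[|i]]; [| |lia]; unfold scale_point; simpl;
      rewrite Czpow_Czpow by assumption; f_equal.
    + replace (m * (x + 1) - y - 1)%Z with (- m * (- x - 1) + (- y - 1))%Z by ring.
      rewrite Czpow_add by assumption. ring.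
    + replace (m * (y + 1) - x - 1)%Z with (- m * (- y - 1) + (- x - 1))%Z by ring.
      rewrite Czpow_add by assumption. ring.
Qed.

Lemma scale_point_small (T : R) (m : Z) :
  2 <= T -> (1 <= m)%Z -> exists x, 0 < x <= 1 /\ Czpow (RtoC T) (- m) = RtoC x.
Proof.
  intros HT Hm. destruct (Czpow_RtoC T (- m)) as (x & Hx & E); [lra|].
  exists x. split; [split; [assumption|]|assumption].
  rewrite <- (Cnorm_RtoC x), <- E by lra. rewrite <- Cnorm_1. change C1 with (Czpow (RtoC T) 0).
  apply Cnorm_Czpow_mono; [lra|lia].
Qed.

(** The constant series 1: with the convention x^(-k-1), exponent 0 sits at index -1. *)
Definition const_one (l : list Z) : C := if list_eq_dec Z.eq_dec l [-1; -1]%Z then C1 else C0.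

Lemma const_one_neq0 (l : list Z) : const_one l <> C0 -> l = [-1; -1]%Z.
Proof. unfold const_one. destruct list_eq_dec; intuition. Qed.

Lemma abs_conv_const_one (z : nat -> C) : abs_conv_to 2 (tm z const_one) C1.
Proof.
  replace C1 with (Csum (map (tm z const_one) [[-1; -1]%Z])).
  - apply abs_conv_finite.
    + split; repeat constructor. intros [].
    + intros k _ Hk. unfold tm, const_one. destruct list_eq_dec; [subst; simpl in Hk; tauto|ring].
  - simpl. unfold tm, const_one. destruct list_eq_dec; [simpl; ring|congruence].
Qed.

Lemma change_var_const_one : change_var 2 0 1 const_one const_one.
Proof.
  split.
  - intros l Hl. destruct (length2 l Hl) as (a & b & ->).
    exists (Z.to_nat (Z.abs b + 1)). intros j Hj. unfold const_one.
    destruct list_eq_dec as [E|]; [|reflexivity]. simpl in E. injection E. intros. lia.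
  - intros l Hl. destruct (length2 l Hl) as (a & b & ->). exists 1%nat. intros J HJ.
    rewrite (csum_stable 1); [| |assumption].
    + unfold csum. simpl. rewrite !Z.add_0_r. ring.
    (* A nonzero value at a diagonal point forces a = j - 1, and then binom(a, j) = 0. *)
    + intros j Hj. simpl. unfold const_one. destruct list_eq_dec as [E|]; [|ring].
      injection E. intros Hb Ha. rewrite signed_binom_0 by lia. ring.
Qed.

Fixpoint poly_op (p : poly) : op :=
  match p with
  | [] => OC C0
  | (c, e) :: p' => OAdd (OMul (OC c) (OMul (opow (OX 0) (e 0%nat)) (opow (OX 1) (e 1%nat)))) (poly_op p')
  end.

Lemma val_poly_op (z : nat -> C) (p : poly) : val z (poly_op p) = peval 2 p z.
Proof.
  induction p as [|[c e] p IH]; [reflexivity|].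
  simpl. rewrite IH, !val_opow. unfold peval. simpl. ring.
Qed.

Lemma ovars_poly_op (p : poly) : ovars (fun i => (i < 2)%nat) (poly_op p).
Proof.
  induction p as [|[c e] p IH]; simpl; auto.
  repeat split; auto; apply ovars_opow; simpl; lia.
Qed.

Definition denom_op (a : nat -> nat) (b : nat -> nat -> nat) : op :=
  OMul (opow (OX 0) (a 0%nat)) (OMul (opow (OX 1) (a 1%nat)) (opow (OSub (OX 0) (OX 1)) (b 0%nat 1%nat))).

Lemma val_denom_op (z : nat -> C) (a : nat -> nat) (b : nat -> nat -> nat) :
  val z (denom_op a b) = denom 2 a b z.
Proof. unfold denom, denom_op. simpl. rewrite !val_opow. simpl. ring. Qed.

Lemma ovars_denom_op (a : nat -> nat) (b : nat -> nat -> nat) :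
  ovars (fun i => (i < 2)%nat) (denom_op a b).
Proof. simpl. repeat split; apply ovars_opow; simpl; lia. Qed.

Definition iter_point (z : nat -> C) (i : nat) : C :=
  match i with O => (z 0%nat - z 1%nat)%C | _ => z 1%nat end.

Lemma val_iter_subst (z : nat -> C) (o : op) :
  ovars (fun i => (i < 2)%nat) o -> val (iter_point z) (iter_subst 0 1 o) = val z o.
Proof.
  unfold iter_subst. induction o; simpl; intros H; try (destruct H; rewrite IHo1, IHo2 by assumption); auto.
  destruct i as [|[|i]]; simpl; [ring|reflexivity|lia].
Qed.

Lemma ovars_iter_subst (n i m : nat) (o : op) :
  (i < n)%nat -> (m < n)%nat -> ovars (fun j => (j < n)%nat) o ->
  ovars (fun j => (j < n)%nat) (iter_subst i m o).
Proof.
  intros Hi Hm. apply ovars_osub. intros j Hj. destruct (Nat.eqb j i); simpl; auto.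
Qed.

(** Denominators that act as monomials in the coordinates y, z_1: the difference z_0 - z_1 turns
    into (y + z_1) - z_1, which acts as y. They are invertible on all series, unlike z_0 = y +
    z_1. *)
Inductive iter_factor : op -> Prop :=
| if_one : iter_factor (OC C1)
| if_x : iter_factor (OX 1)
| if_y : iter_factor (OSub (OAdd (OX 0) (OX 1)) (OX 1))
| if_mul a b : iter_factor a -> iter_factor b -> iter_factor (OMul a b).

Lemma iter_factor_opow (o : op) (n : nat) : iter_factor o -> iter_factor (opow o n).
Proof. intros H. induction n; simpl; constructor; auto. Qed.

Lemma top_bounded_ext (n i : nat) (F G : list Z -> C) :
  (forall l, length l = n -> F l = G l) -> top_bounded n i F -> top_bounded n i G.
Proof. intros E [K HK]. exists K. intros l Hl. rewrite <- E by assumption. auto. Qed.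

Lemma iter_factor_top_bounded (o : op) (F : list Z -> C) :
  iter_factor o -> top_bounded 2 0 (ev o F) -> top_bounded 2 0 F.
Proof.
  intros Ho. revert F. induction Ho; intros F [K HK]; simpl in HK.
  - exists K. intros l Hl Hn. apply HK; auto. intros E. apply Hn.
    transitivity (C1 * F l)%C; [ring|assumption].
  - exists K. intros l Hl Hn. specialize (HK (incr 1 (-1) l)).
    rewrite incr_length, nth_incr_neq, incr_incr, incr_0 in HK by lia. auto.
  - exists (K + 1)%Z. intros l Hl Hn. specialize (HK (incr 0 (-1) l)).
    rewrite incr_length, nth_incr, incr_incr, incr_0 in HK by lia.
    assert (nth 0 l 0 + -1 < K)%Z; [|lia]. apply HK; auto. intros E. apply Hn.
    rewrite <- E. ring.
  - apply IHHo2, IHHo1. now exists K.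
Qed.

(** In general y + z_1 annihilates an alternating delta series. Truncation in y excludes it: d(k, l)
    = - d(k+1, l-1) moves the first index up until it passes K. *)
Lemma sum_shift_injective (d : list Z -> C) :
  top_bounded 2 0 d -> (forall l, length l = 2%nat -> ev (OAdd (OX 0) (OX 1)) d l = C0) ->
  forall l, length l = 2%nat -> d l = C0.
Proof.
  intros [K HK] H l Hl.
  assert (Hind : forall j l, length l = 2%nat -> (K <= nth 0 l 0 + Z.of_nat j)%Z -> d l = C0).
  { clear l Hl. induction j as [|j IH]; intros l Hl Hj.
    - apply NNPP. intros Hn. specialize (HK l Hl Hn). lia.
    - specialize (H (incr 1 (-1) l)). rewrite incr_length in H. specialize (H Hl).
      simpl in H. rewrite incr_incr in H. simpl in H. rewrite incr_0 in H.
      rewrite (IH (incr 0 1 (incr 1 (-1) l))) in H.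
      + rewrite <- H. ring.
      + now rewrite !incr_length.
      + rewrite nth_incr by (rewrite incr_length; lia). rewrite nth_incr_neq by lia. lia. }
  apply (Hind (Z.to_nat (Z.abs K + Z.abs (nth 0 l 0%Z)))); [assumption|lia].
Qed.

Inductive iter_denominator : op -> Prop :=
| id_factor a : iter_factor a -> iter_denominator a
| id_z : iter_denominator (OAdd (OX 0) (OX 1))
| id_mul a b : iter_denominator a -> iter_denominator b -> iter_denominator (OMul a b).

Lemma iter_denominator_opow (o : op) (n : nat) : iter_denominator o -> iter_denominator (opow o n).
Proof. intros H. induction n; simpl; [do 2 constructor|apply id_mul; auto]. Qed.

Lemma iter_factor_injective (o : op) :
  iter_factor o -> forall d, (forall l, length l = 2%nat -> ev o d l = C0) ->
  forall l, length l = 2%nat -> d l = C0.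
Proof.
  induction 1; simpl; intros d Hd l Hl.
  - rewrite <- (Hd l Hl). ring.
  - specialize (Hd (incr 1 (-1) l)). rewrite incr_length, incr_incr, incr_0 in Hd. auto.
  - specialize (Hd (incr 0 (-1) l)). rewrite incr_length, incr_incr, incr_0 in Hd.
    rewrite <- Hd by assumption. ring.
  - apply IHiter_factor2; auto.
Qed.

Lemma iter_denominator_injective (o : op) :
  iter_denominator o -> forall d, top_bounded 2 0 d ->
  (forall l, length l = 2%nat -> ev o d l = C0) -> forall l, length l = 2%nat -> d l = C0.
Proof.
  induction 1; intros d Ht Hd.
  - now apply iter_factor_injective with a.
  - now apply sum_shift_injective.
  - apply IHiter_denominator2; auto. apply IHiter_denominator1; auto. apply top_bounded_ev; auto.
Qed.

Lemma iter_subst_opow (i m : nat) (o : op) (n : nat) :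
  iter_subst i m (opow o n) = opow (iter_subst i m o) n.
Proof. apply osub_opow. Qed.

Lemma top_bounded_diag_trunc (n i m : nat) (F : list Z -> C) :
  (m < n)%nat -> i <> m -> top_bounded n m F -> diag_trunc n i m F.
Proof.
  intros Hm Him [K HK] l Hl. exists (Z.to_nat (Z.abs K + Z.abs (nth m l 0%Z))). intros j Hj.
  apply NNPP. intros Hn. apply HK in Hn; [|now rewrite !incr_length].
  rewrite nth_incr_neq, nth_incr in Hn by lia. lia.
Qed.

Section WeakAssociativity.

Variables (F G : list Z -> C) (N : nat).
Variables (p1 p2 : poly) (a1 a2 : nat -> nat) (b1 b2 : nat -> nat -> nat).
Hypothesis Ha1 : (a1 0%nat <= N)%nat.
Hypothesis F_conv : forall z, prod_dom 2 z -> abs_conv_to 2 (tm z F) (ratval 2 p1 a1 b1 z).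
Hypothesis G_conv : forall z, iter_dom z -> abs_conv_to 2 (tm (iter_point z) G) (ratval 2 p2 a2 b2 z).
Hypothesis FG_assoc : forall z, assoc_dom z -> ratval 2 p1 a1 b1 z = ratval 2 p2 a2 b2 z.
Hypothesis F_sum : sum_bounded 2 F.
Hypothesis G_sum : sum_bounded 2 G.
Hypothesis F_top : top_bounded 2 1 F.
Hypothesis G_top : top_bounded 2 0 G.

Lemma sum_bounded_const_one : sum_bounded 2 const_one.
Proof. exists 2%Z. intros l _ Hn. apply const_one_neq0 in Hn. subst l. simpl. lia. Qed.

Lemma top_bounded_const_one (i : nat) : (i < 2)%nat -> top_bounded 2 i const_one.
Proof.
  intros Hi. exists 0%Z. intros l _ Hn. apply const_one_neq0 in Hn. subst l.
  destruct i as [|[|i]]; simpl; lia.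
Qed.

Lemma prod_dom2_pole (z : nat -> C) : prod_dom 2 z ->
  z 0%nat <> C0 /\ z 1%nat <> C0 /\ (z 0%nat - z 1%nat)%C <> C0.
Proof.
  intros Hz. repeat split; try (apply prod_dom_neq0 with 2%nat; auto; lia).
  apply (pole_factor_neq0 2 z (OSub (OX 0) (OX 1)) Hz). constructor; lia.
Qed.

Lemma val_denom_op_neq0 (z : nat -> C) (a : nat -> nat) (b : nat -> nat -> nat) :
  z 0%nat <> C0 -> z 1%nat <> C0 -> (z 0%nat - z 1%nat)%C <> C0 -> val z (denom_op a b) <> C0.
Proof.
  intros H0 H1 H2. simpl. rewrite !val_opow. simpl.
  repeat apply Cmul_neq0; now apply Cpow_neq0.
Qed.

(** Both sides have the same values on the product region and are truncated in z_1, so the equality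
    of functions descends to coefficients. *)
Lemma denom_op_clears : forall l, length l = 2%nat ->
  ev (denom_op a1 b1) F l = ev (poly_op p1) const_one l.
Proof.
  intros l Hl.
  assert (H : (ev (denom_op a1 b1) F l - ev (poly_op p1) const_one l)%C = C0).
  2:{ transitivity ((ev (denom_op a1 b1) F l - ev (poly_op p1) const_one l) + ev (poly_op p1) const_one l)%C;
      [ring|rewrite H; ring]. }
  revert l Hl. apply (laurent_unique 1); [lia| | |].
  - apply sum_bounded_sub; apply sum_bounded_ev; [assumption|apply sum_bounded_const_one].
  - apply top_bounded_sub; apply top_bounded_ev; try lia; [assumption|apply top_bounded_const_one; lia].
  - intros T m HT Hm. set (z := scale_point 1 T m).
    assert (Hz : prod_dom 2 z).
    { destruct (scale_point_small T m HT Hm) as (x & Hx & E).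
      assert (E0 : z 0%nat = RtoC T) by reflexivity.
      assert (E1 : z 1%nat = RtoC x) by (unfold z, scale_point; simpl; exact E).
      split; intros i Hi.
      - destruct i as [|[|i]]; [rewrite E0|rewrite E1|lia]; rewrite Cnorm_RtoC; lra.
      - destruct i as [|i]; [|lia]. rewrite E0, E1, !Cnorm_RtoC; lra. }
    destruct (prod_dom2_pole z Hz) as (H0 & H1 & H2).
    assert (Hz0 : forall i, (i < 2)%nat -> z i <> C0) by (intros; now apply prod_dom_neq0 with 2%nat).
    replace C0 with (val z (denom_op a1 b1) * ratval 2 p1 a1 b1 z - val z (poly_op p1) * C1)%C.
    + apply abs_conv_tm_sub; apply abs_conv_ev; auto using ovars_denom_op, ovars_poly_op, abs_conv_const_one.
    + unfold ratval. rewrite <- val_denom_op, val_poly_op. field. now apply val_denom_op_neq0.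
Qed.

Lemma iter_point_neq0 (z : nat -> C) (i : nat) : iter_dom z -> (i < 2)%nat -> iter_point z i <> C0.
Proof.
  intros [H1 H2] Hi. apply Cnorm_pos_neq0. destruct i as [|i]; simpl; [assumption|].
  now apply Rlt_trans with (Cnorm (z 0%nat - z 1%nat)).
Qed.

(** Since N is at least the pole order at z_0 = 0, z_0^N F has only the denominators z_1 and z_0 -
    z_1 left. These are monomials in iterate coordinates, so the transform [Ft] of z_0^N F is
    truncated in y, exactly as the iterate is. Two such series are equal once they agree after a
    common denominator is cleared. *)
Theorem weak_associativity :
  change_var 2 0 1 (ev (opow (OX 0) N) F) (ev (opow (OAdd (OX 0) (OX 1)) N) G).
Proof.
  set (XN := opow (OX 0) N).
  change (opow (OAdd (OX 0) (OX 1)) N) with (opow (iter_subst 0 1 (OX 0)) N).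
  rewrite <- iter_subst_opow. fold XN.
  destruct (change_var_exists 2 0 1 (ev XN F)) as [Ft HFt].
  { apply diag_trunc_ev, top_bounded_diag_trunc; auto; lia. }
  (* r collects the denominators other than z_0, and t the surplus power of z_0 left when N exceeds
     the actual pole order. *)
  set (r := OMul (opow (OX 1) (a1 1%nat)) (opow (OSub (OX 0) (OX 1)) (b1 0%nat 1%nat))).
  set (t := opow (OX 0) (N - a1 0%nat)).
  assert (Hr : forall l, length l = 2%nat ->
    ev (iter_subst 0 1 r) Ft l = ev (iter_subst 0 1 t) (ev (iter_subst 0 1 (poly_op p1)) const_one) l).
  { apply (change_var_unique 2 0 1 (ev r (ev XN F))).
    - apply change_var_ev; auto; lia.
    - apply (change_var_ext 2 0 1 (ev t (ev (poly_op p1) const_one)) _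
        (ev (iter_subst 0 1 t) (ev (iter_subst 0 1 (poly_op p1)) const_one))); auto.
      + intros l Hl.
        rewrite (ev_ext_length 2 t _ (ev (denom_op a1 b1) F)); auto.
        * unfold XN. replace N with ((N - a1 0%nat) + a1 0%nat)%nat by lia.
          rewrite ev_opow_add. fold t. unfold denom_op. fold r.
          change (ev (OMul (opow (OX 0) (a1 0%nat)) r) F) with (ev (opow (OX 0) (a1 0%nat)) (ev r F)).
          rewrite (ev_comm r t). now rewrite (ev_comm r).
        * intros. symmetry. now apply denom_op_clears.
      + apply change_var_ev; try lia. apply change_var_ev; try lia. apply change_var_const_one. }
  assert (Hrf : iter_factor (iter_subst 0 1 r)).
  { unfold iter_subst, r. cbn [osub]. rewrite !osub_opow. apply if_mul; apply iter_factor_opow; constructor. }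
  (* r [Ft] is a Laurent polynomial, and r is a monomial in the new coordinates. *)
  assert (HtF : top_bounded 2 0 Ft).
  { apply (iter_factor_top_bounded _ _ Hrf).
    apply (top_bounded_ext 2 0 (ev (iter_subst 0 1 t) (ev (iter_subst 0 1 (poly_op p1)) const_one))).
    - intros; symmetry; auto.
    - repeat (apply top_bounded_ev; [lia|]). apply top_bounded_const_one. lia. }
  set (Gt := ev (iter_subst 0 1 XN) G).
  set (q := iter_subst 0 1 (denom_op a2 b2)).
  (* Both cleared series represent the same function where product and iterate regions overlap;
     there associativity identifies the two rational functions. *)
  assert (HE : forall l, length l = 2%nat ->
    (ev q (ev (iter_subst 0 1 t) (ev (iter_subst 0 1 (poly_op p1)) const_one)) l
      - ev (iter_subst 0 1 r) (ev (iter_subst 0 1 XN) (ev q G)) l)%C = C0).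
  { apply (laurent_unique 0); [lia| | |].
    - apply sum_bounded_sub; repeat apply sum_bounded_ev; [apply sum_bounded_const_one|assumption].
    - apply top_bounded_sub; repeat (apply top_bounded_ev; [lia|]); [apply top_bounded_const_one; lia|assumption].
    - intros T m HT Hm.
      destruct (scale_point_small T m HT Hm) as (x & Hx & E).
      (* With y = x = T^(-m) and z_1 = T, the point z_0 = T + x lies in both regions, and its
         iterate coordinates form a scale point. *)
      pose (z := fun i => match i with O => RtoC (T + x) | _ => RtoC T end).
      assert (Ep : forall l, length l = 2%nat ->
        zmono (iter_point z) 0 l = zmono (scale_point 0 T m) 0 l).
      { intros l Hl. destruct (length2 l Hl) as (k & j & ->). simpl.
        unfold scale_point. simpl. rewrite E. do 3 f_equal. apply C_ext; simpl; ring. }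
      assert (E0 : (z 0%nat - z 1%nat)%C = RtoC x) by (apply C_ext; simpl; ring).
      assert (Hz : assoc_dom z).
      { split; [|split].
        - simpl. rewrite !Cnorm_RtoC; lra.
        - rewrite E0, Cnorm_RtoC; lra.
        - rewrite E0. simpl. rewrite !Cnorm_RtoC; lra. }
      assert (Hp : prod_dom 2 z).
      { destruct Hz as [H1 _]. split; intros i Hi.
        - destruct i; simpl; rewrite Cnorm_RtoC; lra.
        - destruct i; [assumption|lia]. }
      destruct (prod_dom2_pole z Hp) as (H0 & H1 & H2).
      apply (abs_conv_ext 2 (tm (iter_point z)
        (fun l => (ev q (ev (iter_subst 0 1 t) (ev (iter_subst 0 1 (poly_op p1)) const_one)) l
          - ev (iter_subst 0 1 r) (ev (iter_subst 0 1 XN) (ev q G)) l)%C))).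
      { intros k Hk. unfold tm. now rewrite Ep. }
      assert (Hi : iter_dom z) by apply Hz.
      assert (Or : ovars (fun i => (i < 2)%nat) r).
      { split; apply ovars_opow; simpl; lia. }
      assert (Ot : ovars (fun i => (i < 2)%nat) t) by (apply ovars_opow; simpl; lia).
      assert (ON : ovars (fun i => (i < 2)%nat) XN) by (apply ovars_opow; simpl; lia).
      assert (Oq := ovars_denom_op a2 b2).
      assert (Op := ovars_poly_op p1).
      assert (V : C0 = (val z (denom_op a2 b2) * (val z t * (val z (poly_op p1) * C1))
        - val z r * (val z XN * (val z (denom_op a2 b2) * ratval 2 p2 a2 b2 z)))%C).
      { rewrite <- FG_assoc by assumption. unfold ratval.
        rewrite <- (val_denom_op z a1 b1), val_poly_op.
        assert (Er : val z (denom_op a1 b1) = (Cpow (z 0%nat) (a1 0%nat) * val z r)%C).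
        { unfold denom_op. fold r. cbn [val]. now rewrite val_opow. }
        assert (EN : val z XN = (val z t * Cpow (z 0%nat) (a1 0%nat))%C).
        { unfold XN, t. rewrite !val_opow. simpl val.
          replace N with ((N - a1 0%nat) + a1 0%nat)%nat at 1 by lia.
          rewrite <- !Czpow_nat, <- Czpow_add by assumption. f_equal. lia. }
        assert (Hn := val_denom_op_neq0 z a1 b1 H0 H1 H2). rewrite Er in Hn.
        rewrite Er, EN. field.
        split; intros Ez; apply Hn; rewrite Ez; ring. }
      rewrite V.
      rewrite <- (val_iter_subst z r), <- (val_iter_subst z t), <- (val_iter_subst z (poly_op p1)),
        <- (val_iter_subst z XN), <- (val_iter_subst z (denom_op a2 b2)) by assumption.
      assert (Hi0 : forall i, (i < 2)%nat -> iter_point z i <> C0) by (intros; now apply iter_point_neq0).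
      unfold q.
      apply abs_conv_tm_sub; repeat (apply abs_conv_ev; [assumption|apply ovars_iter_subst; (lia || assumption)|]);
        auto using abs_conv_const_one. }
  assert (Hd : forall l, length l = 2%nat -> (Ft l - Gt l)%C = C0).
  { assert (Hqf : iter_denominator q).
    { unfold q, iter_subst, denom_op. cbn [osub]. rewrite !osub_opow.
      apply id_mul; [apply iter_denominator_opow, id_z|].
      apply id_factor, if_mul; apply iter_factor_opow; constructor. }
    (* q contains powers of y + z_1, so this cancellation relies on the truncation of [Ft] and [Gt]
       in y. *)
    apply (iter_denominator_injective (OMul q (iter_subst 0 1 r))).
    - apply id_mul; [assumption|now apply id_factor].
    - apply top_bounded_sub; [assumption|]. apply top_bounded_ev; [lia|assumption].
    - intros l Hl. rewrite <- (HE l Hl). cbn [ev]. rewrite (ev_sub (iter_subst 0 1 r)), ev_sub.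
      f_equal.
      + revert l Hl. apply ev_ext_length. assumption.
      + unfold Gt. now rewrite (ev_comm q), (ev_comm q). }
  apply (change_var_ext 2 0 1 (ev XN F) _ Ft); auto.
  intros l Hl. transitivity ((Ft l - Gt l) + Gt l)%C; [ring|].
  rewrite Hd by assumption. ring.
Qed.

End WeakAssociativity.

(** * Regularity of products in the leftmost variable *)

(* The formal content of the module axioms: Vd and Wd are the graded duals and N u w
   bounds both the truncation order of Y(u,x)w and the pole order at z_1 = 0. *)
Record formal_module {V W : VSpace} (YV : V -> V -> Z -> V) (Y : V -> W -> Z -> W)
    (Vd : (V -> C) -> Prop) (Wd : (W -> C) -> Prop) (N : V -> W -> nat) : Prop := {
  fm_comp : forall f u k, Wd f -> Wd (fun w => f (Y u w k));
  fm_eval : forall f w k, Wd f -> Vd (fun v => f (Y v w k));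
  fm_trunc : forall f u w k, Wd f -> (Z.of_nat (N u w) <= k)%Z -> f (Y u w k) = C0;
  fm_sum : forall f us w, Wd f -> sum_bounded (length us) (fun ks => f (prodY Y us ks w));
  fm_assoc : forall f u v w, Wd f ->
    change_var 2 0 1
      (ev (opow (OX 0) (N u w)) (fun ks => f (prodY Y [u; v] ks w)))
      (ev (opow (OAdd (OX 0) (OX 1)) (N u w))
          (fun ks => f (Y (YV u v (nth 0 ks 0%Z)) w (nth 1 ks 0%Z))))
}.

Fixpoint diff_op (i j : nat) (Ms : list nat) : op :=
  match Ms with
  | [] => OC C1
  | M :: Ms' => OMul (opow (OSub (OX i) (OX j)) M) (diff_op i (S j) Ms')
  end.

(** Index k >= 0 means the power -k-1 < 0, so the condition says that no negative power of the first
    variable survives. Index lists longer than the product are allowed: for an inner product in V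
    they also carry the index of the outer variable z_n. *)
Definition first_regular {V W : VSpace} (Y : V -> W -> Z -> W) (Wd : (W -> C) -> Prop)
    (N : V -> W -> nat) (M : V -> V -> nat) (us : list V) : Prop :=
  forall u w f ks, Wd f -> (S (length us) <= length ks)%nat -> (0 <= nth 0 ks 0)%Z ->
  ev (OMul (opow (OX 0) (N u w)) (diff_op 0 1 (map (M u) us)))
     (fun ks => f (prodY Y (u :: us) ks w)) ks = C0.

Lemma change_var_cons (n i m : nat) (F Ft : list Z -> C) :
  (forall k, change_var n i m (fun ks => F (k :: ks)) (fun ks => Ft (k :: ks))) ->
  change_var (S n) (S i) (S m) F Ft.
Proof.
  intros H. split; intros [|k l] Hl; try discriminate; destruct (H k) as [H1 H2]; simpl in *.
  - apply H1. congruence.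
  - apply H2. congruence.
Qed.

(** Reduces a change of variable between two slots of a long index list to the two-variable case,
    the other indices being frozen as parameters. *)
Lemma change_var_transfer (n i m : nat) (F Ft : list Z -> C) :
  (forall l, length l = n -> exists F2 Ft2 l2, length l2 = 2%nat /\ nth i l 0%Z = nth 0 l2 0%Z /\
     change_var 2 0 1 F2 Ft2 /\ Ft l = Ft2 l2 /\
     forall x y, F (incr i x (incr m y l)) = F2 (incr 0 x (incr 1 y l2))) ->
  change_var n i m F Ft.
Proof.
  intros H. split; intros l Hl; destruct (H l Hl) as (F2 & Ft2 & l2 & Hl2 & E & [C1 C2] & Et & EF).
  - destruct (C1 l2 Hl2) as [J HJ]. exists J. intros j Hj. rewrite EF. auto.
  - destruct (C2 l2 Hl2) as [J HJ]. exists J. intros j Hj. rewrite Et, (HJ j Hj), E.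
    apply csum_ext. intros. now rewrite EF.
Qed.

Lemma ev_transfer (m : nat) (o : op) (F F2 : list Z -> C) (l l2 : list Z) :
  ovars (fun i => (i < 2)%nat) o ->
  (forall x y, F (incr 0 x (incr m y l)) = F2 (incr 0 x (incr 1 y l2))) ->
  forall x y, ev (osub (fun i => OX (match i with O => O | _ => m end)) o) F (incr 0 x (incr m y l))
    = ev o F2 (incr 0 x (incr 1 y l2)).
Proof.
  intros Ho. revert F F2. induction o; simpl; intros F F2 HF x y.
  - now rewrite HF.
  - destruct i as [|[|i]]; simpl in *; [| |lia].
    + now rewrite !incr_incr.
    + rewrite (incr_comm m 0), (incr_comm 1 0), !incr_incr. apply HF.
  - destruct Ho. now rewrite (IHo1 H F F2), (IHo2 H0 F F2).
  - destruct Ho. now rewrite (IHo1 H F F2), (IHo2 H0 F F2).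
  - destruct Ho. now apply IHo1; [|apply IHo2].
Qed.

Lemma ev_diff_op_app (i j : nat) (Ms : list nat) (M : nat) (F : list Z -> C) :
  ev (diff_op i j (Ms ++ [M])) F =
  ev (diff_op i j Ms) (ev (opow (OSub (OX i) (OX (j + length Ms))) M) F).
Proof.
  revert j. induction Ms as [|M' Ms IH]; intros j.
  - simpl app. simpl length. rewrite Nat.add_0_r. cbn [diff_op ev].
    rewrite ev_scale. reflexivity.
  - simpl. rewrite IH. now rewrite Nat.add_succ_r.
Qed.

Lemma ovars_diff_op (n i j : nat) (Ms : list nat) :
  (i < n)%nat -> (j + length Ms <= n)%nat -> ovars (fun k => (k < n)%nat) (diff_op i j Ms).
Proof.
  intros Hi. revert j. induction Ms; simpl; intros j Hj; auto.
  split; [apply ovars_opow; simpl; lia|apply IHMs; lia].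
Qed.

(* The substitution z_j = y_j + z_m for the variables still in iterate position. *)
Definition iter_from (c m j : nat) : op :=
  if (Nat.leb c j && Nat.ltb j m)%bool then OAdd (OX j) (OX m) else OX j.

Lemma iter_from_step (c m : nat) (o : op) :
  (c < m)%nat -> iter_subst c m (osub (iter_from (S c) m) o) = osub (iter_from c m) o.
Proof.
  intros Hc. unfold iter_subst. rewrite osub_osub. f_equal. extensionality j. unfold iter_from.
  destruct (Nat.leb_spec (S c) j); destruct (Nat.leb_spec c j); destruct (Nat.ltb_spec j m);
    simpl; destruct (Nat.eqb_spec j c); destruct (Nat.eqb_spec m c); try lia; subst; auto.
Qed.

Lemma iter_from_end (m : nat) (o : op) : osub (iter_from m m) o = o.
Proof.
  rewrite <- (osub_OX o) at 2. f_equal. extensionality j. unfold iter_from.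
  destruct (Nat.leb_spec m j); destruct (Nat.ltb_spec j m); simpl; auto; lia.
Qed.

(** Differences of variables in iterate position do not feel the substitution: z_m cancels in (y_0 +
    z_m) - (y_j + z_m). *)
Lemma ev_iter_from_diff_op (m j : nat) (Ms : list nat) (F : list Z -> C) :
  (0 < m)%nat -> (j + length Ms <= m)%nat ->
  ev (osub (iter_from 0 m) (diff_op 0 j Ms)) F = ev (diff_op 0 j Ms) F.
Proof.
  intros Hm. revert j. induction Ms as [|M Ms IH]; intros j Hj; [reflexivity|].
  simpl in *. rewrite osub_opow, IH by lia. apply ev_opow_congr. intros G. extensionality l.
  cbn [osub]. unfold iter_from at 1 2.
  destruct (Nat.ltb_spec 0 m); [|lia]. destruct (Nat.ltb_spec j m); [|lia]. simpl. ring.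
Qed.

Section FormalModule.

Variables (V W : VSpace) (YV : V -> V -> Z -> V) (Y : V -> W -> Z -> W).
Variables (Vd : (V -> C) -> Prop) (Wd : (W -> C) -> Prop).
Variables (N : V -> W -> nat) (M : V -> V -> nat).
Hypothesis HW : formal_module YV Y Vd Wd N.

(* Y(u_1,z_1)...Y(u_c,z_c) Y(Y(u_{c+1},y_{c+1})...Y(u_{m-1},y_{m-1})v, z_m) w, where
   us1 = u_1 ... u_c and us2 lists the remaining u_i. *)
Fixpoint mixY (us1 us2 : list V) (v : V) (w : W) (ks : list Z) : W :=
  match us1, ks with
  | u :: us1', k :: ks' => Y u (mixY us1' us2 v w ks') k
  | _, _ => Y (prodY YV us2 ks v) w (nth (length us2) ks 0%Z)
  end.

Lemma mixY_prodY (us : list V) (v : V) (w : W) (ks : list Z) :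
  (S (length us) <= length ks)%nat -> mixY us [] v w ks = prodY Y (us ++ [v]) ks w.
Proof.
  revert ks. induction us as [|u us IH]; intros [|k ks]; simpl; intros H; try lia.
  - reflexivity.
  - rewrite IH by lia. reflexivity.
Qed.

Lemma prodY_incr (us : list V) (v : V) (ks : list Z) (m : nat) (y : Z) :
  (length us <= m)%nat -> prodY YV us (incr m y ks) v = prodY YV us ks v.
Proof.
  revert ks m. induction us as [|u us IH]; intros [|k ks] [|m]; simpl; intros H; auto; try lia.
  rewrite IH by lia. reflexivity.
Qed.

(** Weak associativity of u against the iterated inner vector. That vector varies with the indices,
    so the exponent [N u w] must not depend on it. The operators on the left are absorbed into the
    functional. *)
Lemma change_var_mixY (us1 : list V) (u : V) (us2 : list V) (v : V) (w : W) (f : W -> C) (n : nat) :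
  Wd f -> (length us1 + S (length us2) < n)%nat ->
  let i := length us1 in let m := (length us1 + S (length us2))%nat in
  change_var n i m
    (ev (opow (OX i) (N u w)) (fun ks => f (mixY (us1 ++ [u]) us2 v w ks)))
    (ev (opow (OAdd (OX i) (OX m)) (N u w)) (fun ks => f (mixY us1 (u :: us2) v w ks))).
Proof.
  revert f n. induction us1 as [|u0 us1 IH]; intros f n Hf Hn i m.
  - subst i m. simpl length in *. simpl Nat.add in *. apply change_var_transfer. intros [|k l] Hl; [simpl in Hl; lia|].
    (* The inner vector does not read slot m, so it stays constant along the diagonal between slots
       0 and m. *)
    set (b := nth (length us2) l 0%Z). set (v' := prodY YV us2 l v).
    eexists _, _, [k; b]. split; [reflexivity|]. split; [reflexivity|].
    split; [exact (fm_assoc _ _ _ _ _ HW f u v' w Hf)|]. split.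
    + assert (E := ev_transfer (S (length us2)) (opow (OAdd (OX 0) (OX 1)) (N u w))
        (fun ks => f (mixY [] (u :: us2) v w ks))
        (fun ks => f (Y (YV u v' (nth 0 ks 0%Z)) w (nth 1 ks 0%Z))) (k :: l) [k; b]).
      rewrite osub_opow in E. simpl osub in E.
      specialize (E ltac:(apply ovars_opow; simpl; lia)).
      rewrite <- (incr_0 (S (length us2)) (k :: l)), <- (incr_0 0 (incr _ _ (k :: l))).
      rewrite E.
      * now rewrite !incr_0.
      * intros x y. simpl. rewrite nth_incr by (simpl in Hl; lia). rewrite prodY_incr by lia. reflexivity.
    + assert (E := ev_transfer (S (length us2)) (opow (OX 0) (N u w))
        (fun ks => f (mixY [u] us2 v w ks))
        (fun ks => f (prodY Y [u; v'] ks w)) (k :: l) [k; b]).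
      rewrite osub_opow in E. simpl osub in E.
      specialize (E ltac:(apply ovars_opow; simpl; lia)).
      apply E. intros x y. simpl. rewrite nth_incr by (simpl in Hl; lia). rewrite prodY_incr by lia. reflexivity.
  - destruct n as [|n]; [simpl in Hn; lia|]. subst i m. simpl length in *.
    apply change_var_cons. intros k.
    specialize (IH (fun w => f (Y u0 w k)) n (fm_comp _ _ _ _ _ HW _ _ _ Hf) ltac:(lia)).
    cbv zeta in IH.
    assert (E1 := ev_olift (opow (OX (length us1)) (N u w)) (fun ks => f (mixY ((u0 :: us1) ++ [u]) us2 v w ks)) k).
    assert (E2 := ev_olift (opow (OAdd (OX (length us1)) (OX (length us1 + S (length us2)))) (N u w)) (fun ks => f (mixY (u0 :: us1) (u :: us2) v w ks)) k).
    unfold olift in E1, E2. rewrite osub_opow in E1, E2. simpl osub in E1, E2.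
    simpl Nat.add. rewrite E1, E2. exact IH.
Qed.

(** One step from iterate to product position: u leaves the inner product, and the vanishing for k_0
    >= 0 returns through [change_var_vanish] at the price of z_i^N(u,w). *)
Lemma mixY_vanish_pole (us1 : list V) (u : V) (us2 : list V) (v : V) (w : W) (f : W -> C) (n : nat) (o : op) :
  Wd f -> (length us1 + S (length us2) < n)%nat ->
  let i := length us1 in let m := (length us1 + S (length us2))%nat in
  (forall ks, length ks = n -> (0 <= nth 0 ks 0)%Z ->
    ev (iter_subst i m o) (fun ks => f (mixY us1 (u :: us2) v w ks)) ks = C0) ->
  forall ks, length ks = n -> (0 <= nth 0 ks 0)%Z ->
    ev (opow (OX i) (N u w)) (ev o (fun ks => f (mixY (us1 ++ [u]) us2 v w ks))) ks = C0.
Proof.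
  intros Hf Hn i m Hz.
  assert (HT := change_var_mixY us1 u us2 v w f n Hf Hn). cbv zeta in HT. fold i m in HT.
  apply (change_var_ev n i m o) in HT; try (subst i m; lia).
  rewrite ev_comm in HT. rewrite (ev_comm (iter_subst i m o)) in HT.
  apply (change_var_vanish n i m _ _ (fun l => 0 <= nth 0 l 0)%Z) with (2 := HT).
  (* For i = 0 the diagonal lowers k_0 by j, but binom(k_0, j) = 0 for j > k_0 >= 0, so k_0 - j
     stays nonnegative wherever it counts. *)
  - intros l j Hl Hlen Hb. destruct (Nat.eq_dec i 0) as [E|E].
    + rewrite E in *. rewrite nth_incr by (rewrite incr_length; lia). rewrite nth_incr_neq by (subst m; lia).
      destruct (Z_le_gt_dec (Z.of_nat j) (nth 0 l 0%Z)); [lia|].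
      elim Hb. apply signed_binom_0; lia.
    + rewrite !nth_incr_neq by (subst m; lia). assumption.
  - intros l Hl HP.
    apply (ev_vanish (fun l => length l = n /\ (0 <= nth 0 l 0)%Z)); [| |now split].
    + intros j l' [H1 H2]. rewrite incr_length. split; [assumption|].
      destruct (Nat.eq_dec 0 j) as [<-|]; [rewrite nth_incr by (subst m; lia); lia|now rewrite nth_incr_neq].
    + intros l' [H1 H2]. now apply Hz.
Qed.

(** For i > 0 the price z_i^N(u,w) is a shift that does not touch k_0, hence it can be undone. This
    is why N enters only through the first vector. *)
Lemma mixY_vanish (us1 : list V) (u : V) (us2 : list V) (v : V) (w : W) (f : W -> C) (n : nat) (o : op) :
  Wd f -> (length us1 + S (length us2) < n)%nat ->
  us1 <> [] ->
  let i := length us1 in let m := (length us1 + S (length us2))%nat in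
  (forall ks, length ks = n -> (0 <= nth 0 ks 0)%Z ->
    ev (iter_subst i m o) (fun ks => f (mixY us1 (u :: us2) v w ks)) ks = C0) ->
  forall ks, length ks = n -> (0 <= nth 0 ks 0)%Z ->
    ev o (fun ks => f (mixY (us1 ++ [u]) us2 v w ks)) ks = C0.
Proof.
  intros Hf Hn H0 i m Hz ks Hl HP.
  assert (Hi : i <> 0%nat) by (subst i; destruct us1; simpl; congruence).
  assert (H := mixY_vanish_pole us1 u us2 v w f n o Hf Hn Hz (incr i (- Z.of_nat (N u w)) ks)).
  cbv zeta in H. fold i in H. rewrite ev_OX_pow, incr_incr, Z.add_opp_diag_r, incr_0 in H.
  apply H; [now rewrite incr_length|]. now rewrite nth_incr_neq by lia.
Qed.

Lemma first_regular_nil : first_regular Y Wd N M [].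
Proof.
  intros u w f [|k ks] Hf Hl HP; simpl in Hl; [lia|].
  cbn [ev diff_op map]. rewrite ev_OX_pow. simpl in *.
  rewrite (fm_trunc _ _ _ _ _ HW f u w) by (assumption || lia). ring.
Qed.

(** Starts from the full iterate, where z_0 - z_m is y_0 and regularity in V applies, and then takes
    the vectors out of the inner product from left to right. *)
Lemma first_regular_snoc (us : list V) (v : V) :
  first_regular YV Vd M M us -> first_regular Y Wd N M (us ++ [v]).
Proof.
  intros HVr u w f ks0 Hf Hlen0 HP0.
  set (m := S (length us)).
  set (o1 := OMul (diff_op 0 1 (map (M u) us)) (opow (OSub (OX 0) (OX m)) (M u v))).
  set (o2 := OMul (opow (OX 0) (N u w)) o1).
  set (n := length ks0).
  assert (Hn : (m < n)%nat) by (unfold n, m; rewrite length_app in Hlen0; simpl in Hlen0; lia).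
  assert (Hstart : forall ks, length ks = n -> (0 <= nth 0 ks 0)%Z ->
    ev (osub (iter_from 0 m) o1) (fun ks => f (mixY [] (u :: us) v w ks)) ks = C0).
  (* With the index of z_m frozen at b, the pairing becomes a functional of the inner product that
     lies in [Vd] by [fm_eval]. *)
  { intros ks Hl HP. set (b := nth m ks 0%Z).
    assert (HI := HVr u v (fun v => f (Y v w b)) ks (fm_eval _ _ _ _ _ HW _ _ _ Hf) ltac:(unfold m in *; lia) HP).
    rewrite <- HI.
    replace (ev (osub (iter_from 0 m) o1) (fun ks => f (mixY [] (u :: us) v w ks)))
      with (ev (OMul (opow (OX 0) (M u v)) (diff_op 0 1 (map (M u) us))) (fun ks => f (mixY [] (u :: us) v w ks))).
    - apply (ev_ext_on (fun i => (i < m)%nat) (fun l => nth m l 0%Z = b)); auto.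
      + intros i l Hi Hb. now rewrite nth_incr_neq by lia.
      + split; [apply ovars_opow; simpl; unfold m; lia|].
        apply ovars_diff_op; [|rewrite length_map]; unfold m; lia.
      + intros l Hb. simpl mixY. simpl length. fold m. now rewrite Hb.
    - unfold o1. cbn [osub ev].
      rewrite ev_iter_from_diff_op by (rewrite ?length_map; unfold m; lia).
      rewrite ev_comm. f_equal. rewrite osub_opow. apply ev_opow_congr. intros F. extensionality l.
      cbn [osub]. unfold iter_from. rewrite Nat.ltb_irrefl, Bool.andb_false_r. simpl. ring. }
  (* Appending at the end of [us1] follows the order of extraction: the first vector pays
     z_0^N(u,w), the later ones nothing. *)
  assert (Hchain : forall us1 us2, u :: us = us1 ++ us2 -> us1 <> [] ->
    forall ks, length ks = n -> (0 <= nth 0 ks 0)%Z ->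
    ev (osub (iter_from (length us1) m) o2) (fun ks => f (mixY us1 us2 v w ks)) ks = C0).
  { intros us1. induction us1 as [|u' us1 IH] using rev_ind; intros us2 Eus Hne; [congruence|].
    assert (Em : m = (length us1 + S (length us2))%nat).
    { apply (f_equal (@length V)) in Eus. rewrite !length_app in Eus. simpl in Eus. unfold m. lia. }
    rewrite <- app_assoc in Eus. simpl in Eus.
    rewrite length_app. change (length [u']) with 1%nat. rewrite Nat.add_1_r.
    destruct us1 as [|u1 us1'].
    - simpl in Eus. injection Eus as <- <-. intros ks Hl HP. simpl length. simpl app.
      assert (H := mixY_vanish_pole [] u us v w f n (osub (iter_from 1 m) o1) Hf).
      simpl length in H. simpl Nat.add in H. fold m in H.
      unfold o2. cbn [osub ev]. rewrite osub_opow. apply H; auto.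
      intros ks' Hl' HP'. rewrite iter_from_step by (unfold m; lia). now apply Hstart.
    - apply (mixY_vanish (u1 :: us1') u' us2 v w f n); auto; try lia; [discriminate|].
      rewrite <- Em, iter_from_step by lia. apply IH; [assumption|discriminate]. }
  specialize (Hchain (u :: us) [] (eq_sym (app_nil_r _)) ltac:(discriminate) ks0 eq_refl HP0).
  simpl length in Hchain. fold m in Hchain. rewrite iter_from_end in Hchain.
  rewrite <- Hchain. unfold o2, o1.
  rewrite map_app. simpl map. cbn [ev]. rewrite ev_diff_op_app, length_map. simpl Nat.add. fold m.
  change (ev (OMul (opow (OX 0) (N u w)) (OMul (diff_op 0 1 (map (M u) us)) (opow (OSub (OX 0) (OX m)) (M u v)))) (fun ks => f (prodY Y (u :: us ++ [v]) ks w)) ks0 =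
    ev (OMul (opow (OX 0) (N u w)) (OMul (diff_op 0 1 (map (M u) us)) (opow (OSub (OX 0) (OX m)) (M u v)))) (fun ks => f (mixY (u :: us) [] v w ks)) ks0).
  apply (ev_ext_length n); [|reflexivity].
  intros l Hl. rewrite mixY_prodY by (simpl; unfold m in Hn; lia). reflexivity.
Qed.

End FormalModule.

(** For W = V and N = M the hypothesis and conclusion of [first_regular_snoc] have the same form, so
    it iterates; a general module needs only one step on top of this. *)
Lemma first_regular_algebra (V : VSpace) (YV : V -> V -> Z -> V) (Vd : (V -> C) -> Prop) (M : V -> V -> nat) :
  formal_module YV YV Vd Vd M -> forall us, first_regular YV Vd M M us.
Proof.
  intros HV us. induction us as [|v us IH] using rev_ind.
  - now apply first_regular_nil with YV Vd.
  - now apply first_regular_snoc with YV Vd.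
Qed.

Lemma first_regular_module (V W : VSpace) (YV : V -> V -> Z -> V) (Y : V -> W -> Z -> W)
    (Vd : (V -> C) -> Prop) (Wd : (W -> C) -> Prop) (N : V -> W -> nat) (M : V -> V -> nat) :
  formal_module YV YV Vd Vd M -> formal_module YV Y Vd Wd N ->
  forall us, first_regular Y Wd N M us.
Proof.
  intros HV HW us. destruct us as [|v us _] using rev_ind.
  - now apply first_regular_nil with YV Vd.
  - apply first_regular_snoc with YV Vd; [assumption|]. now apply first_regular_algebra.
Qed.

(** * Graded vector spaces *)

Section VSpaceFacts.
Context {X : VSpace}.
Implicit Types (x y : X).

Lemma vadd_0_r x : vadd x vzero = x.
Proof. rewrite vadd_comm. apply vadd_0. Qed.

Lemma vadd_cancel_idem x : vadd x x = x -> x = vzero.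
Proof.
  intros H. destruct (vadd_inv X x) as [y Hy].
  rewrite <- Hy. rewrite <- H at 2. rewrite <- vadd_assoc, Hy. now rewrite vadd_0_r.
Qed.

Lemma vscale_0 x : vscale C0 x = vzero.
Proof.
  apply vadd_cancel_idem. rewrite <- vscale_addC. f_equal. apply C_ext; simpl; ring.
Qed.

Lemma vscale_vzero (a : C) : vscale a (@vzero X) = vzero.
Proof. apply vadd_cancel_idem. now rewrite <- vscale_addv, vadd_0. Qed.

Lemma vscale_eq0 (a : C) x : a <> C0 -> vscale a x = vzero -> x = vzero.
Proof.
  intros Ha H. rewrite <- (vscale_1 X x).
  replace C1 with (Cinv a * a)%C by (field; assumption).
  rewrite <- vscale_assoc, H. apply vscale_vzero.
Qed.

Lemma eigenvalue_unique (a b : C) x : vscale a x = vscale b x -> x <> vzero -> a = b.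
Proof.
  intros H Hx. apply NNPP. intros Hab. apply Hx.
  apply (vscale_eq0 (a - b)%C).
  - intros E. apply Hab. replace a with ((a - b) + b)%C by ring. rewrite E. ring.
  - unfold Csub. rewrite vscale_addC, H, <- vscale_addC.
    replace (b + - b)%C with C0 by ring. apply vscale_0.
Qed.

End VSpaceFacts.

Section LinearMaps.
Context {X : VSpace}.

Lemma linear_map_0 {X' : VSpace} (f : X -> X') : linear_map f -> f vzero = vzero.
Proof.
  intros H. rewrite <- (vscale_0 (@vzero X)). rewrite (proj2 (H C0 vzero vzero)). apply vscale_0.
Qed.

Lemma linear_map_vsum {X' : VSpace} (f : X -> X') (l : list X) :
  linear_map f -> f (vsum l) = vsum (map f l).
Proof.
  intros H. induction l; simpl; [now apply linear_map_0|].
  rewrite (proj1 (H C0 _ _)). now f_equal.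
Qed.

Lemma linear_functional_0 (f : X -> C) : linear_functional f -> f vzero = C0.
Proof.
  intros H. rewrite <- (vscale_0 (@vzero X)). rewrite (proj2 (H C0 vzero vzero)). ring.
Qed.

Lemma linear_functional_vsum (f : X -> C) (l : list X) :
  linear_functional f -> f (vsum l) = Csum (map f l).
Proof.
  intros H. induction l; simpl; [now apply linear_functional_0|].
  rewrite (proj1 (H C0 _ _)). now f_equal.
Qed.

Lemma linear_functional_vsum_neq0 {A : Type} (f : X -> C) (g : A -> X) (l : list A) :
  linear_functional f -> f (vsum (map g l)) <> C0 -> exists a, In a l /\ f (g a) <> C0.
Proof.
  intros H Hn. apply NNPP. intros Hne. apply Hn.
  rewrite linear_functional_vsum, map_map by assumption. apply Csum_map_zero.
  intros a Ha. apply NNPP. intros E. apply Hne. now exists a.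
Qed.

Lemma vscale_vsum {A : Type} (a : C) (g : A -> X) (l : list A) :
  vscale a (vsum (map g l)) = vsum (map (fun i => vscale a (g i)) l).
Proof. induction l; simpl; [apply vscale_vzero|]. rewrite vscale_addv. now f_equal. Qed.

End LinearMaps.

Lemma CofZ_inj (m n : Z) : CofZ m = CofZ n -> m = n.
Proof. intros H. apply eq_IZR. exact (f_equal Re H). Qed.

Lemma list_upper_bound {A : Type} (g : A -> R) (l : list A) :
  exists B, 0 <= B /\ forall a, In a l -> Rabs (g a) <= B.
Proof.
  induction l as [|a l [B [HB IH]]].
  - exists 0. split; [lra|intros a []].
  - exists (B + Rabs (g a)). pose proof (Rabs_pos (g a)). split; [lra|].
    intros b [<-|Hb]; [lra|]. specialize (IH b Hb). lra.
Qed.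

Lemma list_preimage {I : Type} (wt : I -> C) (L : list C) :
  (forall i j, wt i = wt j -> i = j) -> exists S, forall i, In (wt i) L -> In i S.
Proof.
  intros Hinj. induction L as [|c L [S HS]].
  - exists []. intros i [].
  - destruct (classic (exists i, wt i = c)) as [[i Hi]|Hn].
    + exists (i :: S). intros j [E|Hj]; [left; apply Hinj; congruence|right; auto].
    + exists S. intros j [E|Hj]; [elim Hn; now exists j|auto].
Qed.

(** * Weights of modes: graded duals, truncation, degree bounds *)

(** The index type I and the injection [wt] treat the integer grading of V and the complex grading
    of W at once. *)
Record graded_map (V : VSpace) (projV : Z -> V -> V) (dV : V -> V)
    (W : VSpace) (I : Type) (wt : I -> C) (projW : I -> W -> W) (dW : W -> W)
    (Y : V -> W -> Z -> W) : Prop := {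
  gm_wt_inj : forall i j, wt i = wt j -> i = j;
  gm_gradV : is_grading projV;
  gm_dV_eigen : forall n v, dV (projV n v) = vscale (CofZ n) (projV n v);
  gm_gradW : is_grading projW;
  gm_lower : exists r : R, forall i w, Re (wt i) < r -> projW i w = vzero;
  gm_dW_lin : linear_map dW;
  gm_dW_eigen : forall i w, dW (projW i w) = vscale (wt i) (projW i w);
  gm_lin_l : forall w k, linear_map (fun u => Y u w k);
  gm_lin_r : forall u k, linear_map (fun w => Y u w k);
  gm_d_comm : forall u w k,
    dW (Y u w k) = vadd (Y u (dW w) k)
                        (vadd (vscale (CofZ (- k - 1)) (Y u w k)) (Y (dV u) w k))
}.

Section GradedMap.

Variables (V : VSpace) (projV : Z -> V -> V) (dV : V -> V).
Variables (W : VSpace) (I : Type) (wt : I -> C) (projW : I -> W -> W) (dW : W -> W).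
Variable (Y : V -> W -> Z -> W).
Hypothesis HY : graded_map V projV dV W I wt projW dW Y.

Let linr := gm_lin_r _ _ _ _ _ _ _ _ _ HY.
Let linl := gm_lin_l _ _ _ _ _ _ _ _ _ HY.
Let gradV := gm_gradV _ _ _ _ _ _ _ _ _ HY.
Let gradW := gm_gradW _ _ _ _ _ _ _ _ _ HY.

Lemma proj_d (j : I) (x : W) : projW j (dW x) = vscale (wt j) (projW j x).
Proof.
  destruct gradW as (Hlin & Horth & Hdec). destruct (Hdec x) as (S & _ & E).
  transitivity (projW j (dW (vsum (map (fun i => projW i x) S)))); [now rewrite <- E|].
  transitivity (vscale (wt j) (projW j (vsum (map (fun i => projW i x) S)))); [|now rewrite <- E].
  rewrite (linear_map_vsum dW) by apply HY.
  rewrite !(linear_map_vsum (projW j)) by auto.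
  rewrite !map_map, vscale_vsum. f_equal. apply map_ext. intros i.
  rewrite (gm_dW_eigen _ _ _ _ _ _ _ _ _ HY), (proj2 (Hlin j _ _ vzero)).
  destruct (Horth j i x) as [H1 H2]. destruct (classic (j = i)) as [<-|Hne]; [reflexivity|].
  now rewrite H2, !vscale_vzero.
Qed.

(** On the component j the operator [dW] has eigenvalue [wt j], and the commutator formula computes
    that eigenvalue a second time. *)
Lemma mode_weight (n : Z) (u : V) (i j : I) (w : W) (k : Z) :
  projW j (Y (projV n u) (projW i w) k) <> vzero ->
  wt j = (wt i + (CofZ (- k - 1) + CofZ n))%C.
Proof.
  apply eigenvalue_unique. rewrite <- proj_d.
  rewrite (gm_d_comm _ _ _ _ _ _ _ _ _ HY), (gm_dW_eigen _ _ _ _ _ _ _ _ _ HY), (gm_dV_eigen _ _ _ _ _ _ _ _ _ HY).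
  rewrite (proj2 (linr (projV n u) k (wt i) (projW i w) vzero)).
  rewrite (proj2 (linl (projW i w) k (CofZ n) (projV n u) vzero)).
  rewrite <- !vscale_addC. apply (proj1 gradW j _ _ vzero).
Qed.

Lemma linear_functional_mode (f : W -> C) (u : V) (k : Z) :
  linear_functional f -> linear_functional (fun w => f (Y u w k)).
Proof.
  intros Hf a x y. destruct (linr u k a x y) as [E1 E2]. rewrite E1, E2. apply Hf.
Qed.

Lemma linear_functional_eval (f : W -> C) (w : W) (k : Z) :
  linear_functional f -> linear_functional (fun u => f (Y u w k)).
Proof.
  intros Hf a x y. destruct (linl w k a x y) as [E1 E2]. rewrite E1, E2. apply Hf.
Qed.

Lemma pairing_weight (f : W -> C) (n : Z) (u : V) (i : I) (w : W) (k : Z) :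
  linear_functional f -> f (Y (projV n u) (projW i w) k) <> C0 ->
  exists j, f (projW j (Y (projV n u) (projW i w) k)) <> C0 /\
    wt j = (wt i + (CofZ (- k - 1) + CofZ n))%C /\
    projW j (Y (projV n u) (projW i w) k) <> vzero.
Proof.
  intros Hf Hn. destruct gradW as (_ & _ & Hdec).
  destruct (Hdec (Y (projV n u) (projW i w) k)) as (S & _ & E). rewrite E in Hn.
  apply (linear_functional_vsum_neq0 f (fun i0 => projW i0 (Y (projV n u) (projW i w) k))) in Hn; auto.
  destruct Hn as (j & _ & Hj). exists j.
  assert (Hz : projW j (Y (projV n u) (projW i w) k) <> vzero).
  { intros Ez. apply Hj. rewrite Ez. now apply linear_functional_0. }
  repeat split; auto. now apply mode_weight with u w.
Qed.

Lemma pairing_component (f : W -> C) (u : V) (S : list Z) (w : W) (k : Z) :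
  linear_functional f -> u = vsum (map (fun n => projV n u) S) -> f (Y u w k) <> C0 ->
  exists n, In n S /\ f (Y (projV n u) w k) <> C0.
Proof.
  intros Hf E Hn. rewrite E in Hn.
  now apply (linear_functional_vsum_neq0 (fun u => f (Y u w k)) (fun n => projV n u)) in Hn;
    [|apply linear_functional_eval].
Qed.

Lemma functional_component (f : W -> C) (S : list I) (w : W) :
  linear_functional f -> w = vsum (map (fun i => projW i w) S) -> f w <> C0 ->
  exists i, In i S /\ f (projW i w) <> C0.
Proof.
  intros Hf E Hn. rewrite E in Hn.
  now apply (linear_functional_vsum_neq0 f (fun i => projW i w)) in Hn.
Qed.

(** The finitely many components of u shift weights by finitely many amounts. [list_preimage] turns
    the admissible weights into indices, as not every complex number need be a weight. *)
Lemma graded_dual_comp (f : W -> C) (u : V) (k : Z) :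
  in_graded_dual projW f -> in_graded_dual projW (fun w => f (Y u w k)).
Proof.
  intros [Hf [Sf HSf]]. split; [now apply linear_functional_mode|].
  destruct (proj2 (proj2 gradV) u) as (T & _ & ET).
  destruct (list_preimage wt (map (fun p => (wt (fst p) - (CofZ (- k - 1) + CofZ (snd p)))%C) (list_prod Sf T)))
    as [S HS]; [apply HY|].
  exists S. intros i x Hi. apply NNPP. intros Hn.
  destruct (pairing_component f u T (projW i x) k Hf ET Hn) as (n & Hn1 & Hn2).
  destruct (pairing_weight f n u i x k Hf Hn2) as (j & Hj1 & Hj2 & _).
  apply Hi, HS. apply in_map_iff. exists (j, n). simpl. rewrite Hj2. split; [ring|].
  apply in_prod; [|assumption]. apply NNPP. intros Hj. apply Hj1. auto.
Qed.

Lemma graded_dual_eval (f : W -> C) (w : W) (k : Z) :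
  in_graded_dual projW f -> in_graded_dual projV (fun v => f (Y v w k)).
Proof.
  intros [Hf [Sf HSf]]. split; [now apply linear_functional_eval|].
  destruct (proj2 (proj2 gradW) w) as (T & _ & ET).
  destruct (list_preimage CofZ (map (fun p => (wt (fst p) - wt (snd p) - CofZ (- k - 1))%C) (list_prod Sf T)))
    as [S HS]; [apply CofZ_inj|].
  exists S. intros n v Hi. apply NNPP. intros Hn.
  destruct (functional_component (fun w => f (Y (projV n v) w k)) T w (linear_functional_mode _ _ _ Hf) ET Hn) as (i & Hi1 & Hi2).
  destruct (pairing_weight f n v i w k Hf Hi2) as (j & Hj1 & Hj2 & _).
  apply Hi, HS. apply in_map_iff. exists (j, i). simpl. rewrite Hj2. split; [ring|].
  apply in_prod; [|assumption]. apply NNPP. intros Hj. apply Hj1. auto.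
Qed.

Lemma mode_truncation (u : V) (w : W) :
  exists K : nat, forall f k, linear_functional f -> (Z.of_nat K <= k)%Z -> f (Y u w k) = C0.
Proof.
  destruct (gm_lower _ _ _ _ _ _ _ _ _ HY) as [r Hr].
  destruct (proj2 (proj2 gradV) u) as (T & _ & ET).
  destruct (proj2 (proj2 gradW) w) as (S & _ & ES).
  destruct (list_upper_bound IZR T) as (B1 & _ & HB1).
  destruct (list_upper_bound (fun i => Re (wt i)) S) as (B2 & _ & HB2).
  destruct (archimed (B1 + B2 + Rabs r)) as [HK _].
  (* Beyond this k the weight n + wt i - k - 1 has real part below r, for every component of u and
     w. *)
  exists (Z.to_nat (up (B1 + B2 + Rabs r))). intros f k Hf Hk.
  apply NNPP. intros Hn.
  destruct (pairing_component f u T w k Hf ET Hn) as (n & Hn1 & Hn2).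
  destruct (functional_component (fun w => f (Y (projV n u) w k)) S w (linear_functional_mode _ _ _ Hf) ES Hn2) as (i & Hi1 & Hi2).
  destruct (pairing_weight f n u i w k Hf Hi2) as (j & _ & Hj & Hne).
  assert (Hj' : ~ Re (wt j) < r) by (intros Hlt; apply Hne; auto).
  apply (f_equal Re) in Hj. simpl in Hj. rewrite minus_IZR, opp_IZR in Hj.
  specialize (HB1 n Hn1). specialize (HB2 i Hi1). simpl in HB2.
  pose proof (Rle_abs (IZR n)). pose proof (Rle_abs (Re (wt i))).
  pose proof (Rle_abs (- r)) as Hr'. rewrite Rabs_Ropp in Hr'.
  assert (IZR (up (B1 + B2 + Rabs r)) <= IZR k) by (apply IZR_le; lia). lra.
Qed.

Definition weight_window (f : W -> C) (lo hi : R) : Prop :=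
  forall i x, f (projW i x) <> C0 -> lo <= Re (wt i) <= hi.

Lemma graded_dual_window (f : W -> C) : in_graded_dual projW f -> exists lo hi, weight_window f lo hi.
Proof.
  intros [_ [S HS]]. destruct (list_upper_bound (fun i => Re (wt i)) S) as (B & _ & HB).
  exists (- B), B. intros i x Hn. assert (Hi : In i S) by (apply NNPP; intros Hi; apply Hn; auto).
  specialize (HB i Hi). simpl in HB.
  pose proof (Rle_abs (Re (wt i))). pose proof (Rle_abs (- Re (wt i))) as H'. rewrite Rabs_Ropp in H'. lra.
Qed.

(** D is uniform in the functional: the induction passes to the composite of f with the mode k,
    whose window moves with k. *)
Lemma prodY_weight (us : list V) (w : W) :
  exists D, forall f lo hi ks, linear_functional f -> weight_window f lo hi ->
    length ks = length us -> f (prodY Y us ks w) <> C0 ->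
    - D - hi <= IZR (zsum ks) <= D - lo.
Proof.
  induction us as [|u us [D IH]].
  - destruct (proj2 (proj2 gradW) w) as (S & _ & ES).
    destruct (list_upper_bound (fun i => Re (wt i)) S) as (B & HB0 & HB).
    exists B. intros f lo hi [|k ks] Hf Hwin Hlen Hn; [|discriminate]. simpl in *.
    destruct (functional_component f S w Hf ES Hn) as (i & Hi1 & Hi2).
    specialize (HB i Hi1). simpl in HB. specialize (Hwin i w Hi2).
    pose proof (Rle_abs (Re (wt i))). pose proof (Rle_abs (- Re (wt i))) as H'. rewrite Rabs_Ropp in H'. lra.
  - destruct (proj2 (proj2 gradV) u) as (T & _ & ET).
    destruct (list_upper_bound IZR T) as (h & _ & Hh).
    exists (D + h + 1). intros f lo hi [|k ks] Hf Hwin Hlen Hn; [discriminate|]. simpl in *.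
    (* The mode k moves the window by k + 1, and the weights of the components of u widen it by
       h. *)
    specialize (IH (fun w => f (Y u w k)) (lo + IZR k + 1 - h) (hi + IZR k + 1 + h) ks).
    rewrite plus_IZR. cut (- D - (hi + IZR k + 1 + h) <= IZR (zsum ks) <= D - (lo + IZR k + 1 - h)); [lra|].
    apply IH; auto.
    + now apply linear_functional_mode.
    + intros i x Hx. destruct (pairing_component f u T (projW i x) k Hf ET Hx) as (n & Hn1 & Hn2).
      destruct (pairing_weight f n u i x k Hf Hn2) as (j & Hj1 & Hj2 & _).
      apply Hwin in Hj1. apply (f_equal Re) in Hj2. simpl in Hj2. rewrite minus_IZR, opp_IZR in Hj2.
      specialize (Hh n Hn1). simpl in Hh.
      pose proof (Rle_abs (IZR n)). pose proof (Rle_abs (- IZR n)) as H'. rewrite Rabs_Ropp in H'. lra.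
Qed.

Lemma eval_window (f : W -> C) (w : W) (k : Z) (lo hi : R) :
  linear_functional f -> weight_window f lo hi ->
  exists h, forall k n v, f (Y (projV n v) w k) <> C0 ->
    lo - h + IZR k + 1 <= IZR n <= hi + h + IZR k + 1.
Proof.
  intros Hf Hwin. destruct (proj2 (proj2 gradW) w) as (S & _ & ES).
  destruct (list_upper_bound (fun i => Re (wt i)) S) as (B & HB0 & HB).
  exists B. intros k' n v Hn.
  destruct (functional_component (fun w => f (Y (projV n v) w k')) S w (linear_functional_mode _ _ _ Hf) ES Hn) as (i & Hi1 & Hi2).
  destruct (pairing_weight f n v i w k' Hf Hi2) as (j & Hj1 & Hj2 & _).
  apply Hwin in Hj1. apply (f_equal Re) in Hj2. simpl in Hj2. rewrite minus_IZR, opp_IZR in Hj2.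
  specialize (HB i Hi1). simpl in HB.
  pose proof (Rle_abs (Re (wt i))). pose proof (Rle_abs (- Re (wt i))) as H'. rewrite Rabs_Ropp in H'. lra.
Qed.

Lemma prodY_sum_bounded (f : W -> C) (us : list V) (w : W) :
  in_graded_dual projW f -> sum_bounded (length us) (fun ks => f (prodY Y us ks w)).
Proof.
  intros Hf. destruct (graded_dual_window f Hf) as (lo & hi & Hwin).
  destruct (prodY_weight us w) as [D HD]. destruct Hf as [Hf _].
  exists (up (Rabs (- D - hi) + Rabs (D - lo))). intros l Hl Hn.
  specialize (HD f lo hi l Hf Hwin Hl Hn).
  destruct (archimed (Rabs (- D - hi) + Rabs (D - lo))) as [HK _].
  apply le_IZR. rewrite abs_IZR.
  pose proof (Rle_abs (D - lo)). pose proof (Rle_abs (- (- D - hi))) as H'. rewrite Rabs_Ropp in H'.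
  pose proof (Rabs_pos (- D - hi)). pose proof (Rabs_pos (D - lo)).
  apply Rabs_le. lra.
Qed.

End GradedMap.

(** The window of v -> f(Y_j(v)w) moves by exactly j, which cancels against the second index in the
    total degree. *)
Lemma iterate_sum_bounded (V : VSpace) (projV : Z -> V -> V) (dV : V -> V)
    (YV : V -> V -> Z -> V) (W : VSpace) (I : Type) (wt : I -> C) (projW : I -> W -> W) (dW : W -> W)
    (Y : V -> W -> Z -> W) (f : W -> C) (u v : V) (w : W) :
  graded_map V projV dV V Z CofZ projV dV YV -> graded_map V projV dV W I wt projW dW Y ->
  in_graded_dual projW f ->
  sum_bounded 2 (fun ks => f (Y (YV u v (nth 0 ks 0%Z)) w (nth 1 ks 0%Z))).
Proof.
  intros HV HY Hf. destruct (graded_dual_window _ _ wt projW f Hf) as (lo & hi & Hwin).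
  destruct Hf as [Hf _].
  destruct (eval_window _ _ _ _ _ _ _ _ _ HY f w 0%Z lo hi Hf Hwin) as [h Hh].
  destruct (prodY_weight _ _ _ _ _ _ _ _ _ HV [u] v) as [D HD].
  set (b1 := - D - (hi + h + 1)). set (b2 := D - (lo - h + 1)).
  exists (up (Rabs b1 + Rabs b2)). intros l Hl Hn.
  destruct (length2 l Hl) as (k & j & ->). simpl in *.
  specialize (HD (fun v => f (Y v w j)) (lo - h + IZR j + 1) (hi + h + IZR j + 1) [k]
    (linear_functional_eval _ _ _ _ _ _ _ _ _ HY f w j Hf) (fun n x => Hh j n x) eq_refl Hn).
  simpl in HD. rewrite Z.add_0_r in *.
  destruct (archimed (Rabs b1 + Rabs b2)) as [HK _].
  apply le_IZR. rewrite abs_IZR, plus_IZR.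
  pose proof (Rle_abs b2). pose proof (Rle_abs (- b1)) as H'. rewrite Rabs_Ropp in H'.
  pose proof (Rabs_pos b1). pose proof (Rabs_pos b2). unfold b1, b2 in *.
  apply Rabs_le. lra.
Qed.

Lemma formal_module_of_graded (V : VSpace) (projV : Z -> V -> V) (dV : V -> V)
    (YV : V -> V -> Z -> V) (W : VSpace) (I : Type) (wt : I -> C) (projW : I -> W -> W) (dW : W -> W)
    (Y : V -> W -> Z -> W) :
  graded_map V projV dV V Z CofZ projV dV YV -> graded_map V projV dV W I wt projW dW Y ->
  rational_iterates projW YV Y -> associativity projW YV Y -> pole_order_condition projW Y ->
  exists N, formal_module YV Y (in_graded_dual projV) (in_graded_dual projW) N.
Proof.
  intros HV HY Hiter Hassoc [N0 Hpole].
  (* Choice turns the truncation order, uniform in the functional, into a function of u and w. *)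
  pose (K := fun u w => proj1_sig (constructive_indefinite_description _ (mode_truncation _ _ _ _ _ _ _ _ _ HY u w))).
  assert (HK : forall u w f k, linear_functional f -> (Z.of_nat (K u w) <= k)%Z -> f (Y u w k) = C0).
  { intros u w. exact (proj2_sig (constructive_indefinite_description _ (mode_truncation _ _ _ _ _ _ _ _ _ HY u w))). }
  exists (fun u w => Nat.max (N0 u w) (K u w)). split.
  - intros f u k. apply (graded_dual_comp _ _ _ _ _ _ _ _ _ HY).
  - intros f w k. apply (graded_dual_eval _ _ _ _ _ _ _ _ _ HY).
  - intros f u w k [Hf _] Hk. apply HK; [assumption|lia].
  - intros f us w. apply (prodY_sum_bounded _ _ _ _ _ _ _ _ _ HY).
  - intros f u v w Hf.
    destruct (Hpole u v w f Hf) as (p1 & a1 & b1 & Ha1 & Hp1).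
    destruct (Hiter u v w f Hf) as (p2 & a2 & b2 & Hp2).
    apply (weak_associativity _ _ _ p1 p2 a1 a2 b1 b2).
    + lia.
    + exact Hp1.
    + intros z Hz. apply (abs_conv_ext 2 (iter_term YV Y f u v w z)); [|now apply Hp2].
      intros k Hk. destruct (length2 k Hk) as (x & y & ->). unfold tm. simpl. ring.
    + intros z Hz. apply (Hassoc u v w f z); auto; [apply Hp1|apply Hp2; apply Hz].
      destruct Hz as (H1 & H2 & H3). split; intros i Hi.
      * destruct i as [|[|i]]; [| |lia]; lra.
      * destruct i; [assumption|lia].
    + apply (prodY_sum_bounded _ _ _ _ _ _ _ _ _ HY f [u; v] w Hf).
    + now apply (iterate_sum_bounded V projV dV YV W I wt projW dW).
    (* The product is truncated by its innermost operator; the outer mode goes into the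
       functional. *)
    + exists (Z.of_nat (K v w)). intros l Hl Hn. destruct (length2 l Hl) as (x & y & ->). simpl in *.
      apply Z.nle_gt. intros Hle. apply Hn.
      apply (HK v w (fun w => f (Y u w x))); [|assumption].
      apply (linear_functional_mode _ _ _ _ _ _ _ _ _ HY), Hf.
    + destruct (mode_truncation _ _ _ _ _ _ _ _ _ HV u v) as [K' HK'].
      exists (Z.of_nat K'). intros l Hl Hn. destruct (length2 l Hl) as (x & y & ->). simpl in *.
      apply Z.nle_gt. intros Hle. apply Hn.
      apply (HK' (fun v => f (Y v w y))); [|assumption].
      apply (linear_functional_eval _ _ _ _ _ _ _ _ _ HY), Hf.
Qed.

(** * From formal regularity to convergence *)

Lemma diff_op_lift (i j : nat) (Ms : list nat) : diff_op (S i) (S j) Ms = olift (diff_op i j Ms).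
Proof.
  revert j. induction Ms as [|M Ms IH]; intros j; [reflexivity|].
  simpl. rewrite IH. unfold olift. simpl. now rewrite osub_opow.
Qed.

Lemma prod_upto_S_first (n : nat) (f : nat -> C) :
  prod_upto (S n) f = (f 0%nat * prod_upto n (fun i => f (S i)))%C.
Proof.
  induction n as [|n IH]; [simpl; ring|].
  change (prod_upto (S (S n)) f) with (prod_upto (S n) f * f (S n))%C.
  rewrite IH. simpl. ring.
Qed.

Lemma prod_upto_ext (n : nat) (f g : nat -> C) :
  (forall i, (i < n)%nat -> f i = g i) -> prod_upto n f = prod_upto n g.
Proof. intros H. induction n; simpl; [reflexivity|]. rewrite IHn, H by auto. reflexivity. Qed.

Lemma prod_upto_mul (n : nat) (f g : nat -> C) :
  prod_upto n (fun i => f i * g i)%C = (prod_upto n f * prod_upto n g)%C.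
Proof. induction n; simpl; [ring|]. rewrite IHn. ring. Qed.

Lemma denom_S (n : nat) (a : nat -> nat) (b : nat -> nat -> nat) (z : nat -> C) :
  denom (S n) a b z =
  (Cpow (z 0%nat) (a 0%nat) * prod_upto n (fun j => Cpow (z 0%nat - z (S j)) (b 0%nat (S j)))
   * denom n (fun i => a (S i)) (fun i j => b (S i) (S j)) (fun i => z (S i)))%C.
Proof.
  unfold denom. rewrite !prod_upto_S_first. simpl (prod_upto 0 _).
  rewrite (prod_upto_ext n (fun i => prod_upto (S i) (fun i0 => Cpow (z i0 - z (S i)) (b i0 (S i))))
    (fun j => Cpow (z 0%nat - z (S j)) (b 0%nat (S j)) *
       prod_upto j (fun i => Cpow (z (S i) - z (S j)) (b (S i) (S j))))%C).
  - rewrite prod_upto_mul. ring.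
  - intros i _. apply prod_upto_S_first.
Qed.

Lemma val_diff_op (z : nat -> C) (i j : nat) (Ms : list nat) :
  val z (diff_op i j Ms) = prod_upto (length Ms) (fun k => Cpow (z i - z (j + k)%nat) (nth k Ms 0%nat)).
Proof.
  revert j. induction Ms as [|M Ms IH]; intros j; [reflexivity|].
  cbn [diff_op val length]. rewrite prod_upto_S_first, IH, val_opow, Nat.add_0_r. simpl. f_equal.
  apply prod_upto_ext. intros k _. now rewrite Nat.add_succ_r.
Qed.

Lemma zmono_prod_upto (z : nat -> C) (o : nat) (ks : list Z) :
  Forall (fun k => k < 0)%Z ks ->
  zmono z o ks = prod_upto (length ks) (fun i => Cpow (z (o + i)%nat) (Z.to_nat (- nth i ks 0 - 1)%Z)).
Proof.
  revert o. induction ks as [|k ks IH]; intros o H; [reflexivity|].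
  inversion H; subst. cbn [zmono length]. rewrite prod_upto_S_first, IH, Nat.add_0_r by assumption.
  simpl nth. rewrite <- Czpow_nat, Z2Nat.id by lia. f_equal.
  apply prod_upto_ext. intros i _. now rewrite Nat.add_succ_r.
Qed.

Fixpoint negative_box (n D : nat) : list (list Z) :=
  match n with
  | O => [[]]
  | S n' => flat_map (fun d => map (cons (- Z.of_nat (S d))%Z) (negative_box n' D)) (seq 0 D)
  end.

Lemma negative_box_spec (n D : nat) (ks : list Z) :
  In ks (negative_box n D) <-> length ks = n /\ Forall (fun k => - Z.of_nat D <= k < 0)%Z ks.
Proof.
  revert ks. induction n as [|n IH]; intros ks; simpl.
  - split.
    + intros [<-|[]]. split; [reflexivity|constructor].
    + intros [H _]. left. now destruct ks.
  - rewrite in_flat_map. split.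
    + intros (d & Hd & Hk). apply in_seq in Hd. apply in_map_iff in Hk.
      destruct Hk as (l & <- & Hl). apply IH in Hl. destruct Hl as [Hl HF].
      split; [simpl; congruence|]. constructor; [lia|assumption].
    + intros [Hl HF]. destruct ks as [|k ks]; [discriminate|]. inversion HF; subst.
      exists (Z.to_nat (- k - 1)). split; [apply in_seq; lia|].
      apply in_map_iff. exists ks. split; [f_equal; lia|]. apply IH. split; [simpl in Hl; congruence|assumption].
Qed.

Lemma zsum_negative (ks : list Z) : Forall (fun k => k < 0)%Z ks -> (zsum ks <= 0)%Z.
Proof. induction 1; simpl; lia. Qed.

Lemma negative_zsum_bound (D : Z) (ks : list Z) :
  Forall (fun k => k < 0)%Z ks -> (- D <= zsum ks)%Z -> Forall (fun k => - D <= k < 0)%Z ks.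
Proof.
  induction 1; simpl; intros Hs; constructor.
  - apply zsum_negative in H0. lia.
  - apply IHForall. lia.
Qed.

Lemma nth_negative (ks : list Z) :
  (forall j, (j < length ks)%nat -> (nth j ks 0 < 0)%Z) -> Forall (fun k => k < 0)%Z ks.
Proof.
  intros H. apply Forall_forall. intros k Hk. apply (In_nth _ _ 0%Z) in Hk.
  destruct Hk as (j & Hj & <-). auto.
Qed.

(** Negative indices whose sum is bounded below are finite in number, so H is the coefficient family
    of a polynomial that does not depend on z. *)
Lemma regular_abs_conv_poly (n : nat) (H : list Z -> C) :
  sum_bounded n H ->
  (forall ks j, length ks = n -> (j < n)%nat -> (0 <= nth j ks 0)%Z -> H ks = C0) ->
  exists p : poly, forall z, abs_conv_to n (tm z H) (peval n p z).
Proof.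
  intros [D HD] Hreg.
  set (L0 := nodup (list_eq_dec Z.eq_dec) (negative_box n (Z.to_nat D))).
  assert (HL0 : forall k, In k L0 <-> length k = n /\ Forall (fun k => - Z.of_nat (Z.to_nat D) <= k < 0)%Z k).
  { intros k. unfold L0. rewrite nodup_In. apply negative_box_spec. }
  exists (map (fun ks => (H ks, fun i => Z.to_nat (- nth i ks 0 - 1)%Z)) L0).
  intros z. unfold peval. rewrite map_map. simpl.
  replace (Csum _) with (Csum (map (tm z H) L0)).
  - apply abs_conv_finite.
    + split; [apply NoDup_nodup|]. apply Forall_forall. intros k Hk. now apply HL0.
    + intros k Hk Hn. unfold tm. replace (H k) with C0; [ring|]. symmetry.
      apply NNPP. intros Hne. apply Hn, HL0. split; [assumption|].
      specialize (HD k Hk Hne). apply negative_zsum_bound; [|lia].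
      apply nth_negative. intros j Hj. apply Z.nle_gt. intros Hle. apply Hne.
      apply Hreg with j; auto. lia.
  - f_equal. apply map_ext_in. intros k Hk. apply HL0 in Hk. destruct Hk as [Hk HF].
    unfold tm. rewrite zmono_prod_upto, Hk; [reflexivity|].
    eapply Forall_impl; [|exact HF]. simpl. lia.
Qed.

(** * Products of n operators: common denominator and convergence *)

Section Rationality.

Variables (V W : VSpace) (YV : V -> V -> Z -> V) (Y : V -> W -> Z -> W).
Variables (Vd : (V -> C) -> Prop) (Wd : (W -> C) -> Prop).
Variables (N : V -> W -> nat) (M : V -> V -> nat).
Hypothesis HV : formal_module YV YV Vd Vd M.
Hypothesis HW : formal_module YV Y Vd Wd N.

Fixpoint pole_op (i : nat) (us : list V) (w : W) : op :=
  match us with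
  | [] => OC C1
  | u :: us' => OMul (OMul (opow (OX i) (N u w)) (diff_op i (S i) (map (M u) us'))) (pole_op (S i) us' w)
  end.

Lemma pole_op_lift (i : nat) (us : list V) (w : W) : pole_op (S i) us w = olift (pole_op i us w).
Proof.
  revert i. induction us as [|u us IH]; intros i; [reflexivity|].
  simpl. rewrite IH, diff_op_lift. unfold olift. simpl. now rewrite osub_opow.
Qed.

(** For j = 0 this is first regularity; for j > 0 the first index is frozen and its mode absorbed
    into the functional. The remaining factors only raise indices, so they preserve vanishing on k_j
    >= 0. *)
Lemma prodY_regular (us : list V) (w : W) (f : W -> C) (ks : list Z) (j : nat) :
  Wd f -> length ks = length us -> (j < length us)%nat -> (0 <= nth j ks 0)%Z ->
  ev (pole_op 0 us w) (fun ks => f (prodY Y us ks w)) ks = C0.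
Proof.
  revert f ks j. induction us as [|u us IH]; intros f ks j Hf Hl Hj HP; [simpl in Hj; lia|].
  assert (Hup : forall i l, length l = S (length us) /\ (0 <= nth j l 0)%Z ->
    length (incr i 1 l) = S (length us) /\ (0 <= nth j (incr i 1 l) 0)%Z).
  { intros i l [H1 H2]. rewrite incr_length. split; [assumption|].
    destruct (Nat.eq_dec j i) as [<-|]; [simpl in Hj; rewrite nth_incr by lia; lia|now rewrite nth_incr_neq]. }
  cbn [pole_op].
  set (A := OMul (opow (OX 0) (N u w)) (diff_op 0 1 (map (M u) us))).
  change (ev A (ev (pole_op 1 us w) (fun ks => f (prodY Y (u :: us) ks w))) ks = C0).
  destruct j as [|j].
  - rewrite ev_comm. apply (ev_vanish _ _ _ Hup); [|now split].
    intros l [H1 H2]. apply (first_regular_module V W YV Y Vd Wd N M HV HW us); auto. lia.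
  - apply (ev_vanish _ _ _ Hup); [|now split].
    intros [|k l] [H1 H2]; [discriminate|]. rewrite pole_op_lift.
    assert (E := f_equal (fun g => g l) (ev_olift (pole_op 0 us w) (fun ks => f (prodY Y (u :: us) ks w)) k)).
    cbv beta in E. rewrite E.
    apply (IH (fun w => f (Y u w k)) l j); [apply (fm_comp _ _ _ _ _ HW), Hf| | |exact H2]; simpl in *; lia.
Qed.

(** The indices to the right of j determine the vector on which the j-th operator acts, so they
    alone fix its truncation order. *)
Lemma prodY_trunc (us : list V) (w : W) (j : nat) (ks : list Z) :
  (j < length us)%nat -> exists J0, forall f ks', Wd f -> length ks' = length us ->
    skipn (S j) ks' = skipn (S j) ks -> (J0 <= nth j ks' 0)%Z -> f (prodY Y us ks' w) = C0.
Proof.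
  revert j ks. induction us as [|u us IH]; intros [|j] ks Hj; simpl in Hj; try lia.
  - exists (Z.of_nat (N u (prodY Y us (skipn 1 ks) w))). intros f [|k' ks'] Hf Hl Hs Hk; [discriminate|].
    simpl in *. rewrite Hs. now apply (fm_trunc _ _ _ _ _ HW).
  - destruct (IH j (skipn 1 ks)) as [J0 H0]; [lia|].
    exists J0. intros f [|k' ks'] Hf Hl Hs Hk; [discriminate|]. simpl.
    apply (H0 (fun w => f (Y u w k'))); [apply (fm_comp _ _ _ _ _ HW), Hf| | |exact Hk].
    + simpl in Hl. lia.
    + rewrite skipn_skipn. simpl in *. rewrite Nat.add_1_r. exact Hs.
Qed.

Lemma skipn_incr (i m : nat) (x : Z) (ks : list Z) : (i < m)%nat -> skipn m (incr i x ks) = skipn m ks.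
Proof.
  revert i m. induction ks as [|k ks IH]; intros [|i] [|m] H; simpl; auto; try lia. apply IH. lia.
Qed.

(** Along this diagonal everything to the right of j stays fixed while k_j grows. *)
Lemma prodY_diag_trunc (us : list V) (w : W) (f : W -> C) (i j : nat) :
  Wd f -> (i < j)%nat -> (j < length us)%nat ->
  diag_trunc (length us) i j (fun ks => f (prodY Y us ks w)).
Proof.
  intros Hf Hij Hj l Hl. destruct (prodY_trunc us w j l Hj) as [J0 H0].
  exists (Z.to_nat (Z.abs J0 + Z.abs (nth j l 0%Z))). intros t Ht. apply H0; auto.
  - now rewrite !incr_length.
  - now rewrite !skipn_incr by lia.
  - rewrite nth_incr_neq, nth_incr by lia. lia.
Qed.

Lemma pole_factor_diff_op (n i j : nat) (Ms : list nat) :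
  (i < j)%nat -> (j + length Ms <= n)%nat -> pole_factor n (diff_op i j Ms).
Proof.
  revert j. induction Ms; simpl; intros j Hij Hn; [constructor|].
  apply pf_mul; [apply pole_factor_opow; constructor; lia|apply IHMs; lia].
Qed.

Lemma pole_factor_pole_op (n i : nat) (us : list V) (w : W) :
  (i + length us <= n)%nat -> pole_factor n (pole_op i us w).
Proof.
  revert i. induction us as [|u us IH]; simpl; intros i Hn; [constructor|].
  repeat apply pf_mul.
  - apply pole_factor_opow. constructor. lia.
  - apply pole_factor_diff_op; rewrite ?length_map; lia.
  - apply IH. lia.
Qed.

Lemma val_pole_op (z : nat -> C) (o : nat) (us : list V) (w : W) :
  val z (pole_op o us w) =
  denom (length us) (fun i => N (nth i us vzero) w)
    (fun i j => M (nth i us vzero) (nth j us vzero)) (fun i => z (o + i)%nat).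
Proof.
  revert o. induction us as [|u us IH]; intros o.
  - unfold denom. simpl. ring.
  - cbn [pole_op val length]. rewrite denom_S, IH, val_opow, val_diff_op, length_map. simpl.
    rewrite Nat.add_0_r. f_equal; [f_equal|].
    + apply prod_upto_ext. intros i Hi. rewrite Nat.add_succ_r. f_equal.
      (* [map_nth] requires the default to be the image of the default [vzero]. *)
      rewrite (nth_indep _ 0%nat (M u vzero)) by (now rewrite length_map).
      apply map_nth.
    + f_equal. extensionality i. now rewrite Nat.add_succ_r.
Qed.

Theorem prodY_rational (us : list V) (w : W) (f : W -> C) :
  Wd f -> exists p : poly, forall z, prod_dom (length us) z ->
    abs_conv_to (length us) (prod_term Y f us w z)
      (ratval (length us) p (fun i => N (nth i us vzero) w)
        (fun i j => M (nth i us vzero) (nth j us vzero)) z).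
Proof.
  intros Hf. set (F := fun ks => f (prodY Y us ks w)).
  destruct (regular_abs_conv_poly (length us) (ev (pole_op 0 us w) F)) as [p Hp].
  - apply sum_bounded_ev, (fm_sum _ _ _ _ _ HW), Hf.
  - intros ks j Hl Hj HP. now apply prodY_regular with j.
  - exists p. intros z Hz. unfold ratval.
    rewrite <- (val_pole_op z 0). change (prod_term Y f us w z) with (tm z F).
    apply abs_conv_div_pole_factor; auto.
    + apply pole_factor_pole_op. lia.
    + intros i j Hij Hj. now apply prodY_diag_trunc.
Qed.

End Rationality.

Theorem mainTheorem1
  (V : VSpace) (projV : Z -> V -> V) (dV : V -> V) (YV : V -> V -> Z -> V) (one : V)
  (HV : is_MOSVA V projV dV YV one)
  (HVpole : pole_order_condition projV YV)
  (W : VSpace) (projW : C -> W -> W) (YW : V -> W -> Z -> W) (dW DW : W -> W)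
  (HW : weak_left_module V projV dV YV one W projW YW dW DW) :
  exists (N : V -> W -> nat) (M : V -> V -> nat),
  forall (n : nat) (us : list V) (w : W) (w' : W -> C),
    (1 <= n)%nat -> length us = n -> in_graded_dual projW w' ->
    exists (p : poly) (a : nat -> nat) (b : nat -> nat -> nat),
      (forall i, (i < n)%nat -> (a i <= N (nth i us vzero) w)%nat) /\
      (forall i j, (i < j)%nat -> (j < n)%nat -> (b i j <= M (nth i us vzero) (nth j us vzero))%nat) /\
      (forall z : nat -> C, prod_dom n z ->
         abs_conv_to n (prod_term YW w' us w z) (ratval n p a b z)).
Proof.
  assert (GV : graded_map V projV dV V Z CofZ projV dV YV).
  { destruct HV. split; auto using CofZ_inj.
    destruct mosva_lower as [r Hr]. exists (IZR r). intros i v Hi. apply Hr. now apply lt_IZR. }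
  assert (GW : graded_map V projV dV W C (fun m => m) projW dW YW).
  { destruct HV, HW. split; auto. }
  (* V is taken as a module over itself; its bound M becomes the pole order at z_i = z_j. *)
  destruct (formal_module_of_graded _ _ _ _ _ _ _ _ _ _ GV GV) as [M HM].
  { apply HV. } { apply HV. } { exact HVpole. }
  destruct (formal_module_of_graded _ _ _ _ _ _ _ _ _ _ GV GW) as [N HN].
  { apply HW. } { apply HW. } { apply HW. }
  exists N, M. intros n us w w' _ <- Hw'.
  destruct (prodY_rational V W YV YW _ _ N M HM HN us w w' Hw') as [p Hp].
  exists p, (fun i => N (nth i us vzero) w), (fun i j => M (nth i us vzero) (nth j us vzero)).
  split; [auto|split; auto].
Qed.
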